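(* Let $M$ be the round two-dimensional sphere, of constant Gaussian curvature $\kappa>0$, let $\mu>0$ be a constant, and let $(u,p)$, defined for $t\ge 0$, be a solution of the Navier–Stokes system \[ u_t+\nabla_u u-\mu\, Lu+\mathsf{grad}(p)=0,\qquad \mathsf{div}(u)=0 \] on $M$. Decompose $u=u^K+u^\perp$, where $u^K$ is Killing and $u^\perp$ is $L^2$-orthogonal to all Killing vector fields, and let $\zeta^\perp=\mathsf{rot}(u^\perp)$ be the corresponding component of the vorticity $\zeta=\mathsf{rot}(u)=\mathsf{rot}(u^K)+\mathsf{rot}(u^\perp)$. Then there is a constant $C$ (independent of $t$) such that for all $t\ge 0$ \[ \|\zeta^\perp\|^2\le Ce^{-8\mu\kappa t}. \]
   Context: All fields are smooth. $\nabla$ is the Levi-Civita connection, $\mathsf{grad}(p)=g^{ij}p_{;j}$, $\mathsf{div}(u)=u^i_{;i}$. In $u^k_{;ij}$ the rightmost index is the last covariant derivative taken. $Lu=\mathsf{div}(Su)$ with $(Su)^{kj}=g^{ki}u^j_{;i}+g^{ij}u^k_{;i}$, i.e. $(Lu)^j=g^{ki}u^j_{;ik}+g^{ij}u^k_{;ik}$. A vector field $u$ is Killing if $Su=0$. The sphere is oriented, and in positively oriented coordinates $\varepsilon=\sqrt{\det g}\,(dx_1\otimes dx_2-dx_2\otimes dx_1)$; $(Ku)^k=g^{ki}\varepsilon_{ij}u^j=\varepsilon^k_j u^j$ and $\mathsf{rot}(u)=\mathsf{div}(Ku)=\varepsilon^k_j u^j_{;k}$. $\|f\|^2=\int_M f^2\,\omega_M$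 for functions; $L^2$-orthogonality of vector fields is with respect to $\int_M g(u,v)\,\omega_M$. *)

(* Defs.v *)
From HB Require Import structures.
From mathcomp Require Import all_boot all_order all_algebra.
From mathcomp Require Import all_classical all_reals all_analysis.

Set Implicit Arguments.
Unset Strict Implicit.
Unset Printing Implicit Defensive.

Import Order.TTheory GRing.Theory Num.Theory.
Import numFieldNormedType.Exports.

Local Open Scope classical_set_scope.
Local Open Scope ring_scope.

(* For finite-dimensional V this is the usual class C^k: a C^1 function is
   Fréchet differentiable, and differentiability implies continuity. *)
Fixpoint Ck (R : realType) (V : normedModType R) (k : nat) (f : V -> R) : Prop :=
  if k is k'.+1 then
    (forall x : V, differentiable f x) /\ (forall v : V, Ck k' (fun x => 'D_v f x))
  else continuous f.

Definition smooth (R : realType) (V : normedModType R) (f : V -> R) : Prop :=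
  forall k : nat, Ck k f.

(* Smoothness on the closed set [0, +oo[ x V, in the usual sense for sets that
   are not open: f is there the restriction of a smooth function. *)
Definition smooth_halfline (R : realType) (V : normedModType R)
    (f : R -> V -> R) : Prop :=
  exists F : R * V -> R,
    smooth F /\ forall (t : R) (x : V), 0 <= t -> F (t, x) = f t x.

(* Derivative of a function of t in [0, +oo[: two-sided at t > 0, one-sided
   at t = 0. *)
Definition dt (R : realType) (f : R -> R) (t : R) : R :=
  lim ((fun h : R => h^-1 * (f (t + h) - f t))
         @ within [set h : R | 0 <= t + h] (0 : R)^').

Definition dot (R : realType) (n : nat) (a b : 'rV[R]_n) : R :=
  \sum_k a 0 k * b 0 k.

Definition coord_dir (R : realType) (i : 'I_2) : R * R :=
  if i == 0 then (1, 0) else (0, 1).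

Definition pd (R : realType) (W : normedModType R) (i : 'I_2) (f : R * R -> W)
    (x : R * R) : W :=
  'D_(coord_dir R i) f x.

Definition metric (R : realType) (sigma : R * R -> 'rV[R]_3) (x : R * R) :
    'M[R]_2 :=
  \matrix_(i, j) dot (pd i sigma x) (pd j sigma x).

Definition metric_inv (R : realType) (sigma : R * R -> 'rV[R]_3) (x : R * R) :
    'M[R]_2 :=
  invmx (metric sigma x).

Definition christoffel (R : realType) (sigma : R * R -> 'rV[R]_3)
    (k i j : 'I_2) (x : R * R) : R :=
  2^-1 * \sum_l metric_inv sigma x k l *
    (pd i (fun y => metric sigma y l j) x
     + pd j (fun y => metric sigma y i l) x
     - pd l (fun y => metric sigma y i j) x).

(* A vector field in coordinates is given by its contravariant components
   U k, k = 0, 1; components sigma v are those of the tangent field v, i.e.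
   v (sigma x) = \sum_k components sigma v k x *: pd k sigma x. *)
Definition components (R : realType) (sigma : R * R -> 'rV[R]_3)
    (v : 'rV[R]_3 -> 'rV[R]_3) (k : 'I_2) (x : R * R) : R :=
  \sum_l metric_inv sigma x k l * dot (v (sigma x)) (pd l sigma x).

(* u^k_{;i} *)
Definition cov1 (R : realType) (sigma : R * R -> 'rV[R]_3)
    (U : 'I_2 -> R * R -> R) (k i : 'I_2) (x : R * R) : R :=
  pd i (U k) x + \sum_l christoffel sigma k i l x * U l x.

(* u^k_{;ij}, the derivative with respect to j being taken last *)
Definition cov2 (R : realType) (sigma : R * R -> 'rV[R]_3)
    (U : 'I_2 -> R * R -> R) (k i j : 'I_2) (x : R * R) : R :=
  pd j (cov1 sigma U k i) x
  + \sum_l christoffel sigma k j l x * cov1 sigma U l i x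
  - \sum_l christoffel sigma l j i x * cov1 sigma U k l x.

Definition grad (R : realType) (sigma : R * R -> 'rV[R]_3) (f : R * R -> R)
    (k : 'I_2) (x : R * R) : R :=
  \sum_j metric_inv sigma x k j * pd j f x.

Definition divergence (R : realType) (sigma : R * R -> 'rV[R]_3)
    (U : 'I_2 -> R * R -> R) (x : R * R) : R :=
  \sum_i cov1 sigma U i i x.

Definition nabla (R : realType) (sigma : R * R -> 'rV[R]_3)
    (U V : 'I_2 -> R * R -> R) (k : 'I_2) (x : R * R) : R :=
  \sum_i U i x * cov1 sigma V k i x.

Definition opS (R : realType) (sigma : R * R -> 'rV[R]_3)
    (U : 'I_2 -> R * R -> R) (k j : 'I_2) (x : R * R) : R :=
  \sum_i (metric_inv sigma x k i * cov1 sigma U j i x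
          + metric_inv sigma x i j * cov1 sigma U k i x).

(* div (S U), where g is taken out of the covariant derivative *)
Definition opL (R : realType) (sigma : R * R -> 'rV[R]_3)
    (U : 'I_2 -> R * R -> R) (j : 'I_2) (x : R * R) : R :=
  \sum_k \sum_i (metric_inv sigma x k i * cov2 sigma U j i k x
                 + metric_inv sigma x i j * cov2 sigma U k i k x).

Definition area_density (R : realType) (sigma : R * R -> 'rV[R]_3)
    (x : R * R) : R :=
  Num.sqrt (\det (metric sigma x)).

(* the tensor epsilon, for a positively oriented sigma *)
Definition epsilon (R : realType) (sigma : R * R -> 'rV[R]_3) (i j : 'I_2)
    (x : R * R) : R :=
  area_density sigma x *
  (((i == 0) && (j == 1))%:R - ((i == 1) && (j == 0))%:R).

Definition opK (R : realType) (sigma : R * R -> 'rV[R]_3)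
    (U : 'I_2 -> R * R -> R) (k : 'I_2) (x : R * R) : R :=
  \sum_i \sum_j metric_inv sigma x k i * epsilon sigma i j x * U j x.

Definition vrot (R : realType) (sigma : R * R -> 'rV[R]_3)
    (U : 'I_2 -> R * R -> R) (x : R * R) : R :=
  divergence sigma (opK sigma U) x.

Definition inner (R : realType) (sigma : R * R -> 'rV[R]_3)
    (U V : 'I_2 -> R * R -> R) (x : R * R) : R :=
  \sum_i \sum_j metric sigma x i j * U i x * V j x.

(* The round sphere of curvature kappa, of radius 1 / sqrt kappa, centred at 0 in
   3-space, with the induced metric and the orientation given by the outward
   normal.  Fields on it are functions on the ambient space of which only the
   values on the sphere matter. *)
Definition sphere (R : realType) (kappa : R) : set 'rV[R]_3 :=
  [set y | dot y y = kappa^-1].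

(* Stereographic parametrizations: chart kappa false covers the sphere minus
   the pole (0, 0, - 1 / sqrt kappa), chart kappa true the sphere minus the
   opposite pole.  The second one is the first one followed by the rotation
   by pi around the first axis, so that both are positively oriented.  In both
   the metric is 4 / (1 + kappa |x|^2)^2 times the Euclidean one. *)
Definition chart (R : realType) (kappa : R) (s : bool) (x : R * R) : 'rV[R]_3 :=
  let r2 := x.1 ^+ 2 + x.2 ^+ 2 in
  (1 + kappa * r2)^-1 *:
  \row_(k < 3)
    (if k == 0 then 2 * x.1
     else if k == 1 then (-1) ^+ s * (2 * x.2)
     else (-1) ^+ s * ((Num.sqrt kappa)^-1 * (1 - kappa * r2))).

Definition smooth_field (R : realType) (kappa : R) (v : 'rV[R]_3 -> 'rV[R]_3) :
    Prop :=
  (forall y, sphere kappa y -> dot (v y) y = 0) /\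
  (forall (s : bool) (k : 'I_2), smooth (components (chart kappa s) v k)).

Definition killing (R : realType) (kappa : R) (v : 'rV[R]_3 -> 'rV[R]_3) :
    Prop :=
  smooth_field kappa v /\
  forall (s : bool) (k j : 'I_2) (x : R * R),
    opS (chart kappa s) (components (chart kappa s) v) k j x = 0.

(* Integral over the sphere of a function given by its expression F in the
   coordinates chart kappa false, which omit only one point. *)
Definition sphere_integral (R : realType) (kappa : R) (F : R * R -> R) : \bar R :=
  (\int[(@lebesgue_measure R \x @lebesgue_measure R)%E]_x
     (F x * area_density (chart kappa false) x)%:E)%E.

Definition orthogonal_to_killing (R : realType) (kappa : R)
    (v : 'rV[R]_3 -> 'rV[R]_3) : Prop :=
  forall w : 'rV[R]_3 -> 'rV[R]_3, killing kappa w ->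
    sphere_integral kappa
      (inner (chart kappa false) (components (chart kappa false) v)
                                 (components (chart kappa false) w)) = 0%E.

Definition vrot_norm2 (R : realType) (kappa : R) (v : 'rV[R]_3 -> 'rV[R]_3) :
    \bar R :=
  sphere_integral kappa
    (fun x => vrot (chart kappa false) (components (chart kappa false) v) x ^+ 2).

(* Smooth solutions on [0, +oo[ x sphere; the equations are required in the
   coordinates of both charts. *)
Record navier_stokes (R : realType) (kappa mu : R)
    (u : R -> 'rV[R]_3 -> 'rV[R]_3) (p : R -> 'rV[R]_3 -> R) : Prop := {
  ns_tangent : forall (t : R) (y : 'rV[R]_3),
    0 <= t -> sphere kappa y -> dot (u t y) y = 0 ;
  ns_smooth_u : forall (s : bool) (k : 'I_2),
    smooth_halfline (fun t => components (chart kappa s) (u t) k) ;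
  ns_smooth_p : forall s : bool,
    smooth_halfline (fun t (x : (R * R)%type) => p t (chart kappa s x)) ;
  ns_momentum : forall (s : bool) (k : 'I_2) (t : R) (x : R * R), 0 <= t ->
    let sigma := chart kappa s in
    let U := components sigma (u t) in
    dt (fun t' => components sigma (u t') k x) t
    + nabla sigma U U k x
    - mu * opL sigma U k x
    + grad sigma (fun z => p t (sigma z)) k x = 0 ;
  ns_incompressible : forall (s : bool) (t : R) (x : R * R), 0 <= t ->
    divergence (chart kappa s) (components (chart kappa s) (u t)) x = 0
}.

(* Main.v *)
Require Import Defs.
From HB Require Import structures.
From mathcomp Require Import all_boot all_order all_algebra.
From mathcomp Require Import all_classical all_reals all_analysis.
From mathcomp Require Import measurable_realfun complex ring lra.

Set Implicit Arguments.
Unset Strict Implicit.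
Unset Printing Implicit Defensive.

Import Order.TTheory GRing.Theory Num.Theory.
Import numFieldNormedType.Exports.

Local Open Scope classical_set_scope.
Local Open Scope ring_scope.

Import Normc.

(** In a stereographic chart a vector field is a complex function [w] of z, and the operators become
    complex ones. Let lam^2 |dz|^2 be the metric and let [d], [db] be twice the Wirtinger
    derivatives. Then [curl w], which is lam^-2 d (lam^2 w), equals div u + i rot u; [db w] encodes
    the trace-free part of S u; and for div u = 0 the field L u is [lap w], which is lam^-4 d (lam^2
    db w). Objects on the sphere are pairs of chart expressions related by a weight ([tensor]).
    Stokes' theorem on the sphere ([tensor_flux]) makes [twist 2] minus the adjoint of [db]
    ([pairing_adjoint]), and curvature enters only through the commutator [db_twist].

    The quantity followed in time is not the vorticity but the deformation of the whole field u, the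
    integral of |db w|^2. It does not see Killing fields, so u and its component orthogonal to them
    have the same deformation, and no evolution equation for that component alone is needed. With
    the convection term written as rot u times the rotated field plus a gradient ([nabla_cfield]),
    both the convection and the gradient vanish when paired with L u ([pairing_lap_curl],
    [pairing_lap_grad]). Hence the deformation has time derivative - 2 mu times the integral of |L
    u|^2. A Bochner argument ([dissipation_deformation]) bounds that integral below by 4 kappa times
    the deformation, and the rate 8 mu kappa follows by Gronwall ([deformation_decay]).

    To return to the vorticity: for a divergence-free field the enstrophy is the deformation plus 2
    kappa times the energy ([deformation_enstrophy]), so it remains to bound the energy of the
    orthogonal component by its deformation. This is a Korn inequality ([korn]). The holomorphic
    fields [quad] form a real space of dimension 6, spanned by the three rotations and by the
    gradients of the three ambient coordinates; a divergence-free field is orthogonal to gradients,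
    so the orthogonal component is orthogonal to all six ([orth_quad]). For such a field, Stokes'
    theorem with a Cauchy kernel centred at a point a bounds |w(a)| by a weighted integral of |db w|
    / |x - a| ([korn_integral]). Young's inequality and Schur's test turn this pointwise bound into
    the L^2 one. *)

Local Notation Re := complex.Re.
Local Notation Im := complex.Im.

(** * Calculus of smooth functions and symmetry of second derivatives *)

Section SmoothFunctions.
Variables (R : realType) (V : normedModType R).
Implicit Types f g : V -> R.

Lemma smooth_differentiable f : smooth f -> forall x, differentiable f x.
Proof. by move=> sf x; have [+ _] := sf 1%N; exact. Qed.

Lemma smooth_continuous f : smooth f -> continuous f.
Proof. by move=> sf; exact: (sf 0%N). Qed.

Lemma smooth_derivable f x v : smooth f -> derivable f x v.
Proof. by move=> sf; exact/diff_derivable/smooth_differentiable. Qed.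

Arguments smooth_derivable [f] x v _.

Lemma smooth_derive f v : smooth f -> smooth (fun x => 'D_v f x).
Proof. by move=> sf k; have [_] := sf k.+1; exact. Qed.

Lemma CkS k f : Ck k.+1 f -> Ck k f.
Proof.
elim: k f => [|k IH] f [df sf].
  by move=> x; exact/differentiable_continuous.
by split=> // v; apply: IH; exact: sf.
Qed.

Lemma Ck_cst k (c : R) : Ck k (fun _ : V => c).
Proof.
elim: k c => [|k IH] c; first exact: cst_continuous.
split=> [x|v]; first exact: differentiable_cst.
under eq_fun do rewrite derive_cst; exact: IH.
Qed.

Lemma CkD k f g : Ck k f -> Ck k g -> Ck k (fun x => f x + g x).
Proof.
elim: k f g => [|k IH] f g; first by move=> cf cg x; apply: cvgD; [exact: cf|exact: cg].
move=> [df sf] [dg sg]; split=> [x|v]; first exact: differentiableD.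
have -> : (fun x => 'D_v (fun x => f x + g x) x) =
   (fun x => 'D_v f x + 'D_v g x).
  by apply/funext => x; rewrite deriveD //; apply: diff_derivable.
by apply: IH; [exact: sf|exact: sg].
Qed.

Lemma CkM k f g : Ck k f -> Ck k g -> Ck k (fun x => f x * g x).
Proof.
elim: k f g => [|k IH] f g; first by move=> cf cg x; apply: cvgM; [exact: cf|exact: cg].
move=> cf cg; have [df sf] := cf; have [dg sg] := cg.
split=> [x|v]; first exact: differentiableM.
have -> : (fun x => 'D_v (fun x => f x * g x) x) =
   (fun x => f x * 'D_v g x + g x * 'D_v f x).
  by apply/funext => x; rewrite deriveM //; apply: diff_derivable.
by apply: CkD; apply: IH; (exact: CkS || exact: sg || exact: sf).
Qed.

Lemma CkV k f : (forall x, f x != 0) -> Ck k f -> Ck k (fun x => (f x)^-1).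
Proof.
move=> f0; elim: k => [|k IH]; first by move=> cf x; apply: cvgV; [|exact: cf].
move=> cf; have [df sf] := cf.
split=> [x|v]; first exact: differentiableV.
have -> : (fun x => 'D_v (fun x => (f x)^-1) x) =
   (fun x => -1 * (((f x)^-1 * (f x)^-1) * 'D_v f x)).
  apply/funext => x; rewrite deriveV //; last by apply: diff_derivable.
  by rewrite mulN1r -invfM -expr2 scaleNr.
have ? := IH (CkS cf).
by apply: CkM; [exact: Ck_cst|apply: CkM; [exact: CkM|exact: sf]].
Qed.

Lemma smooth_cst (c : R) : smooth (fun _ : V => c).
Proof. by move=> k; exact: Ck_cst. Qed.

Lemma smoothD f g : smooth f -> smooth g -> smooth (fun x => f x + g x).
Proof. by move=> sf sg k; exact: CkD. Qed.

Lemma smoothM f g : smooth f -> smooth g -> smooth (fun x => f x * g x).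
Proof. by move=> sf sg k; exact: CkM. Qed.

Lemma smoothV f : (forall x, f x != 0) -> smooth f ->
  smooth (fun x => (f x)^-1).
Proof. by move=> f0 sf k; exact: CkV. Qed.

Lemma smoothN f : smooth f -> smooth (fun x => - f x).
Proof.
move=> sf; have -> : (fun x => - f x) = (fun x => -1 * f x).
  by apply/funext => x; rewrite mulN1r.
by apply: smoothM => //; exact: smooth_cst.
Qed.

Lemma smoothB f g : smooth f -> smooth g -> smooth (fun x => f x - g x).
Proof. by move=> sf sg; exact/smoothD/smoothN. Qed.

Lemma is_derive_line (W : normedModType R) (f : V -> W) (x u : V) (t : R) :
  derivable f (x + t *: u) u ->
  is_derive t 1 (fun s : R => f (x + s *: u)) ('D_u f (x + t *: u)).
Proof.
move=> df; have E : (fun h : R => h^-1 *: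
     (((fun s : R => f (x + s *: u)) \o shift t) (h *: (1 : R)) - f (x + t *: u)))
   = (fun h => h^-1 *: ((f \o shift (x + t *: u)) (h *: u) - f (x + t *: u))).
  apply/funext => h /=; congr (_ *: (f _ - _)).
  by rewrite scalerDl -[h *: 1]/(h * 1) mulr1 addrCA.
apply: DeriveDef; first by rewrite /derivable E.
by rewrite /derive E.
Qed.

(** The mean value theorem is applied along [a] to the increment of [f] in the direction [b], and
    then along [b] to the derivative so obtained. *)
Lemma second_difference f (a b x : V) (h : R) : smooth f -> 0 < h ->
  exists s t : R, [/\ 0 <= s <= h, 0 <= t <= h &
    f (x + h *: a + h *: b) - f (x + h *: a) - (f (x + h *: b) - f x) =
    h * h * 'D_b (fun y => 'D_a f y) (x + s *: a + t *: b)].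
Proof.
move=> sf h0.
pose G (s : R) := f ((x + h *: b) + s *: a) - f (x + s *: a).
have dG (s : R) : is_derive s 1 G
    ('D_a f ((x + h *: b) + s *: a) - 'D_a f (x + s *: a)).
  have d1 := @is_derive_line _ f (x + h *: b) a s (smooth_derivable _ _ sf).
  have d2 := @is_derive_line _ f x a s (smooth_derivable _ _ sf).
  exact: is_deriveB d1 d2.
have [s sh Es] := @MVT_segment R G _ 0 h (ltW h0) (fun s _ => dG s)
   (continuous_subspaceT (fun s => differentiable_continuous
      (proj1 (derivable1_diffP _ _) (@ex_derive _ _ _ _ _ _ _ (dG s))))).
pose H (t : R) := 'D_a f ((x + s *: a) + t *: b).
have dH (t : R) : is_derive t 1 H
    ('D_b (fun y => 'D_a f y) ((x + s *: a) + t *: b)).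
  exact: (@is_derive_line _ (fun y => 'D_a f y) (x + s *: a) b t
    (smooth_derivable _ _ (smooth_derive _ sf))).
have [t th Et] := @MVT_segment R H _ 0 h (ltW h0) (fun s _ => dH s)
   (continuous_subspaceT (fun s => differentiable_continuous
      (proj1 (derivable1_diffP _ _) (@ex_derive _ _ _ _ _ _ _ (dH s))))).
exists s, t; split; [by move: sh; rewrite in_itv|by move: th; rewrite in_itv|].
transitivity (G h - G 0); first by rewrite /G scale0r !addr0 (addrAC x); ring.
rewrite Es subr0; transitivity ((H h - H 0) * h).
  by rewrite /H scale0r addr0 (addrAC x).
by rewrite Et subr0; ring.
Qed.

(* Both mixed derivatives are limits of the same second difference, by the
   mean value theorem applied in the two possible orders. *)
Lemma derive_swap f (u v : V) (x : V) : smooth f ->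
  'D_u (fun y => 'D_v f y) x = 'D_v (fun y => 'D_u f y) x.
Proof.
move=> sf.
pose A y : R := 'D_u (fun y => 'D_v f y) y.
pose B y : R := 'D_v (fun y => 'D_u f y) y.
rewrite -/(A x) -/(B x).
have cA : continuous A.
  exact: (smooth_continuous (smooth_derive u (smooth_derive v sf))).
have cB : continuous B.
  exact: (smooth_continuous (smooth_derive v (smooth_derive u sf))).
have DA : forall h : R, 0 < h -> exists s t : R, [/\ 0 <= s <= h, 0 <= t <= h &
    f (x + h *: v + h *: u) - f (x + h *: v) - (f (x + h *: u) - f x) =
    h * h * A (x + s *: v + t *: u)] by move=> h; exact: second_difference.
have DB : forall h : R, 0 < h -> exists s t : R, [/\ 0 <= s <= h, 0 <= t <= h &
    f (x + h *: u + h *: v) - f (x + h *: u) - (f (x + h *: v) - f x) =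
    h * h * B (x + s *: u + t *: v)] by move=> h; exact: second_difference.
clearbody A B; apply/eqP; rewrite -subr_eq0 -normr_le0; apply/ler_addgt0Pr => e e0.
have e20 : 0 < e / 2 by rewrite divr_gt0.
have /cvgrPdist_lt/(_ _ e20)/nbhs_ballP[d1 /= d10 A1] := cA x.
have /cvgrPdist_lt/(_ _ e20)/nbhs_ballP[d2 /= d20 A2] := cB x.
(* With the step h = d / (2 N), the intermediate points of both second differences lie in the ball
   of radius [d] about [x]. *)
pose d : R := Num.min d1 d2; pose N : R := `|u| + `|v| + 1.
have N0 : 0 < N by rewrite /N ltr_wpDl // addr_ge0.
have d0 : 0 < d by rewrite /d lt_min d10 d20.
pose h : R := d / N / 2; have h0 : 0 < h by rewrite !divr_gt0.
have near_x (s t : R) a b : `|a| + `|b| + 1 = N -> 0 <= s <= h ->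
    0 <= t <= h -> ball x d (x + s *: a + t *: b).
  move=> abN /andP[s0 sh] /andP[t0 th]; rewrite -ball_normE /ball_ /=.
  rewrite -addrA opprD addNKr normrN (le_lt_trans (ler_normD _ _)) //.
  rewrite !normrZ !ger0_norm //.
  apply: (@le_lt_trans _ _ (h * (N - 1))).
    by rewrite -abN addrK mulrDr lerD // ler_wpM2r.
  apply: (@le_lt_trans _ _ (d / 2)); last first.
    by rewrite ltr_pdivrMr // ltr_pMr // ltr1n.
  rewrite /h mulrAC ler_pM2r ?invr_gt0 // -mulrA ger_pMr // mulrC.
  by rewrite ler_pdivrMr // mul1r lerBlDr lerDl.
have [s [t [hs ht E1]]] := DA h h0.
have [s' [t' [hs' ht' E2]]] := DB h h0.
have E3 : h * h * A (x + s *: v + t *: u) = h * h * B (x + s' *: u + t' *: v).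
  have subACA (a b c e' : R) : a - b - (c - e') = a - c - (b - e') by ring.
  by rewrite -E1 -E2 subACA (addrAC x (h *: v)).
have hh0 : h * h != 0 by rewrite mulf_neq0 // gt_eqF.
have Eq := mulfI hh0 E3.
have dd1 : d <= d1 by rewrite ge_min lexx.
have dd2 : d <= d2 by rewrite ge_min lexx orbT.
have N' : `|v| + `|u| + 1 = N by rewrite (addrC `|v|).
have B1 := A1 _ (le_ball dd1 (near_x s t v u N' hs ht)).
have B2 := A2 _ (le_ball dd2 (near_x s' t' u v erefl hs' ht')).
have {}B1 : `|A x - B (x + s' *: u + t' *: v)| < e / 2 by rewrite -Eq.
have {}B2 : `|B x - B (x + s' *: u + t' *: v)| < e / 2 := B2.
have subBB (a b c : R) : a - b = (a - c) - (b - c) by ring.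
rewrite (subBB _ _ (B (x + s' *: u + t' *: v))).
rewrite add0r (le_trans (ler_normB _ _)) // [leRHS](splitr e).
by rewrite lerD // ltW.
Qed.

End SmoothFunctions.

(** * Space and time sections of a smooth function on time x space *)

Section Sections.
Variables (R : realType) (V : normedModType R).
Implicit Types F : R * V -> R.

Lemma is_derive_section F t x v : differentiable F (t, x) ->
  differentiable (fun y => F (t, y)) x /\
  'D_v (fun y => F (t, y)) x = 'D_((0, v) : R * V) F (t, x).
Proof.
move=> dF; have dp : differentiable (fun y : V => (t, y)) x.
  by apply: differentiable_pair.
have dc : differentiable (fun y => F (t, y)) x.
  exact: (@differentiable_comp _ _ _ _ (fun y => (t, y)) F).
split=> //; rewrite deriveE // (@diff_comp _ _ _ _ (fun y => (t, y)) F) //=.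
by rewrite diff_pair // diff_cst diff_val -deriveE.
Qed.

Lemma smooth_section F t : smooth F -> smooth (fun x => F (t, x)).
Proof.
move=> sF k; elim: k F sF => [|k IH] F sF.
  move=> x; apply: differentiable_continuous.
  by apply: (@is_derive_section _ _ _ 0 _).1; exact: smooth_differentiable.
split=> [x|v].
  by apply: (@is_derive_section _ _ _ 0 _).1; exact: smooth_differentiable.
have -> : (fun x => 'D_v (fun y => F (t, y)) x) =
    (fun x => 'D_((0, v) : R * V) F (t, x)).
  apply/funext => x; apply: (@is_derive_section _ _ _ v _).2.
  exact: smooth_differentiable.
by apply: (IH (fun y => 'D_((0, v) : R * V) F y)); exact: smooth_derive.
Qed.

Lemma is_derive_time F t x : differentiable F (t, x) ->
  is_derive t (1 : R) (fun s => F (s, x)) ('D_((1, 0) : R * V) F (t, x)).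
Proof.
move=> dF.
have := @is_derive_line _ _ _ F (0, x) (1, 0) t.
have E s : ((0, x) : R * V) + s *: (1, 0) = (s, x).
  by congr pair => /=; [rewrite add0r -[s *: _]/(s * 1) mulr1|rewrite scaler0 addr0].
under eq_fun do rewrite E.
rewrite E; apply; exact: diff_derivable.
Qed.

End Sections.

(** * The coordinate functions of the plane *)

Fact fst_linear (R : realType) : linear (fst : R * R -> R). Proof. by []. Qed.
HB.instance Definition _ (R : realType) := GRing.isLinear.Build R (R * R)%type R _ fst (@fst_linear R).
Fact snd_linear (R : realType) : linear (snd : R * R -> R). Proof. by []. Qed.
HB.instance Definition _ (R : realType) := GRing.isLinear.Build R (R * R)%type R _ snd (@snd_linear R).
Lemma is_diff_fst (R : realType) (x : R * R) : is_diff x fst fst.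
Proof.
have c : continuous (fst : R * R -> R) by move=> y; exact: cvg_fst.
by apply: DiffDef; [exact: linear_differentiable|exact: diff_lin].
Qed.
Lemma is_diff_snd (R : realType) (x : R * R) : is_diff x snd snd.
Proof.
have c : continuous (snd : R * R -> R) by move=> y; exact: cvg_snd.
by apply: DiffDef; [exact: linear_differentiable|exact: diff_lin].
Qed.
Lemma derive_coord1 (R : realType) (x v : R * R) :
  'D_v (fun y : R * R => y.1) x = v.1.
Proof.
have d := is_diff_fst x; rewrite deriveE; last exact: ex_diff.
by rewrite [LHS]/= diff_val.
Qed.

Lemma derive_coord2 (R : realType) (x v : R * R) :
  'D_v (fun y : R * R => y.2) x = v.2.
Proof.
have d := is_diff_snd x; rewrite deriveE; last exact: ex_diff.
by rewrite [LHS]/= diff_val.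
Qed.

Lemma smooth_coord1 (R : realType) : smooth (fun x : R * R => x.1).
Proof.
case=> [|k]; first by move=> x; exact: cvg_fst.
split=> [x|v]; first by have d := is_diff_fst x; exact: ex_diff.
under eq_fun do rewrite derive_coord1; exact: Ck_cst.
Qed.

Lemma smooth_coord2 (R : realType) : smooth (fun x : R * R => x.2).
Proof.
case=> [|k]; first by move=> x; exact: cvg_snd.
split=> [x|v]; first by have d := is_diff_snd x; exact: ex_diff.
under eq_fun do rewrite derive_coord2; exact: Ck_cst.
Qed.

(** * Complex-valued functions on the plane *)

HB.lock Definition cpd (R : realType) (i : 'I_2) (f : R * R -> R[i])
    (x : R * R) : R[i] :=
  (pd i (fun y => Re (f y)) x +i* pd i (fun y => Im (f y)) x)%C.

(* [dc (-'i)] and [dc 'i] are twice the Wirtinger derivatives *)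
HB.lock Definition dc (R : realType) (e : R[i]) (f : R * R -> R[i])
    (x : R * R) : R[i] :=
  cpd 0 f x + e * cpd 1 f x.

Section Wirtinger.
Variable R : realType.
Local Notation C := R[i].
Implicit Types (f g : R * R -> C) (r : R * R -> R) (x : R * R).

Definition cdiff f x :=
  differentiable (fun y => Re (f y)) x /\ differentiable (fun y => Im (f y)) x.

Definition csmooth f :=
  smooth (fun y => Re (f y)) /\ smooth (fun y => Im (f y)).

Lemma reM (z w : C) : Re (z * w) = Re z * Re w - Im z * Im w.
Proof. by case: z w => [a b] [c d]. Qed.

Lemma imM (z w : C) : Im (z * w) = Re z * Im w + Im z * Re w.
Proof. by case: z w => [a b] [c d]. Qed.

Lemma reD (z w : C) : Re (z + w) = Re z + Re w.
Proof. by case: z w => [a b] [c d]. Qed.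

Lemma imD (z w : C) : Im (z + w) = Im z + Im w.
Proof. by case: z w => [a b] [c d]. Qed.

Lemma reN (z : C) : Re (- z) = - Re z. Proof. by case: z. Qed.

Lemma imN (z : C) : Im (- z) = - Im z. Proof. by case: z. Qed.

Lemma reV (z : C) : Re z^-1 = Re z * (Re z * Re z + Im z * Im z)^-1.
Proof. by case: z => a b /=; rewrite !expr2. Qed.

Lemma imV (z : C) : Im z^-1 = - (Im z * (Re z * Re z + Im z * Im z)^-1).
Proof. by case: z => a b /=; rewrite !expr2. Qed.

Lemma reJ (z : C) : Re (conjc z) = Re z. Proof. by case: z. Qed.

Lemma imJ (z : C) : Im (conjc z) = - Im z. Proof. by case: z. Qed.

Lemma complex_eqP (z w : C) : Re z = Re w -> Im z = Im w -> z = w.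
Proof. by case: z w => [a b] [c d] /= -> ->. Qed.

Lemma norm2_neq0 (z : C) : z != 0 -> Re z * Re z + Im z * Im z != 0.
Proof.
apply: contra; rewrite paddr_eq0 -?expr2 ?sqr_ge0 // !sqrf_eq0.
by case: z => a b /= /andP[/eqP -> /eqP ->].
Qed.

Lemma pdM i r1 r2 x : differentiable r1 x -> differentiable r2 x ->
  pd i (fun y => r1 y * r2 y) x = r1 x * pd i r2 x + r2 x * pd i r1 x.
Proof. by move=> d1 d2; rewrite /pd deriveM //; exact: diff_derivable. Qed.

Lemma pdD i r1 r2 x : differentiable r1 x -> differentiable r2 x ->
  pd i (fun y => r1 y + r2 y) x = pd i r1 x + pd i r2 x.
Proof. by move=> d1 d2; rewrite /pd deriveD //; exact: diff_derivable. Qed.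

Lemma pdN i r1 x : differentiable r1 x ->
  pd i (fun y => - r1 y) x = - pd i r1 x.
Proof. by move=> d1; rewrite /pd deriveN //; exact: diff_derivable. Qed.

Lemma pdB i r1 r2 x : differentiable r1 x -> differentiable r2 x ->
  pd i (fun y => r1 y - r2 y) x = pd i r1 x - pd i r2 x.
Proof. by move=> d1 d2; rewrite /pd deriveB //; exact: diff_derivable. Qed.

Lemma pdV i r1 x : r1 x != 0 -> differentiable r1 x ->
  pd i (fun y => (r1 y)^-1) x = - (r1 x) ^- 2 * pd i r1 x.
Proof. by move=> r0 d1; rewrite /pd deriveV //; exact: diff_derivable. Qed.

Lemma pd_cst i (c : R) x : pd i (fun _ => c) x = 0.
Proof. exact: derive_cst. Qed.

Lemma cdiffD f g x : cdiff f x -> cdiff g x -> cdiff (fun y => f y + g y) x.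
Proof.
move=> [f1 f2] [g1 g2]; split; under eq_fun do rewrite ?reD ?imD;
  exact: differentiableD.
Qed.

Lemma cdiffN f x : cdiff f x -> cdiff (fun y => - f y) x.
Proof.
move=> [f1 f2]; split; under eq_fun do rewrite ?reN ?imN;
  exact: differentiableN.
Qed.

Lemma cdiffB f g x : cdiff f x -> cdiff g x -> cdiff (fun y => f y - g y) x.
Proof. by move=> df dg; apply: cdiffD => //; exact: cdiffN. Qed.

Lemma cdiffM f g x : cdiff f x -> cdiff g x -> cdiff (fun y => f y * g y) x.
Proof.
move=> [f1 f2] [g1 g2]; split; under eq_fun do rewrite ?reM ?imM.
  by apply: differentiableB; exact: differentiableM.
by apply: differentiableD; exact: differentiableM.
Qed.

Lemma cdiffJ f x : cdiff f x -> cdiff (fun y => conjc (f y)) x.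
Proof.
move=> [f1 f2]; split; under eq_fun do rewrite ?reJ ?imJ; first by [].
exact: differentiableN.
Qed.

Lemma cdiff_norm2 f x : cdiff f x ->
  differentiable (fun y => Re (f y) * Re (f y) + Im (f y) * Im (f y)) x.
Proof. by move=> [f1 f2]; apply: differentiableD; exact: differentiableM. Qed.

Lemma cdiffV f x : f x != 0 -> cdiff f x -> cdiff (fun y => (f y)^-1) x.
Proof.
move=> f0 df; have [f1 f2] := df; have dn := cdiff_norm2 df.
have dV := differentiableV dn (norm2_neq0 f0).
split; under eq_fun do rewrite ?reV ?imV; first exact: differentiableM.
by apply: differentiableN; exact: differentiableM.
Qed.

Lemma cdiff_real r x : differentiable r x -> cdiff (fun y => (r y)%:C%C) x.
Proof. by move=> dr; split=> //=; exact: differentiable_cst. Qed.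

Lemma cdiff_cst (c : C) x : cdiff (fun _ => c) x.
Proof. by split; exact: differentiable_cst. Qed.

Lemma csmooth_cdiff f x : csmooth f -> cdiff f x.
Proof. by move=> [f1 f2]; split; exact: smooth_differentiable. Qed.

Lemma cpdD i f g x : cdiff f x -> cdiff g x ->
  cpd i (fun y => f y + g y) x = cpd i f x + cpd i g x.
Proof.
move=> [f1 f2] [g1 g2]; apply: complex_eqP; rewrite cpd.unlock ?reD ?imD /= -pdD //;
  by under eq_fun do rewrite ?reD ?imD.
Qed.

Lemma cpdN i f x : cdiff f x -> cpd i (fun y => - f y) x = - cpd i f x.
Proof.
move=> [f1 f2]; apply: complex_eqP; rewrite cpd.unlock ?reN ?imN /= -pdN //;
  by under eq_fun do rewrite ?reN ?imN.
Qed.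

Lemma cpdM i f g x : cdiff f x -> cdiff g x ->
  cpd i (fun y => f y * g y) x = cpd i f x * g x + f x * cpd i g x.
Proof.
move=> [f1 f2] [g1 g2]; rewrite cpd.unlock.
under eq_fun do rewrite reM.
under [X in (_ +i* pd i X x)%C]eq_fun do rewrite imM.
rewrite pdB ?pdD ?pdM //; try exact: differentiableM.
by apply: complex_eqP; rewrite ?reD ?imD ?reM ?imM /=; ring.
Qed.

Lemma cpdJ i f x : cdiff f x ->
  cpd i (fun y => conjc (f y)) x = conjc (cpd i f x).
Proof.
move=> [f1 f2]; rewrite cpd.unlock.
under eq_fun do rewrite reJ.
under [X in (_ +i* pd i X x)%C]eq_fun do rewrite imJ.
by rewrite pdN.
Qed.

Lemma cpdV i f x : f x != 0 -> cdiff f x ->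
  cpd i (fun y => (f y)^-1) x = - (cpd i f x / (f x * f x)).
Proof.
move=> f0 df; have [f1 f2] := df; have dn := cdiff_norm2 df.
have dV := differentiableV dn (norm2_neq0 f0).
have n0 := norm2_neq0 f0.
rewrite cpd.unlock; under eq_fun do rewrite reV.
under [X in (_ +i* pd i X x)%C]eq_fun do rewrite imV.
have dM (r1 : R * R -> R) := @differentiableM _ _ r1.
rewrite pdN ?pdM ?pdV // ?pdD ?pdM //; try exact: differentiableM.
set a := Re (f x) in n0 *; set b := Im (f x) in n0 *.
have -> : f x = (a +i* b)%C by rewrite /a /b; case: (f x).
apply: complex_eqP; rewrite ?reN ?imN ?reM ?imM /= ?expr2.
  set p := pd i _ x; set q := pd i _ x.
  have n1 : (a * a - b * b) ^+ 2 + (a * b + b * a) ^+ 2 = (a * a + b * b) ^+ 2 by ring.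
  rewrite !expr2 in n1; rewrite n1; field; exact/n0.
set p := pd i _ x; set q := pd i _ x.
have n1 : (a * a - b * b) ^+ 2 + (a * b + b * a) ^+ 2 = (a * a + b * b) ^+ 2 by ring.
by rewrite !expr2 in n1; rewrite n1; field; exact/n0.
Qed.

Lemma cpd_real i r x : cpd i (fun y => (r y)%:C%C) x = (pd i r x)%:C%C.
Proof. by rewrite cpd.unlock /= pd_cst. Qed.

Lemma cpd_cst i (c : C) x : cpd i (fun _ => c) x = 0.
Proof. by rewrite cpd.unlock /= !pd_cst. Qed.

Variable e : C.

Lemma dcD f g x : cdiff f x -> cdiff g x ->
  dc e (fun y => f y + g y) x = dc e f x + dc e g x.
Proof. by move=> df dg; rewrite dc.unlock !cpdD //; ring. Qed.

Lemma dcN f x : cdiff f x -> dc e (fun y => - f y) x = - dc e f x.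
Proof. by move=> df; rewrite dc.unlock !cpdN //; ring. Qed.

Lemma dcB f g x : cdiff f x -> cdiff g x ->
  dc e (fun y => f y - g y) x = dc e f x - dc e g x.
Proof. by move=> df dg; rewrite dcD ?dcN //; exact: cdiffN. Qed.

Lemma dcM f g x : cdiff f x -> cdiff g x ->
  dc e (fun y => f y * g y) x = dc e f x * g x + f x * dc e g x.
Proof. by move=> df dg; rewrite dc.unlock !cpdM //; ring. Qed.

Lemma dcV f x : f x != 0 -> cdiff f x ->
  dc e (fun y => (f y)^-1) x = - (dc e f x / (f x * f x)).
Proof. by move=> f0 df; rewrite dc.unlock !cpdV //; ring. Qed.

Lemma dc_cst (c : C) x : dc e (fun _ => c) x = 0.
Proof. by rewrite dc.unlock !cpd_cst mulr0 addr0. Qed.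

Lemma dcZ (c : C) f x : cdiff f x -> dc e (fun y => c * f y) x = c * dc e f x.
Proof.
by move=> df; rewrite dcM // ?dc_cst ?mul0r ?add0r //; exact: cdiff_cst.
Qed.

End Wirtinger.

Section WirtingerSmooth.
Variable R : realType.
Local Notation C := R[i].
Implicit Types (f g : R * R -> C) (r : R * R -> R) (x : R * R).

Lemma dcJ e f x : cdiff f x ->
  dc e (fun y => conjc (f y)) x = conjc (dc (conjc e) f x).
Proof. by move=> df; rewrite dc.unlock !cpdJ // rmorphD rmorphM /= conjcK. Qed.

Lemma csmoothD f g : csmooth f -> csmooth g -> csmooth (fun y => f y + g y).
Proof.
move=> [f1 f2] [g1 g2]; split; under eq_fun do rewrite ?reD ?imD; exact: smoothD.
Qed.

Lemma csmoothN f : csmooth f -> csmooth (fun y => - f y).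
Proof.
move=> [f1 f2]; split; under eq_fun do rewrite ?reN ?imN; exact: smoothN.
Qed.

Lemma csmoothB f g : csmooth f -> csmooth g -> csmooth (fun y => f y - g y).
Proof. by move=> sf sg; apply: csmoothD => //; exact: csmoothN. Qed.

Lemma csmoothM f g : csmooth f -> csmooth g -> csmooth (fun y => f y * g y).
Proof.
move=> [f1 f2] [g1 g2]; split; under eq_fun do rewrite ?reM ?imM.
  by apply: smoothB; exact: smoothM.
by apply: smoothD; exact: smoothM.
Qed.

Lemma csmoothJ f : csmooth f -> csmooth (fun y => conjc (f y)).
Proof.
move=> [f1 f2]; split; under eq_fun do rewrite ?reJ ?imJ; first by [].
exact: smoothN.
Qed.

Lemma csmooth_real r : smooth r -> csmooth (fun y => (r y)%:C%C).
Proof. by move=> sr; split=> //=; exact: smooth_cst. Qed.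

Lemma csmooth_cst (c : C) : csmooth (fun _ => c).
Proof. by split; exact: smooth_cst. Qed.

Lemma csmooth_cpd i f : csmooth f -> csmooth (cpd i f).
Proof. by move=> [f1 f2]; rewrite cpd.unlock; split; exact: smooth_derive. Qed.

Lemma csmooth_dc e f : csmooth f -> csmooth (dc e f).
Proof.
move=> sf; rewrite dc.unlock; apply: csmoothD; first exact: csmooth_cpd.
by apply: csmoothM; [exact: csmooth_cst|exact: csmooth_cpd].
Qed.

Lemma cpd_swap i j f : csmooth f -> cpd i (cpd j f) = cpd j (cpd i f).
Proof.
move=> [f1 f2]; apply/funext => x.
by rewrite cpd.unlock /pd /= (derive_swap _ _ _ f1) (derive_swap _ _ _ f2).
Qed.

Lemma dc_swap e e' f x : csmooth f -> dc e (dc e' f) x = dc e' (dc e f) x.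
Proof.
move=> sf; have s0 := csmooth_cpd 0 sf; have s1 := csmooth_cpd 1 sf.
have dM (c : C) y : cdiff (fun z => c * cpd 1 f z) y.
  by apply: cdiffM; [exact: cdiff_cst|exact: csmooth_cdiff].
rewrite dc.unlock !(@cpdD _ _ (cpd 0 f)) //; try exact: csmooth_cdiff.
rewrite !cpdM; try exact: cdiff_cst; try exact: csmooth_cdiff.
by rewrite !cpd_cst (cpd_swap 0 1 sf); ring.
Qed.

Definition zc (x : R * R) : C := (x.1 +i* x.2)%C.

Lemma csmooth_zc : csmooth zc.
Proof. by split; [exact: smooth_coord1|exact: smooth_coord2]. Qed.

Lemma cpd0_zc x : cpd 0 zc x = 1.
Proof. by rewrite cpd.unlock /pd /= derive_coord1 derive_coord2. Qed.

Lemma cpd1_zc x : cpd 1 zc x = 'i%C.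
Proof. by rewrite cpd.unlock /pd /= derive_coord1 derive_coord2. Qed.

Lemma dc_zc e x : dc e zc x = 1 + e * 'i%C.
Proof. by rewrite dc.unlock cpd0_zc cpd1_zc. Qed.

Lemma derive_comp r (phi : R * R -> R * R) x v :
  differentiable phi x -> differentiable r (phi x) ->
  'D_v (fun y => r (phi y)) x = 'd r (phi x) ('d phi x v).
Proof.
move=> dphi dr; apply: (etrans (deriveE v (differentiable_comp dphi dr))).
exact: (congr1 (fun h => h v) (diff_comp dphi dr)).
Qed.

Lemma diff_pd r x v : differentiable r x ->
  'd r x v = pd 0 r x * v.1 + pd 1 r x * v.2.
Proof.
move=> dr; rewrite /pd !deriveE //.
have {1}-> : v = v.1 *: coord_dir R 0 + v.2 *: coord_dir R 1.
  case: v => v1 v2; rewrite /coord_dir /=; congr pair => /=.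
    by rewrite -[v1 *: 1]/(v1 * 1) -[v2 *: 0]/(v2 * 0) mulr1 mulr0 addr0.
  by rewrite -[v1 *: 0]/(v1 * 0) -[v2 *: 1]/(v2 * 1) mulr1 mulr0 add0r.
by rewrite linearD !linearZ /=; congr (_ + _); exact: mulrC.
Qed.

Lemma cpd_comp i f (phi : R * R -> R * R) x :
  differentiable phi x -> cdiff f (phi x) ->
  cpd i (fun y => f (phi y)) x =
    cpd 0 f (phi x) * (pd i (fun y => (phi y).1) x)%:C%C
    + cpd 1 f (phi x) * (pd i (fun y => (phi y).2) x)%:C%C.
Proof.
move=> dphi [f1 f2]; have d1 := is_diff_fst (phi x); have d2 := is_diff_snd (phi x).
rewrite cpd.unlock; set v := coord_dir R i.
have E1 : pd i (fun y => (phi y).1) x = ('d phi x v).1.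
  apply: (etrans (@derive_comp fst _ _ v dphi ex_diff)).
  by rewrite /= diff_val.
have E2 : pd i (fun y => (phi y).2) x = ('d phi x v).2.
  apply: (etrans (@derive_comp snd _ _ v dphi ex_diff)).
  by rewrite /= diff_val.
have E3 : pd i (fun y => Re (f (phi y))) x =
    pd 0 (fun y => Re (f y)) (phi x) * ('d phi x v).1 +
    pd 1 (fun y => Re (f y)) (phi x) * ('d phi x v).2.
  exact: (etrans (derive_comp v dphi f1) (diff_pd _ f1)).
have E4 : pd i (fun y => Im (f (phi y))) x =
    pd 0 (fun y => Im (f y)) (phi x) * ('d phi x v).1 +
    pd 1 (fun y => Im (f y)) (phi x) * ('d phi x v).2.
  exact: (etrans (derive_comp v dphi f2) (diff_pd _ f2)).
rewrite E1 E2 E3 E4; set a1 := pd 0 _ _; set a2 := pd 1 _ _.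
set b1 := pd 0 _ _; set b2 := pd 1 _ _; move: a1 a2 b1 b2 ('d phi x v) => a1 a2 b1 b2 u.
by apply: complex_eqP; rewrite ?reD ?imD ?reM ?imM /=; ring.
Qed.

End WirtingerSmooth.

(** * Borel functions for the product sigma-algebra of the plane *)

Section PlaneMeasurability.
Variable R : realType.

(** The sigma-algebra is the product one, so an open set has to be exhibited as a countable union of
    boxes; those with rational centre and half-width 1 / (n + 1) suffice. *)
Lemma open_measurable_plane (U : set (R * R)) : open U -> measurable U.
Proof.
move=> oU.
pose box (i : rat * rat * nat) : set (R * R) :=
  ball (ratr i.1.1 : R) (i.2.+1%:R^-1) `*` ball (ratr i.1.2 : R) (i.2.+1%:R^-1).
pose F i : set (R * R) := if `[< box i `<=` U >] then box i else set0.
have -> : U = \bigcup_i F i.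
  apply/seteqP; split => [x Ux|x [i _]]; last first.
    by rewrite /F; case: asboolP => // + xb; exact.
  have /nbhs_ballP[e /= e0 eU] : nbhs x U by exact: open_nbhs_nbhs.
  pose n := Num.truncn (2 / e).
  have ne : n.+1%:R^-1 < e / 2.
    rewrite -[ltRHS]invrK ltf_pV2 ?posrE ?invr_gt0 ?divr_gt0 // invf_div.
    by rewrite /n truncnS_gt.
  have n0 : 0 < n.+1%:R^-1 :> R by rewrite invr_gt0.
  have key (d : R) : 0 < d -> d < e / 2 -> exists q : rat * rat,
    [/\ ball (ratr q.1 : R) d x.1, ball (ratr q.2 : R) d x.2 &
      ball (ratr q.1 : R) d `*` ball (ratr q.2 : R) d `<=` U].
    move=> d0 de.
    have /rat_in_itvoo[q1] : x.1 - d < x.1 + d by lra.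
    rewrite in_itv /= => /andP[q1a q1b].
    have /rat_in_itvoo[q2] : x.2 - d < x.2 + d by lra.
    rewrite in_itv /= => /andP[q2a q2b].
    have b1 : ball (ratr q1 : R) d x.1.
      by rewrite -ball_normE /ball_ /= ltr_norml; apply/andP; split; lra.
    have b2 : ball (ratr q2 : R) d x.2.
      by rewrite -ball_normE /ball_ /= ltr_norml; apply/andP; split; lra.
    exists (q1, q2); split=> // -[y1 y2] [/= y1b y2b]; apply: eU; split => /=.
      apply: (@le_ball _ _ _ (d + d)); first lra.
      exact: ball_triangle (ball_sym b1) y1b.
    apply: (@le_ball _ _ _ (d + d)); first lra.
    exact: ball_triangle (ball_sym b2) y2b.
  have [[q1 q2] [b1 b2 bU]] := key _ n0 ne.
  by exists (q1, q2, n) => //; rewrite /F; case: asboolP.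
apply: countable_bigcupT_measurable; first exact: countableP.
move=> i; rewrite /F; case: asboolP => // _.
by apply: measurableX; apply: open_measurable; exact: ball_open.
Qed.

(** A point is closed, hence measurable, so the behaviour of the function there is irrelevant. This
    serves for the kernels that are singular at [z]. *)
Lemma punctured_measurable_plane (f : R * R -> R) (z : R * R) :
  (forall x, x != z -> {for x, continuous f}) -> measurable_fun setT f.
Proof.
move=> cf; have cz : closed [set z].
  exact: (accessible_closed_set1 (hausdorff_accessible (@norm_hausdorff _ _))).
have mz : measurable [set z].
  rewrite -(setCK [set z]); apply: measurableC; apply: open_measurable_plane.
  exact: closed_openC.
move=> _; apply: (measurability _ (RGenOInfty.measurableE R)) => //.
move=> /= _ [_ [a ->] <-]; rewrite setTI.
have -> : f @^-1` `]a, +oo[%classic =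
    (~` [set z] `&` [set x | a < f x]) `|` ([set z] `&` [set x | a < f x]).
  by rewrite -setIUl setUCl setTI; apply/seteqP; split => x /=;
    rewrite in_itv /= andbT.
apply: measurableU; last first.
  have [az|az] := pselect (a < f z).
    by rewrite setIidl // => x ->.
  rewrite (_ : _ `&` _ = set0) //; apply/seteqP; split => // x [-> /=].
  by move=> /az.
apply: open_measurable_plane; rewrite openE => x [/= /eqP xz ax]; apply: filterI.
  by apply: open_nbhs_nbhs; split => //; [exact: closed_openC|exact/eqP].
have := cf x xz; move=> /(_ [set y | a < y]); apply.
by apply: open_nbhs_nbhs; split => //; exact: open_gt.
Qed.

Lemma continuous_measurable_plane (f : R * R -> R) :
  continuous f -> measurable_fun setT f.
Proof. by move=> cf; apply: (@punctured_measurable_plane f 0) => x _; exact: cf. Qed.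

End PlaneMeasurability.

(** * Integrals over the line and an explicit integrable singularity *)

Section LineIntegrals.
Variable R : realType.
Local Notation mu := (@lebesgue_measure R).

Lemma integral_derive_itv (f F : R -> R) (a b : R) : a < b ->
  (forall x : R, a <= x <= b -> is_derive x (1 : R) F (f x)) ->
  (forall x : R, a <= x <= b -> {for x, continuous f}) ->
  (\int[mu]_(x in `[a, b]) (f x)%:E = (F b - F a)%:E)%E.
Proof.
move=> ab dF cf.
have cF x : a <= x <= b -> {for x, continuous F}.
  move=> xab; apply: differentiable_continuous; apply/derivable1_diffP.
  by have := dF x xab => d; exact: ex_derive.
have ia : a <= a <= b by rewrite lexx ltW.
have ib : a <= b <= b by rewrite lexx ltW.
rewrite (@continuous_FTC2 R f F) ?EFinB //.
- apply: continuous_in_subspaceT => x; rewrite inE /= in_itv; exact: cf.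
- split => [x|  |].
  + rewrite in_itv /= => /andP[ax xb].
    by have := dF x; rewrite !ltW // => /(_ isT) d; exact: ex_derive.
  + exact: cvg_at_right_filter (cF a ia).
  + exact: cvg_at_left_filter (cF b ib).
- move=> x; rewrite in_itv /= => /andP[ax xb].
  by have := dF x; rewrite !ltW // derive1E => /(_ isT) d; exact: derive_val.
Qed.

(** The fundamental theorem of calculus on [- (n + 1), n + 1], followed by dominated convergence
    with |f| as majorant. *)
Lemma integral_derive_line (f F : R -> R) :
  (forall x : R, is_derive x (1 : R) F (f x)) -> continuous f ->
  mu.-integrable setT (EFin \o f) ->
  F x @[x --> +oo] --> (0 : R) -> F x @[x --> -oo] --> (0 : R) ->
  (\int[mu]_x (f x)%:E = 0)%E.
Proof.
move=> dF cf intf Fy FNy.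
pose A (n : nat) := `[- n.+1%:R, n.+1%:R]%classic : set R.
have AE n : (\int[mu]_(x in A n) (f x)%:E = (F n.+1%:R - F (- n.+1%:R))%:E)%E.
  apply: integral_derive_itv => // [|x _]; last exact: cf.
  by rewrite (@lt_trans _ _ 0) // oppr_lt0.
pose fn (n : nat) (x : R) := ((EFin \o f) \_ (A n)) x.
have mf : measurable_fun setT (EFin \o f) by exact: measurable_int intf.
have mfn n : measurable_fun setT (fn n).
  by apply/(measurable_restrictT _ (measurable_itv _)); exact: measurable_funTS.
have [|||||_ _ cv] := @dominated_convergence _ _ _ mu setT measurableT fn
  (EFin \o f) (abse \o (EFin \o f)) => //.
- apply: aeW => x _; apply: cvg_near_cst.
  exists (Num.truncn `|x|) => // n /= xn.
  rewrite /fn patchE ifT // inE /A /= in_itv /= -ler_norml.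
  by rewrite (le_trans (ltW (truncnS_gt _))) // ler_nat ltnS.
- exact: integrable_abse.
- apply: aeW => x n _; rewrite /fn patchE; case: ifP => //= _.
  by rewrite normr0 lee_fin.
have cv0 : (\int[mu]_x fn n x)%E @[n --> \oo] --> (0 : \bar R)%E.
  under eq_fun do rewrite /fn -integral_mkcond AE.
  apply: cvg_EFin; first exact: nearW.
  rewrite -[X in _ --> X](subr0 0) /comp /=; apply: cvgB.
    apply: (@cvg_comp _ _ _ (fun n : nat => n.+1%:R : R) F) Fy.
    rewrite (cvg_shiftS (fun n : nat => n%:R : R)); exact: cvgr_idn.
  apply: (@cvg_comp _ _ _ (fun n : nat => - n.+1%:R : R) F) FNy.
  apply/cvgNrNy.
  rewrite (cvg_shiftS (fun n : nat => n%:R : R)); exact: cvgr_idn.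
exact: (cvg_unique _ cv cv0).
Qed.

(* The density [g x = 1 / (sqrt |x| (1 + |x|))] is at the same time integrable
   near 0 and at infinity; it takes care of the singularity of the Cauchy
   kernel and of the decay of the fields. *)
Definition spike (x : R) : R := (Num.sqrt `|x| * (1 + `|x|))^-1.

Lemma spike_ge0 x : 0 <= spike x.
Proof. by rewrite invr_ge0 mulr_ge0 ?sqrtr_ge0 // addr_ge0. Qed.

Lemma continuous_spike x : x != 0 -> {for x, continuous spike}.
Proof.
move=> x0; have nx : `|x| != 0 by rewrite normr_eq0.
have cn : `|y| @[y --> x] --> `|x| by apply: cvg_norm; exact: cvg_id.
apply: cvgV.
  by rewrite mulf_neq0 ?sqrtr_eq0 -?ltNge ?lt_def ?nx ?normr_ge0 // gt_eqF // ltr_wpDr.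
apply: cvgM; last by apply: cvgD => //; exact: cvg_cst.
by apply: (@cvg_comp _ _ _ _ Num.sqrt) cn _; exact: sqrt_continuous.
Qed.

Lemma spikeN x : spike (- x) = spike x.
Proof. by rewrite /spike normrN. Qed.

(** The sign [e] selects the side of the singularity [a]; on that side a primitive of the spike is 2
    e atan (sqrt |x - a|), whose range has length at most pi. *)
Lemma is_derive_atan_sqrt (e a x : R) : e ^+ 2 = 1 -> 0 < e * (x - a) ->
  is_derive x (1 : R) (fun y => e * (2 * atan (Num.sqrt (e * (y - a)))))
    (spike (x - a)).
Proof.
move=> e2 x0; set g := fun y => e * (y - a).
have d1 := is_derive1_sqrt x0.
have d2 := is_derive1_atan (Num.sqrt (g x)).
have d0 : is_derive x (1 : R) g e.
  by apply: is_derive_eq; rewrite subr0 /GRing.scale /= mulr1.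
have d3 := @is_derive1_comp _ Num.sqrt g x _ _ d1 d0.
have d4 : is_derive x (1 : R) (fun y => atan (Num.sqrt (g y))) _ :=
  @is_derive1_comp _ atan (fun y => Num.sqrt (g y)) x _ _ d2 d3.
have d5 := @is_deriveZ _ _ _ _ (e * 2) x 1 _ d4.
rewrite (_ : (fun y => _) = (e * 2) \*: (fun y => atan (Num.sqrt (g y)))); last first.
  by apply/funext => y; rewrite mulrA.
apply: (is_derive_eq d5).
have E : `|x - a| = g x.
  have e1 : e = 1 \/ e = -1.
    have /eqP : (e - 1) * (e + 1) = 0 by rewrite -subr_sqr e2 expr1n subrr.
    by rewrite mulf_eq0 subr_eq0 addr_eq0 => /orP[/eqP|/eqP]; [left|right].
  rewrite /g; move: x0; case: e1 => ->; rewrite ?mul1r ?mulN1r => x0.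
    by rewrite gtr0_norm.
  by rewrite ltr0_norm // -oppr_gt0.
rewrite /spike E sqr_sqrtr ?(ltW x0) // /GRing.scale /= -/(g x).
have s0 : Num.sqrt (g x) != 0 by rewrite gt_eqF // sqrtr_gt0.
have g1 : 1 + g x != 0 by rewrite gt_eqF // ltr_wpDr // ltW.
rewrite -/(g x); set q := Num.sqrt (g x) in s0 *.
transitivity (e ^+ 2 * ((1 + g x)^-1 / q)); last by rewrite e2 mul1r invfM mulrC.
by field; rewrite s0 g1.
Qed.

Lemma integral_spike_side (e a c d : R) : e ^+ 2 = 1 -> c < d ->
  (forall x, c <= x <= d -> 0 < e * (x - a)) ->
  (\int[mu]_(x in `[c, d]) (spike (x - a))%:E <= (pi : R)%:E)%E.
Proof.
move=> e2 cd sgn.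
pose F x := e * (2 * atan (Num.sqrt (e * (x - a)))).
have -> : (\int[mu]_(x in `[c, d]) (spike (x - a))%:E = (F d - F c)%:E)%E.
  apply: integral_derive_itv => // [x xcd|x /sgn x0].
    by apply: is_derive_atan_sqrt => //; exact: sgn.
  apply: (@cvg_comp _ _ _ (fun y => y - a) spike).
    by apply: cvgB; [exact: cvg_id|exact: cvg_cst].
  by apply: continuous_spike; apply: contraTneq x0 => ->; rewrite mulr0 ltxx.
have e1 : e = 1 \/ e = -1.
  have /eqP : (e - 1) * (e + 1) = 0 by rewrite -subr_sqr e2 expr1n subrr.
  by rewrite mulf_eq0 subr_eq0 addr_eq0 => /orP[/eqP|/eqP]; [left|right].
have at0 (y : R) : 0 <= atan (Num.sqrt y) by rewrite -atan0 le_atan // sqrtr_ge0.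
have at1 (y : R) : atan (Num.sqrt y) < pi / 2 by exact: atan_ltpi2.
have := at0 (e * (c - a)); have := at0 (e * (d - a)).
have := at1 (e * (c - a)); have := at1 (e * (d - a)).
by rewrite lee_fin /F; case: e1 => -> ; lra.
Qed.

Lemma measurable_spike : measurable_fun setT spike.
Proof.
rewrite -(setUv [set 0 : R]); apply/measurable_funU => //.
  exact: measurableC.
split.
  apply: (eq_measurable_fun (cst (spike 0))); last exact: measurable_cst.
  by move=> x; rewrite inE /= => ->.
apply: open_continuous_measurable_fun => [|x].
  by apply: closed_openC; exact: (@closed_eq _ 0).
by rewrite inE /= => /eqP; exact: continuous_spike.
Qed.

Lemma measurable_spike_shift (a : R) :
  measurable_fun setT (fun x : R => spike (x - a)).
Proof.
apply: (measurableT_comp measurable_spike).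
by apply: measurable_funB => //; exact: measurable_cst.
Qed.

Lemma spike0 : spike 0 = 0.
Proof. by rewrite /spike normr0 sqrtr0 mul0r invr0. Qed.

Lemma integral_spike (a : R) :
  (\int[mu]_x (spike ((x : R) - a))%:E <= (2 * pi : R)%:E)%E.
Proof.
(* The sets [A n] exhaust the line without [a], each side contributing at most pi. At [a] itself the
   integrand is 0, because 0^-1 = 0. *)
pose L (n : nat) : set R := `[a - n.+2%:R, a - n.+1%:R^-1]%classic.
pose U (n : nat) : set R := `[a + n.+1%:R^-1, a + n.+2%:R]%classic.
pose A n := L n `|` U n.
have mL n : measurable (L n) by exact: measurable_itv.
have mU n : measurable (U n) by exact: measurable_itv.
have mA n : measurable (A n) by exact: measurableU.
have mf : measurable_fun setT (fun x : R => (spike (x - a))%:E).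
  by apply/measurable_EFinP; exact: measurable_spike_shift.
have n0 (n : nat) : 0 < n.+1%:R^-1 :> R by rewrite invr_gt0.
have n2 (n : nat) : n.+1%:R^-1 < n.+2%:R :> R.
  by rewrite (@le_lt_trans _ _ 1) ?invf_le1 ?ler1n ?ltr1n.
have leA n : (\int[mu]_(x in A n) (spike (x - a))%:E <= (2 * pi : R)%:E)%E.
  rewrite (ge0_integral_setU mu (mL n) (mU n)); last 3 first.
  - exact: measurable_funTS.
  - by move=> x _; rewrite lee_fin spike_ge0.
  - rewrite disj_set2E; apply/eqP; rewrite -subset0 => x [] /=.
    rewrite /L /U /= !in_itv /= => /andP[_ h1] /andP[h2 _].
    have aux (y e : R) : y <= a - e -> a + e <= y -> 0 < e -> False by lra.
    exact: aux h1 h2 (n0 n).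
  rewrite mulr_natl mulr2n EFinD; apply: leeD.
    apply: (@integral_spike_side (-1)); first by rewrite sqrrN expr1n.
      by rewrite ltrD2l ltrN2.
    move=> x /andP[_ h]; rewrite mulN1r opprB subr_gt0 (le_lt_trans h) //.
    by rewrite gtrBl.
  apply: (@integral_spike_side 1); first by rewrite expr1n.
    by rewrite ltrD2l.
  move=> x /andP[h _]; rewrite mul1r subr_gt0 (lt_le_trans _ h) //.
  by rewrite ltrDl.
have ndA : nondecreasing_seq A.
  move=> m n mn; apply/subsetPset => x.
  have h1 : n.+1%:R^-1 <= m.+1%:R^-1 :> R by rewrite lef_pV2 ?posrE // ler_nat.
  have h2 : m.+2%:R <= n.+2%:R :> R by rewrite ler_nat.
  case; rewrite /L /U /= in_itv /= => /andP[xa xb]; [left|right];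
    rewrite /L /U /= in_itv /=.
    by rewrite (le_trans _ xa) ?(le_trans xb) // lerD2l lerN2.
  by rewrite (le_trans _ xa) ?(le_trans xb) // lerD2l.
have covA (x : R) : x != a -> (\bigcup_i A i) x.
  move=> xa.
  have xa0 : 0 < `|x - a| by rewrite normr_gt0 subr_eq0.
  pose d : R := `|x - a|; pose n := (Num.truncn d + Num.truncn d^-1%R)%N.
  have b1 : `|x - a| <= n.+2%:R.
    rewrite (le_trans (ltW (truncnS_gt _))) // ler_nat /n.
    by rewrite ltnS; apply: leq_trans (leqnSn _); exact: leq_addr.
  have b2 : n.+1%:R^-1 <= `|x - a|.
    rewrite -[leRHS]invrK lef_pV2 ?posrE ?invr_gt0 //.
    rewrite (le_trans (ltW (truncnS_gt _))) // ler_nat /n.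
    by rewrite ltnS leq_addl.
  exists n => //; move: b1 b2.
  have [h|h] := leP 0 (x - a).
    rewrite (ger0_norm h) => b1 b2; right; rewrite /U /= in_itv /=.
    by rewrite -lerBrDl b2 -lerBlDl.
  rewrite (ltr0_norm h) opprB => b1 b2; left; rewrite /L /= in_itv /=.
  by rewrite lerBlDr -lerBlDl b1 lerBrDr -lerBrDl.
have cvA : ((\int[mu]_(x in A i) (spike ((x : R) - a))%:E)%E @[i --> \oo] -->
    (\int[mu]_(x in \bigcup_i A i) (spike ((x : R) - a))%:E)%E).
  apply: ge0_nondecreasing_set_cvg_integral => // [n|n x _].
    exact: measurable_funTS.
  by rewrite lee_fin spike_ge0.
have -> : (\int[mu]_x (spike ((x : R) - a))%:E =
    \int[mu]_(x in \bigcup_i A i) (spike (x - a))%:E)%E.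
  rewrite [RHS]integral_mkcond; apply: eq_integral => x _.
  rewrite patchE; case: ifPn => // /negP xA.
  have [->|xa] := eqVneq x a; first by rewrite subrr spike0.
  exfalso.
  by apply: xA; rewrite inE; exact: covA.
by apply: (cvge_le _ cvA); exact: nearW.
Qed.

End LineIntegrals.

(** * Integrals over the plane, decay estimates and Stokes' theorem *)

Section PlaneIntegrals.
Variable R : realType.
Local Notation mu := (@lebesgue_measure R).
Local Notation mu2 := (@lebesgue_measure R \x @lebesgue_measure R)%E.

Definition plane_integrable (f : R * R -> R) : Prop :=
  mu2.-integrable setT (EFin \o f).

(** [fine] returns 0 on an infinite integral, so the value is meaningful when the function is
    [plane_integrable]. *)
Definition plane_int (f : R * R -> R) : R := fine (\int[mu2]_x (f x)%:E)%E.

Lemma ae_neq (a : R) : {ae mu, forall x : R, x != a}.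
Proof.
exists [set a]; split => //; first exact: lebesgue_measure_set1.
by move=> x /= /negP; rewrite negbK => /eqP.
Qed.

Lemma ae_notin (s : seq R) : {ae mu, forall x : R, x \notin s}.
Proof.
have aeF := ae_filter_ringOfSetsType mu; elim: s => [|a s IH].
  by apply: aeW => x; rewrite in_nil.
have := IH; have := ae_neq a; apply: filterS2 => x xa xs.
by rewrite inE negb_or xa.
Qed.

(** Tonelli's theorem with a product majorant. The majoration may fail on the finitely many lines
    with abscissa in [s] or ordinate in [t], which are negligible. *)
Lemma tonelli_product_bound (f : R * R -> R) (s t : seq R) (A B : R) (g h : R -> R) :
  measurable_fun setT f -> measurable_fun setT g -> measurable_fun setT h ->
  (forall x, 0 <= f x) -> (forall x, 0 <= g x) -> (forall y, 0 <= h y) ->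
  (forall x y, x \notin s -> y \notin t -> f (x, y) <= g x * h y) ->
  (\int[mu]_x (g x)%:E <= A%:E)%E -> (\int[mu]_x (h x)%:E <= B%:E)%E ->
  (\int[mu2]_x (f x)%:E <= (A * B)%:E)%E.
Proof.
move=> mf mg mh f0 g0 h0 fgh gA hB; have aeF := ae_filter_ringOfSetsType mu.
have A0 : 0 <= A by rewrite -lee_fin (le_trans _ gA) // integral_ge0 // => x _; rewrite lee_fin.
have mfE : measurable_fun setT (EFin \o f) by exact/measurable_EFinP.
have mgE : measurable_fun setT (EFin \o g) by exact/measurable_EFinP.
have mhE : measurable_fun setT (EFin \o h) by exact/measurable_EFinP.
rewrite (@fubini_tonelli2 _ _ _ _ _ mu mu (EFin \o f)) //.
apply: (@le_trans _ _ (\int[mu]_y (A%:E * (h y)%:E))%E).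
  apply: ae_ge0_le_integral => //.
  - by move=> y _; apply: integral_ge0 => x _; rewrite lee_fin.
  - by apply: measurable_fun_fubini_tonelli_G => // x; rewrite lee_fin.
  - by move=> y _; rewrite -EFinM lee_fin mulr_ge0.
  - by apply: emeasurable_funM => //; exact: measurable_cst.
  have := ae_notin t; apply: filterS => y yb _.
  apply: (@le_trans _ _ (\int[mu]_x ((h y)%:E * (g x)%:E))%E).
    apply: ae_ge0_le_integral => //.
    - by move=> x _; rewrite lee_fin.
    - by apply/measurable_EFinP; apply: (measurableT_comp mf);
        exact: measurable_pair2.
    - by move=> x _; rewrite -EFinM lee_fin mulr_ge0.
    - by apply: emeasurable_funM => //; exact: measurable_cst.
    have := ae_notin s; apply: filterS => x xa _.
    by rewrite -EFinM lee_fin mulrC fgh.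
  rewrite ge0_integralZl //; last by rewrite lee_fin.
    by rewrite muleC; apply: lee_wpmul2r => //; rewrite lee_fin.
  by move=> x _; rewrite lee_fin.
rewrite ge0_integralZl //; last by move=> x _; rewrite lee_fin.
by rewrite EFinM; apply: lee_wpmul2l => //; rewrite lee_fin.
Qed.

Lemma plane_integrable_bound (f : R * R -> R) (M : R) : measurable_fun setT f ->
  (\int[mu2]_x (`|f x|)%:E <= M%:E)%E -> plane_integrable f.
Proof.
move=> mf fM; apply/integrableP; split; first exact/measurable_EFinP.
by apply: (le_lt_trans fM); rewrite ltry.
Qed.

(* [line1 F] and [line2 F]: the two one-dimensional halves of the divergence
   theorem; the lines through a singular point are negligible. *)
Lemma plane_int_pd0 (F : R * R -> R) (z : R * R) :
  (forall x, x != z -> differentiable F x) ->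
  (forall x, x != z -> {for x, continuous (pd 0 F)}) ->
  plane_integrable (pd 0 F) ->
  (forall y, F (x, y) @[x --> +oo] --> (0 : R)) ->
  (forall y, F (x, y) @[x --> -oo] --> (0 : R)) ->
  (\int[mu2]_x (pd 0 F x)%:E = 0)%E.
Proof.
move=> dF cF iF Fy FNy; have aeF := ae_filter_ringOfSetsType mu.
rewrite -(@integral21_prod_meas1 _ _ _ _ _ mu mu (EFin \o pd 0 F)) //.
transitivity (\int[mu]_y (cst 0 y : \bar R))%E; last by rewrite integral0.
apply: ae_eq_integral => //; first exact: (measurable_fubini_G iF).
have := ae_integrable2 iF; have := ae_neq z.2; apply: filterS2 => y yz iy _.
apply: (@integral_derive_line _ (fun x => pd 0 F (x, y)) (fun x => F (x, y))) => //.
  move=> x; have xyz : (x, y) != z by apply: contraNneq yz => <-.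
  exact: is_derive_time (dF _ xyz).
move=> x; have xyz : (x, y) != z by apply: contraNneq yz => <-.
have cp : {for x, continuous (fun s : R => (s, y))}.
  by apply: differentiable_continuous; apply: differentiable_pair.
exact: (@cvg_comp _ _ _ _ _ _ _ _ cp (cF _ xyz)).
Qed.

Lemma plane_int_pd1 (F : R * R -> R) (z : R * R) :
  (forall x, x != z -> differentiable F x) ->
  (forall x, x != z -> {for x, continuous (pd 1 F)}) ->
  plane_integrable (pd 1 F) ->
  (forall x, F (x, y) @[y --> +oo] --> (0 : R)) ->
  (forall x, F (x, y) @[y --> -oo] --> (0 : R)) ->
  (\int[mu2]_x (pd 1 F x)%:E = 0)%E.
Proof.
move=> dF cF iF Fy FNy; have aeF := ae_filter_ringOfSetsType mu.
rewrite -(@integral12_prod_meas1 _ _ _ _ _ mu mu (EFin \o pd 1 F)) //.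
transitivity (\int[mu]_y (cst 0 y : \bar R))%E; last by rewrite integral0.
apply: ae_eq_integral => //; first exact: (measurable_fubini_F iF).
have := ae_integrable1 iF; have := ae_neq z.1; apply: filterS2 => x xz ix _.
apply: (@integral_derive_line _ (fun y => pd 1 F (x, y)) (fun y => F (x, y))) => //.
  move=> y; have xyz : (x, y) != z by apply: contraNneq xz => <-.
  have [d1 d2] := is_derive_section (1 : R) (dF _ xyz).
  by apply: DeriveDef; [exact: diff_derivable|exact: d2].
move=> y; have xyz : (x, y) != z by apply: contraNneq xz => <-.
have cp : {for y, continuous (fun s : R => (x, s))}.
  by apply: differentiable_continuous; apply: differentiable_pair.
exact: (@cvg_comp _ _ _ _ _ _ _ _ cp (cF _ xyz)).
Qed.

Variable kappa : R.
Hypothesis kappa0 : 0 < kappa.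

(** The conformal factor of the metric is 2 / rho^2; powers of [rho] measure the decay of fields
    towards the pole that the chart omits. *)
Definition rho (x : R * R) : R :=
  Num.sqrt (1 + kappa * (x.1 ^+ 2 + x.2 ^+ 2)).

(** The weight rho^-2 makes the Cauchy kernel decay like |x|^-3, so that it is integrable over the
    plane, at its singularity as well as at infinity. *)
Definition cauchy_kernel (z x : R * R) : R :=
  (rho x ^+ 2)^-1 * (normc (zc x - zc z))^-1.

Lemma rho_sqr x : rho x ^+ 2 = 1 + kappa * (x.1 ^+ 2 + x.2 ^+ 2).
Proof. by rewrite sqr_sqrtr // addr_ge0 // mulr_ge0 ?(ltW kappa0) // addr_ge0 // sqr_ge0. Qed.

Lemma rho_ge1 x : 1 <= rho x.
Proof.
rewrite -(@ler_sqr _ 1) ?nnegrE ?sqrtr_ge0 // expr1n rho_sqr lerDl.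
by rewrite mulr_ge0 ?(ltW kappa0) // addr_ge0 // sqr_ge0.
Qed.

Lemma rho_gt0 x : 0 < rho x.
Proof. exact: lt_le_trans (rho_ge1 x). Qed.

Lemma normcE2 (c : R[i]) : normc c ^+ 2 = Re c ^+ 2 + Im c ^+ 2.
Proof. by case: c => a b /=; rewrite sqr_sqrtr // addr_ge0 // sqr_ge0. Qed.

Lemma normc_ge0 (c : R[i]) : 0 <= normc c.
Proof. by case: c => a b; exact: sqrtr_ge0. Qed.

Lemma normc_gt0 (c : R[i]) : c != 0 -> 0 < normc c.
Proof.
move=> c0; rewrite lt_def normc_ge0 andbT; apply: contra c0 => /eqP.
by move=> /eq0_normc ->.
Qed.

Definition cauchy_factor (a s : R) : R := spike s + spike (s - a).

Lemma cauchy_factor_ge0 a s : 0 <= cauchy_factor a s.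
Proof. by rewrite addr_ge0 // spike_ge0. Qed.

(** Replacing the larger of |s| and |s - a| by the smaller one in its factor increases the product,
    which becomes the spike at 0 or the spike at [a]. *)
Lemma cauchy_factor_bound (a s : R) : s != a -> s != 0 ->
  (1 + `|s|)^-1 * (Num.sqrt `|s - a|)^-1 <= cauchy_factor a s.
Proof.
move=> sa s0; rewrite /cauchy_factor /spike.
have h1 : 0 < 1 + `|s| by rewrite ltr_wpDr.
have h2 : 0 < 1 + `|s - a| by rewrite ltr_wpDr.
have q1 : 0 < Num.sqrt `|s| by rewrite sqrtr_gt0 normr_gt0.
have q2 : 0 < Num.sqrt `|s - a| by rewrite sqrtr_gt0 normr_gt0 subr_eq0.
rewrite !invfM; have [h|h] := leP `|s - a| `|s|.
  apply: (@le_trans _ _ ((Num.sqrt `|s - a|)^-1 * (1 + `|s - a|)^-1)).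
    by rewrite mulrC ler_pM2l ?invr_gt0 // lef_pV2 ?posrE // lerD2l.
  by rewrite lerDr mulr_ge0 // invr_ge0 ltW.
apply: (@le_trans _ _ ((Num.sqrt `|s|)^-1 * (1 + `|s|)^-1)).
  by rewrite mulrC ler_pM2r ?invr_gt0 // lef_pV2 ?posrE // ler_wsqrtr // ltW.
by rewrite lerDl mulr_ge0 // invr_ge0 ltW.
Qed.

(** The variables separate by elementary quadratic inequalities: (1 + |x1|) (1 + |x2|) <= 2 (1 + 1 /
    kappa) rho^2 for the weight, and |x1 - z1| |x2 - z2| <= |x - z|^2 for the singular factor. *)
Lemma cauchy_kernel_bound (z x : R * R) : x.1 != z.1 -> x.2 != z.2 ->
  x.1 != 0 -> x.2 != 0 ->
  cauchy_kernel z x <= 2 * (1 + kappa^-1) *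
    (cauchy_factor z.1 x.1 * cauchy_factor z.2 x.2).
Proof.
move=> x1 x2 x10 x20; pose A : R := `|x.1|; pose B : R := `|x.2|.
have A0 : 0 <= A by exact: normr_ge0.
have B0 : 0 <= B by exact: normr_ge0.
have AE : x.1 ^+ 2 = A ^+ 2 by rewrite /A -normrX ger0_norm // sqr_ge0.
have BE : x.2 ^+ 2 = B ^+ 2 by rewrite /B -normrX ger0_norm // sqr_ge0.
have kV : 0 < kappa^-1 by rewrite invr_gt0.
have AB : (1 + A) * (1 + B) <= 2 * (1 + kappa^-1) * rho x ^+ 2.
  rewrite rho_sqr AE BE; pose S : R := A ^+ 2 + B ^+ 2; rewrite -/S.
  apply: (@le_trans _ _ (2 * (1 + S))).
    have amgm (a b : R) : (1 + a) * (1 + b) <= 2 * (1 + (a ^+ 2 + b ^+ 2)).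
      have := sqr_ge0 (a - b); have := sqr_ge0 (a - 1); have := sqr_ge0 (b - 1).
      by nra.
    exact: amgm.
  rewrite -mulrA ler_pM2l //.
  have -> : (1 + kappa^-1) * (1 + kappa * S) = 1 + kappa^-1 + kappa * S + S.
    by field; rewrite gt_eqF.
  have S0 : 0 <= S by rewrite /S addr_ge0 // sqr_ge0.
  have : 0 <= kappa * S by rewrite mulr_ge0 // ltW.
  lra.
have r0 : 0 < rho x ^+ 2 by rewrite exprn_gt0 // rho_gt0.
have h1 : (rho x ^+ 2)^-1 <= 2 * (1 + kappa^-1) * ((1 + A)^-1 * (1 + B)^-1).
  rewrite -invfM ler_pdivlMr; last by rewrite mulr_gt0 // ltr_wpDr.
  by rewrite mulrC ler_pdivrMr.
pose d1 : R := `|x.1 - z.1|; pose d2 : R := `|x.2 - z.2|.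
have q1 : 0 < Num.sqrt d1 by rewrite sqrtr_gt0 normr_gt0 subr_eq0.
have q2 : 0 < Num.sqrt d2 by rewrite sqrtr_gt0 normr_gt0 subr_eq0.
have h2 : Num.sqrt d1 * Num.sqrt d2 <= normc (zc x - zc z).
  rewrite -ler_sqr ?nnegrE ?normc_ge0 ?mulr_ge0 ?sqrtr_ge0 //.
  rewrite normcE2 exprMn /= (sqr_sqrtr (normr_ge0 _)) (sqr_sqrtr (normr_ge0 _)).
  have -> : (x.1 - z.1) ^+ 2 = d1 ^+ 2 by rewrite /d1 -normrX ger0_norm // sqr_ge0.
  have -> : (x.2 - z.2) ^+ 2 = d2 ^+ 2 by rewrite /d2 -normrX ger0_norm // sqr_ge0.
  have amgm (a b : R) : a * b <= a ^+ 2 + b ^+ 2.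
    by have := sqr_ge0 (a - b); have := sqr_ge0 a; have := sqr_ge0 b; nra.
  exact: amgm.
have n0 : 0 < normc (zc x - zc z) by rewrite (lt_le_trans _ h2) // mulr_gt0.
have h3 : (normc (zc x - zc z))^-1 <= (Num.sqrt d1)^-1 * (Num.sqrt d2)^-1.
  by rewrite -invfM lef_pV2 ?posrE // mulr_gt0.
apply: (@le_trans _ _ ((2 * (1 + kappa^-1) * ((1 + A)^-1 * (1 + B)^-1)) *
    ((Num.sqrt d1)^-1 * (Num.sqrt d2)^-1))).
  by apply: ler_pM => //; rewrite invr_ge0 ltW.
rewrite -mulrA ler_pM2l; last by rewrite mulr_gt0 // ltr_wpDr // ltW.
rewrite mulrACA; apply: ler_pM; rewrite ?cauchy_factor_bound //.
  by rewrite mulr_ge0 // invr_ge0 // ?ltW // ltr_wpDr.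
by rewrite mulr_ge0 // invr_ge0 // ?ltW // ltr_wpDr.
Qed.

Lemma cauchy_kernel_ge0 z x : 0 <= cauchy_kernel z x.
Proof. by rewrite mulr_ge0 // invr_ge0 ?normc_ge0 // exprn_ge0 // ltW // rho_gt0. Qed.

Lemma cauchy_factor_measurable (a : R) : measurable_fun setT (cauchy_factor a).
Proof.
by apply: measurable_funD; [exact: measurable_spike|exact: measurable_spike_shift].
Qed.

Lemma integral_cauchy_factor (a : R) :
  (\int[mu]_x (cauchy_factor a x)%:E <= (4 * pi : R)%:E)%E.
Proof.
under eq_integral do rewrite EFinD.
rewrite ge0_integralD //; last 4 first.
- by move=> x _; rewrite lee_fin spike_ge0.
- by apply/measurable_EFinP; exact: measurable_spike.
- by move=> x _; rewrite lee_fin spike_ge0.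
- by apply/measurable_EFinP; exact: measurable_spike_shift.
have -> : 4 * pi = 2 * pi + 2 * pi :> R by ring.
rewrite EFinD; apply: leeD; last exact: integral_spike.
apply: le_trans (integral_spike 0); rewrite le_eqVlt; apply/orP; left; apply/eqP.
by apply: eq_integral => x _; rewrite subr0.
Qed.

Definition kernel_mass : R := 2 * (1 + kappa^-1) * (4 * pi) * (4 * pi).

Lemma integral_le_cauchy_kernel (z : R * R) (f : R * R -> R) (C : R) :
  0 <= C -> measurable_fun setT f -> (forall x, 0 <= f x) ->
  (forall x, x != z -> f x <= C * cauchy_kernel z x) ->
  (\int[mu2]_x (f x)%:E <= (C * kernel_mass)%:E)%E.
Proof.
move=> C0 mf f0 fK; pose D := 2 * (1 + kappa^-1).
have D0 : 0 <= D by rewrite mulr_ge0 // addr_ge0 // invr_ge0 ltW.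
rewrite (_ : C * kernel_mass = (C * D * (4 * pi)) * (4 * pi)); last first.
  by rewrite /kernel_mass -/D; ring.
apply: (@tonelli_product_bound f [:: z.1; 0] [:: z.2; 0] _ _
  (fun x => C * D * cauchy_factor z.1 x) (cauchy_factor z.2)) => //.
- by apply: measurable_funM => //; exact: cauchy_factor_measurable.
- exact: cauchy_factor_measurable.
- by move=> x; apply: mulr_ge0; [exact: mulr_ge0|exact: cauchy_factor_ge0].
- by move=> x; exact: cauchy_factor_ge0.
- move=> x y; rewrite !inE !negb_or => /andP[x1 x0] /andP[y1 y0].
  have xz : (x, y) != z by apply: contraNneq x1 => <-.
  apply: (le_trans (fK _ xz)); rewrite -!mulrA ler_wpM2l // mulrA.
  exact: (@cauchy_kernel_bound z (x, y)).
- under eq_integral do rewrite EFinM.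
  rewrite ge0_integralZl //; last 2 first.
  + by move=> x _; rewrite lee_fin cauchy_factor_ge0.
  + by rewrite lee_fin mulr_ge0.
  + rewrite (EFinM (C * D)); apply: lee_wpmul2l; first by rewrite lee_fin mulr_ge0.
    exact: integral_cauchy_factor.
  + by apply/measurable_EFinP; exact: cauchy_factor_measurable.
- exact: integral_cauchy_factor.
Qed.

Lemma plane_integrable_kernel (z : R * R) (f : R * R -> R) (C : R) :
  measurable_fun setT f ->
  (forall x, x != z -> `|f x| <= C * cauchy_kernel z x) -> plane_integrable f.
Proof.
move=> mf fK; apply: (@plane_integrable_bound f (`|C| * kernel_mass)) => //.
apply: (@integral_le_cauchy_kernel z) => //.
  by apply: (measurableT_comp _ mf); exact: normr_measurable.
move=> x xz; apply: (le_trans (fK x xz)).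
by rewrite ler_wpM2r ?cauchy_kernel_ge0 // ler_norm.
Qed.

Lemma rho_le (x : R * R) : Num.sqrt kappa * normc (zc x) <= rho x.
Proof.
rewrite -ler_sqr ?nnegrE ?mulr_ge0 ?sqrtr_ge0 ?normc_ge0 //.
by rewrite exprMn normcE2 (sqr_sqrtr (ltW kappa0)) rho_sqr lerDr.
Qed.

Lemma decay_cauchy_kernel x : x != 0 ->
  (rho x ^+ 3)^-1 <= (Num.sqrt kappa)^-1 * cauchy_kernel 0 x.
Proof.
move=> x0; have nx : 0 < normc (zc x).
  by apply: normc_gt0; apply: contra x0; case: x => a b /= /eqP[-> ->].
have k0 : 0 < Num.sqrt kappa by rewrite sqrtr_gt0.
rewrite /cauchy_kernel (_ : zc x - zc 0 = zc x); last by rewrite /zc /= subr0.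
rewrite exprSr invfM mulrCA ler_pM2l ?invr_gt0 ?exprn_gt0 ?rho_gt0 //.
by rewrite -invfM lef_pV2 ?posrE ?rho_gt0 ?mulr_gt0 // rho_le.
Qed.

Lemma plane_integrable_decay (f : R * R -> R) (C : R) :
  measurable_fun setT f -> (forall x, `|f x| <= C / rho x ^+ 3) ->
  plane_integrable f.
Proof.
move=> mf fC; apply: (@plane_integrable_kernel 0 f (C / Num.sqrt kappa)) => //.
move=> x x0; apply: (le_trans (fC x)); rewrite -mulrA.
apply: ler_wpM2l; last exact: decay_cauchy_kernel.
have := le_trans (normr_ge0 _) (fC 0); rewrite pmulr_lge0 // invr_gt0.
by rewrite exprn_gt0 // rho_gt0.
Qed.

Lemma invrho_cvg0 (f : R -> R * R) :
  (forall t, `|t| <= `|(f t).1| \/ `|t| <= `|(f t).2|) ->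
  (rho (f t))^-1 @[t --> +oo] --> (0 : R) /\
  (rho (f t))^-1 @[t --> -oo] --> (0 : R).
Proof.
move=> ft.
have bnd t : t != 0 -> (rho (f t))^-1 <= (Num.sqrt kappa)^-1 * `|t|^-1.
  move=> t0; rewrite -invfM lef_pV2 ?posrE ?rho_gt0 ?mulr_gt0 ?sqrtr_gt0 ?normr_gt0 //.
  apply: le_trans (rho_le _); rewrite ler_pM2l ?sqrtr_gt0 //.
  rewrite -ler_sqr ?nnegrE ?normc_ge0 // normcE2 /=.
  have sq (u : R) : `|t| <= `|u| -> `|t| ^+ 2 <= u ^+ 2.
    by move=> tu; rewrite -[leRHS]ger0_norm ?sqr_ge0 // normrX ler_sqr ?nnegrE.
  case: (ft t) => /sq h; apply: (le_trans h).
    by rewrite lerDl sqr_ge0.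
  by rewrite lerDr sqr_ge0.
have c0 : forall e : R, 0 < e -> forall t : R, (Num.sqrt kappa)^-1 / e < `|t| ->
    `|0 - (rho (f t))^-1| < e.
  move=> e e0 t et; have t0 : 0 < `|t|.
    by apply: le_lt_trans et; rewrite mulr_ge0 // invr_ge0 // ?sqrtr_ge0 // ltW.
  rewrite sub0r normrN gtr0_norm ?invr_gt0 ?rho_gt0 //.
  rewrite (le_lt_trans (bnd t _)) -?normr_gt0 // ltr_pdivrMr //.
  by rewrite mulrC -ltr_pdivrMr.
split; apply/cvgrPdist_lt => e e0.
  exists ((Num.sqrt kappa)^-1 / e); split; first exact: num_real.
  by move=> t te; apply: c0 => //; rewrite (lt_le_trans te) // ler_norm.
exists (- ((Num.sqrt kappa)^-1 / e)); split; first by rewrite num_real.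
by move=> t te; apply: c0 => //; rewrite -normrN (lt_le_trans _ (ler_norm _)) // ltrNr.
Qed.

Lemma normc_re (c : R[i]) : `|Re c| <= normc c.
Proof.
rewrite -ler_sqr ?nnegrE ?normc_ge0 // normcE2 -normrX ger0_norm ?sqr_ge0 //.
by rewrite lerDl sqr_ge0.
Qed.

Lemma normc_im (c : R[i]) : `|Im c| <= normc c.
Proof.
rewrite -ler_sqr ?nnegrE ?normc_ge0 // normcE2 -normrX ger0_norm ?sqr_ge0 //.
by rewrite lerDr sqr_ge0.
Qed.

Definition ccontinuous_at (f : R * R -> R[i]) x :=
  {for x, continuous (fun y => Re (f y))} /\ {for x, continuous (fun y => Im (f y))}.

(* Stokes' theorem on the plane, for a field with a singularity of the type of
   the Cauchy kernel at [z]. *)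
Theorem plane_flux (F : R * R -> R[i]) (z : R * R) (C : R) :
  (forall x, x != z -> cdiff F x) ->
  (forall i x, x != z -> ccontinuous_at (cpd i F) x) ->
  (forall i x, x != z -> normc (cpd i F x) <= C * cauchy_kernel z x) ->
  (forall x, normc (F x) <= C / rho x) ->
  plane_integrable (fun x => Re (dc 'i%C F x)) /\
  plane_int (fun x => Re (dc 'i%C F x)) = 0.
Proof.
move=> dF cF bF dec.
pose f x := Re (F x); pose g x := Im (F x).
have fE i x : pd i f x = Re (cpd i F x) by rewrite cpd.unlock.
have gE i x : pd i g x = Im (cpd i F x) by rewrite cpd.unlock.
have cf i x : x != z -> {for x, continuous (pd i f)}.
  by move=> xz; rewrite (funext (fE i)); exact: (cF i x xz).1.
have cg i x : x != z -> {for x, continuous (pd i g)}.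
  by move=> xz; rewrite (funext (gE i)); exact: (cF i x xz).2.
have intf i : plane_integrable (pd i f).
  apply: (@plane_integrable_kernel z _ C).
    exact: (punctured_measurable_plane (cf i)).
  by move=> x xz; rewrite fE (le_trans (normc_re _)) // bF.
have intg i : plane_integrable (pd i g).
  apply: (@plane_integrable_kernel z _ C).
    exact: (punctured_measurable_plane (cg i)).
  by move=> x xz; rewrite gE (le_trans (normc_im _)) // bF.
have decay (h : R * R -> R) (l : R -> R * R) : (forall x, `|h x| <= C / rho x) ->
    (forall t, `|t| <= `|(l t).1| \/ `|t| <= `|(l t).2|) ->
    h (l t) @[t --> +oo] --> (0 : R) /\ h (l t) @[t --> -oo] --> (0 : R).
  move=> hC /invrho_cvg0[c1 c2].
  have sq (G : set_system R) : Filter G -> (rho (l t))^-1 @[t --> G] --> (0 : R) ->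
      h (l t) @[t --> G] --> (0 : R).
    move=> FG cG; apply/norm_cvg0P.
    apply: (@squeeze_cvgr _ _ _ _ (cst 0) (fun t => C / rho (l t))).
    - by apply: nearW => t; rewrite normr_ge0 hC.
    - exact: cvg_cst.
    - by rewrite -(mulr0 C); apply: cvgM => //; exact: cvg_cst.
  by split; exact: sq.
have fd x : `|f x| <= C / rho x by exact: le_trans (normc_re _) (dec x).
have gd x : `|g x| <= C / rho x by exact: le_trans (normc_im _) (dec x).
have If : (\int[mu2]_x (pd 0 f x)%:E = 0)%E.
  apply: (@plane_int_pd0 f z) => // [x xz|x xz|y|y].
  - exact: (dF x xz).1.
  - exact: cf.
  - by have [] := decay f (fun s => (s, y)) fd; first by move=> t; left.
  - by have [] := decay f (fun s => (s, y)) fd; first by move=> t; left.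
have Ig : (\int[mu2]_x (pd 1 g x)%:E = 0)%E.
  apply: (@plane_int_pd1 g z) => // [x xz|x xz|y|y].
  - exact: (dF x xz).2.
  - exact: cg.
  - by have [] := decay g (fun s => (y, s)) gd; first by move=> t; right.
  - by have [] := decay g (fun s => (y, s)) gd; first by move=> t; right.
(* The integrand is the divergence of the real field (Re F, - Im F). *)
have E x : Re (dc 'i%C F x) = pd 0 f x - pd 1 g x.
  by rewrite dc.unlock reD reM /= mul0r mul1r sub0r fE gE.
have i0 := intf 0; have i1 := intg 1; set p := pd 0 f in E If i0; set q := pd 1 g in E Ig i1.
split.
  rewrite /plane_integrable (_ : EFin \o _ = ((EFin \o p) \- (EFin \o q))%E).
    exact: integrableB i0 i1.
  by apply/funext => x /=; rewrite E EFinB.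
rewrite /plane_int; under eq_integral do rewrite E.
by rewrite (integralB_EFin _ i0 i1) // If Ig subee.
Qed.

End PlaneIntegrals.

(** * Integer powers, locality of derivatives, and moduli *)

Section ComplexCalculus.
Variable R : realType.
Local Notation C := R[i].

Lemma cdiff_exprz (f : R * R -> C) x (a : int) : f x != 0 -> cdiff f x ->
  cdiff (fun y => f y ^ a) x.
Proof.
move=> f0 df.
have dn n : cdiff (fun y => f y ^+ n) x.
  elim: n => [|n IH]; first by under eq_fun do rewrite expr0; exact: cdiff_cst.
  by under eq_fun do rewrite exprS; exact: cdiffM.
case: a => n; first exact: dn.
by apply: cdiffV; [rewrite expf_neq0|exact: dn].
Qed.

Lemma cpd_exprz i (f : R * R -> C) x (a : int) : f x != 0 -> cdiff f x ->
  cpd i (fun y => f y ^ a) x = a%:~R * f x ^ (a - 1) * cpd i f x.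
Proof.
move=> f0 df.
have dn n : cdiff (fun y => f y ^+ n) x.
  elim: n => [|n IH]; first by under eq_fun do rewrite expr0; exact: cdiff_cst.
  by under eq_fun do rewrite exprS; exact: cdiffM.
have En n : cpd i (fun y => f y ^+ n) x = n%:R * f x ^+ n / f x * cpd i f x.
  elim: n => [|n IH].
    by under eq_fun do rewrite expr0; rewrite cpd_cst !mul0r.
  under eq_fun do rewrite exprS.
  rewrite cpdM // IH exprS -(natr1 n); by field.
case: a => n.
  rewrite En; congr (_ * _); rewrite -mulrA; congr (_ * _).
  by rewrite expfzDr // exprN1.
under eq_fun do rewrite NegzE -exprnN.
rewrite cpdV ?expf_neq0 // En NegzE expfzDr // exprN1 -exprnN.
rewrite mulrNz; have fn : f x ^+ n.+1 != 0 by rewrite expf_neq0.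
set A := f x ^+ n.+1 in fn *; set N : C := n.+1%:R.
by field; rewrite fn f0.
Qed.

Lemma near_eq_cpd i (f g : R * R -> C) x : (\near x, f x = g x) ->
  cpd i f x = cpd i g x.
Proof.
move=> fg; rewrite cpd.unlock; congr (_ +i* _)%C; apply: near_eq_derive.
  by apply: filterS fg => y ->.
by apply: filterS fg => y ->.
Qed.

Lemma near_eq_dc e (f g : R * R -> C) x : (\near x, f x = g x) ->
  dc e f x = dc e g x.
Proof. by move=> fg; rewrite dc.unlock !(near_eq_cpd _ fg). Qed.

Lemma ccontinuous_csmooth (f : R * R -> C) x : csmooth f -> ccontinuous_at f x.
Proof.
by move=> [s1 s2]; split; [exact: (smooth_continuous s1)|exact: (smooth_continuous s2)].
Qed.

Lemma normc_opp (c : C) : normc (- c) = normc c.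
Proof. by case: c => a b /=; rewrite !sqrrN. Qed.

Lemma normc_add (c d : C) : normc (c + d) <= normc c + normc d.
Proof. exact: le_normcD. Qed.

Lemma normc_conj (c : C) : normc (conjc c) = normc c.
Proof. by case: c => a b /=; rewrite !sqrrN. Qed.

Lemma normcX (c : C) n : normc (c ^+ n) = normc c ^+ n.
Proof. by elim: n => [|n IH]; rewrite ?expr0 ?normc1 // !exprS normcM IH. Qed.

Lemma normcXz (c : C) (a : int) : normc (c ^ a) = normc c ^ a.
Proof. by case: a => n; rewrite ?NegzE -?exprnN ?normcV ?normcX. Qed.

Lemma normc_real (r : R) : normc r%:C%C = `|r|.
Proof. by rewrite /= expr0n addr0 sqrtr_sqr. Qed.

End ComplexCalculus.

(** * Bounds of continuous functions on boxes *)

Section CompactBounds.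
Variable R : realType.

Lemma bounded_box (f : R * R -> R) (L : R) : continuous f ->
  exists2 M, 0 <= M & forall x, `|x.1| <= L -> `|x.2| <= L -> `|f x| <= M.
Proof.
move=> cf; have [L0|L0] := ltP L 0.
  by exists 0 => // x /(le_trans (normr_ge0 _)); rewrite leNgt L0.
pose A : set (R * R) := `[- L, L] `*` `[- L, L].
have cA : compact A by apply: compact_setX; exact: segment_compact.
have [c cAc cmax] : exists2 c, c \in A & forall t, t \in A -> `|f t| <= `|f c|.
  apply: (@compact_EVT_max _ _ (fun x => `|f x|)) => //.
    by exists (0, 0); split; rewrite /= in_itv /= oppr_le0 L0.
  apply: continuous_subspaceT => x; apply: (@cvg_norm _ _ _ _ _ f); exact: cf.
exists `|f c| => // x x1 x2; apply: cmax; rewrite inE.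
by split; rewrite /= in_itv /= -ler_norml.
Qed.

Lemma bounded_time_box (F : R * (R * R) -> R) (T L : R) : continuous F ->
  exists2 M, 0 <= M &
    forall t x, 0 <= t <= T -> `|x.1| <= L -> `|x.2| <= L -> `|F (t, x)| <= M.
Proof.
move=> cf; have [L0|L0] := ltP L 0.
  by exists 0 => // t x _ /(le_trans (normr_ge0 _)); rewrite leNgt L0.
have [T0|T0] := ltP T 0.
  by exists 0 => // t x /andP[t0 /(le_trans t0)]; rewrite leNgt T0.
pose A : set (R * (R * R)) := `[0, T] `*` (`[- L, L] `*` `[- L, L]).
have cA : compact A.
  by do 2?[apply: compact_setX; first exact: segment_compact]; exact: segment_compact.
have [c cAc cmax] : exists2 c, c \in A & forall t, t \in A -> `|F t| <= `|F c|.
  apply: (@compact_EVT_max _ _ (fun x => `|F x|)) => //.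
    by exists (0, (0, 0)); rewrite /A /setX /= !in_itv /= !oppr_le0 lexx T0 L0.
  apply: continuous_subspaceT => x; apply: (@cvg_norm _ _ _ _ _ F); exact: cf.
exists `|F c| => // t x tT x1 x2; apply: cmax; rewrite inE.
by rewrite /A /setX /= !in_itv /= -!ler_norml.
Qed.

End CompactBounds.

(** * Tensors on the sphere, their decay in a chart, and Stokes' theorem *)

Section Tensors.
Variables (R : realType) (kappa : R).
Hypothesis kappa0 : 0 < kappa.
Local Notation C := R[i].
Local Notation k := (kappa%:C%C : C).
Local Notation d := (dc (-'i%C)).
Local Notation db := (dc ('i%C)).

Let k0 : k != 0.
Proof. by rewrite eq_complex /= negb_and gt_eqF. Qed.

Lemma zc_eq0 x : (zc x == 0 :> C) = (x == 0).
Proof. by case: x => a b; rewrite eq_complex -[RHS]xpair_eqE. Qed.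

Definition inv_zc (x : R * R) : C := (k * zc x)^-1.

(* The change of charts; in complex notation it is z |-> 1 / (kappa z), and
   [jac] is the inverse of its complex derivative. *)
Definition transition (x : R * R) : R * R := (Re (inv_zc x), Im (inv_zc x)).

Definition jac (x : R * R) : C := - (k * (zc x * zc x)).

Lemma zc_transition x : zc (transition x) = inv_zc x.
Proof. by apply: complex_eqP. Qed.

Lemma jac_neq0 x : x != 0 -> jac x != 0.
Proof. by move=> x0; rewrite oppr_eq0 !mulf_neq0 ?zc_eq0. Qed.

Lemma kzc_neq0 x : x != 0 -> k * zc x != 0.
Proof. by move=> x0; rewrite mulf_neq0 // zc_eq0. Qed.

Lemma cdiff_zc x : cdiff (@zc R) x.
Proof. exact/csmooth_cdiff/csmooth_zc. Qed.

Lemma csmooth_jac : csmooth jac.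
Proof.
apply: csmoothN; apply: csmoothM; first exact: csmooth_cst.
by apply: csmoothM; exact: csmooth_zc.
Qed.

Lemma cdiff_inv_zc x : x != 0 -> cdiff inv_zc x.
Proof.
move=> x0; apply: cdiffV; first exact: kzc_neq0.
by apply: cdiffM; [exact: cdiff_cst|exact: cdiff_zc].
Qed.

Lemma cpd_zc i x : cpd i (@zc R) x = if i == 0 then 1 else 'i%C.
Proof.
case: (eqVneq i 0) => [->|i0]; first exact: cpd0_zc.
have -> : i = 1 by apply/val_inj; case: i i0 => -[|[|]].
exact: cpd1_zc.
Qed.

Lemma cpd_jac i x : cpd i jac x = - (2 * k * zc x * cpd i (@zc R) x).
Proof.
have dz := cdiff_zc x; have dc := @cdiff_cst R k x.
rewrite cpdN; last by apply: cdiffM => //; exact: cdiffM.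
by rewrite !cpdM //; [rewrite cpd_cst; ring|exact: cdiffM].
Qed.

Lemma cpd_inv_zc i x : x != 0 -> cpd i inv_zc x = (jac x)^-1 * cpd i (@zc R) x.
Proof.
move=> x0; have z0 : zc x != 0 by rewrite zc_eq0.
rewrite cpdV; last 2 first.
- exact: kzc_neq0.
- by apply: cdiffM; [exact: cdiff_cst|exact: cdiff_zc].
rewrite cpdM; [|exact: cdiff_cst|exact: cdiff_zc].
by rewrite cpd_cst /jac; field; rewrite z0 k0.
Qed.

Lemma differentiable_transition x : x != 0 -> differentiable transition x.
Proof. by move=> /cdiff_inv_zc[d1 d2]; exact: differentiable_pair. Qed.

Lemma pd_transition i x :
  pd i (fun y => (transition y).1) x = Re (cpd i inv_zc x) /\
  pd i (fun y => (transition y).2) x = Im (cpd i inv_zc x).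
Proof. by rewrite cpd.unlock. Qed.

Lemma cpd_transition i (f : R * R -> C) x : x != 0 -> csmooth f ->
  cpd i (fun y => f (transition y)) x =
  cpd 0 f (transition x) * (Re (cpd i inv_zc x))%:C%C +
  cpd 1 f (transition x) * (Im (cpd i inv_zc x))%:C%C.
Proof.
move=> x0 sf; have [E1 E2] := pd_transition i x.
rewrite -E1 -E2; apply: cpd_comp; first exact: differentiable_transition.
exact: csmooth_cdiff.
Qed.

Lemma cdiff_transition (f : R * R -> C) x : x != 0 -> csmooth f ->
  cdiff (fun y => f (transition y)) x.
Proof.
move=> x0 sf; have [d1 d2] := csmooth_cdiff (transition x) sf.
have dt := differentiable_transition x0.
split; first exact: (@differentiable_comp _ _ _ _ transition (fun y => Re (f y))).
exact: (@differentiable_comp _ _ _ _ transition (fun y => Im (f y))).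
Qed.

Lemma db_transition (f : R * R -> C) x : x != 0 -> csmooth f ->
  db (fun y => f (transition y)) x = (conjc (jac x))^-1 * db f (transition x).
Proof.
move=> x0 sf; rewrite dc.unlock !cpd_transition // !cpd_inv_zc // !cpd_zc.
rewrite -conjc_inv; move: (jac x)^-1 (cpd 0 f _) (cpd 1 f _) => [u v] [a b] [e g].
by apply: complex_eqP; rewrite /= ?(mul0r, mulr0, mulr1, addr0, add0r, subr0, mul1r); ring.
Qed.

Lemma near_neq0 (x : R * R) : x != 0 -> \near x, x != 0.
Proof.
move=> x0; have : nbhs x (~` [set 0]).
  apply: open_nbhs_nbhs; split; last exact/eqP.
  apply: closed_openC.
  exact: (accessible_closed_set1 (hausdorff_accessible (@norm_hausdorff _ _))).
by apply: filterS => y /eqP.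
Qed.

(** An object on the sphere is a pair of chart expressions, and (a, b) is its weight under the
    holomorphic change of charts. Functions have type (0, 0), vector fields (1, 0), forms F dz (-1,
    0), and the area density (-1, -1). *)
Definition transforms (a b : int) (f : bool -> R * R -> C) : Prop :=
  forall x, x != 0 ->
    f false x = jac x ^ a * conjc (jac x) ^ b * f true (transition x).

Definition tensor (a b : int) (f : bool -> R * R -> C) : Prop :=
  (forall s, csmooth (f s)) /\ transforms a b f.

Lemma tensorM a b a' b' f g : tensor a b f -> tensor a' b' g ->
  tensor (a + a') (b + b') (fun s x => f s x * g s x).
Proof.
move=> [sf tf] [sg tg]; split=> [s|x x0]; first exact: csmoothM.
have j0 := jac_neq0 x0.
by rewrite tf // tg // !expfzDr ?conjc_eq0 //; ring.
Qed.

Lemma tensorD a b f g : tensor a b f -> tensor a b g ->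
  tensor a b (fun s x => f s x + g s x).
Proof.
move=> [sf tf] [sg tg]; split=> [s|x x0]; first exact: csmoothD.
by rewrite tf // tg // mulrDr.
Qed.

Lemma tensorZ a b c f : tensor a b f -> tensor a b (fun s x => c * f s x).
Proof.
move=> [sf tf]; split=> [s|x x0]; last by rewrite tf // mulrCA.
by apply: csmoothM => //; exact: csmooth_cst.
Qed.

Lemma tensorN a b f : tensor a b f -> tensor a b (fun s x => - f s x).
Proof.
move=> [sf tf]; split=> [s|x x0]; last by rewrite tf // mulrN.
exact: csmoothN.
Qed.

Lemma conjcM (c e : C) : conjc (c * e) = conjc c * conjc e.
Proof. exact: rmorphM. Qed.

Lemma conjcXz (c : C) (a : int) : conjc (c ^ a) = conjc c ^ a.
Proof. by case: a => n; rewrite ?NegzE -?exprnN ?conjc_inv rmorphXn. Qed.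

Lemma tensorJ a b f : tensor a b f -> tensor b a (fun s x => conjc (f s x)).
Proof.
move=> [sf tf]; split=> [s|x x0]; first exact: csmoothJ.
by rewrite tf // !conjcM !conjcXz conjcK (mulrC (_ ^ a)).
Qed.

(** The transition is holomorphic, so [db] annihilates the factor [jac ^ a], and the chain rule
    contributes one factor 1 / conj jac. A factor [conj jac ^ b] would not be annihilated, whence b
    = 0. *)
Lemma tensor_db a f : tensor a 0 f -> tensor a (-1) (fun s => db (f s)).
Proof.
move=> [sf tf]; split=> [s|x x0]; first exact: csmooth_dc.
have j0 := jac_neq0 x0.
rewrite (@near_eq_dc _ _ _ (fun y => jac y ^ a * f true (transition y))); last first.
  by apply: filterS (near_neq0 x0) => y y0; rewrite tf // expr0z mulr1.
have dj := csmooth_cdiff x csmooth_jac.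
have dt := cdiff_transition x0 (sf true).
rewrite dcM //; last exact: cdiff_exprz.
rewrite db_transition // (_ : db (fun y => jac y ^ a) x = 0).
  by rewrite mul0r add0r exprN1; ring.
rewrite dc.unlock !cpd_exprz // !cpd_jac !cpd_zc /=.
set u := _%:~R * _; transitivity (- (u * (2 * k * zc x) * (1 + 'i%C * 'i%C))).
  by ring.
by rewrite -expr2 sqr_i subrr mulr0 oppr0.
Qed.

Lemma tensor_d b f : tensor 0 b f -> tensor (-1) b (fun s => d (f s)).
Proof.
move=> tf; have := tensorJ (tensor_db (tensorJ tf)).
congr tensor; apply/funext => s; apply/funext => x.
have [sf _] := tf; rewrite dcJ; last exact: csmooth_cdiff.
rewrite conjcK; congr (dc _ _ _); apply: complex_eqP => /=; by rewrite ?oppr0.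
Qed.

Local Notation rho := (rho kappa).

Lemma normc_jac x : normc (jac x) = kappa * (x.1 ^+ 2 + x.2 ^+ 2).
Proof.
by rewrite normc_opp !normcM normc_real -expr2 normcE2 gtr0_norm.
Qed.

Lemma exprz_le_double (J : R) (n : int) : 1 < J ->
  J ^ n <= 2 ^+ absz n * (1 + J) ^ n.
Proof.
move=> h; have J0 : 0 < J by exact: lt_trans h.
case: n => p /=.
  rewrite -!exprnP -exprMn; apply: lerXn2r; rewrite ?nnegrE; lra.
rewrite NegzE -!exprnN -[2 ^+ _]invrK -invfM lef_pV2 ?posrE; last 2 first.
- by rewrite exprn_gt0.
- by rewrite mulr_gt0 ?invr_gt0 ?exprn_gt0 // addr_gt0.
rewrite ler_pdivrMl ?exprn_gt0 // -exprMn; apply: lerXn2r.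
- by rewrite nnegrE addr_ge0 // ltW.
- by rewrite nnegrE mulr_ge0 // ltW.
by lra.
Qed.

Lemma transition_disc x : 1 < kappa * (x.1 ^+ 2 + x.2 ^+ 2) ->
  kappa * ((transition x).1 ^+ 2 + (transition x).2 ^+ 2) <= 1.
Proof.
move=> h; have J0 := lt_trans ltr01 h.
rewrite -normc_jac /jac normc_opp !normcM normc_real gtr0_norm //.
rewrite -expr2 zc_transition /inv_zc normcV normcM normc_real gtr0_norm //.
rewrite exprVn exprMn normcE2 /= -(@ler_pM2l _ (kappa * (x.1 ^+ 2 + x.2 ^+ 2))) // mulr1.
set S := x.1 ^+ 2 + x.2 ^+ 2 in h J0 *.
have S0 : S != 0 by apply: contraTneq J0 => ->; rewrite mulr0 ltxx.
rewrite (_ : kappa * S * _ = 1) ?ltW //; field.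
by rewrite S0 gt_eqF.
Qed.

(* [rho ^ 2] and [|jac|] are comparable off the disc [kappa |z|^2 <= 1]. *)
Lemma transforms_bound a b f (M : R) : transforms a b f -> 0 <= M ->
  (forall s x, kappa * (x.1 ^+ 2 + x.2 ^+ 2) <= 1 -> normc (f s x) <= M) ->
  forall x, normc (f false x) <= 2 ^+ absz (a + b) * M * (rho x ^+ 2) ^ (a + b).
Proof.
move=> tf M0 fM x; set n := a + b.
have r1 : 1 <= rho x ^+ 2 by rewrite exprn_ege1 // rho_ge1.
have r0 : 0 < rho x ^+ 2 by rewrite exprn_gt0 // rho_gt0.
have two (p : nat) : 1 <= 2 ^+ p :> R by rewrite exprn_ege1 // ler1n.
have [h|h] := leP (kappa * (x.1 ^+ 2 + x.2 ^+ 2)) 1.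
  apply: (le_trans (fM _ _ h)); rewrite -[leLHS]mul1r mulrAC ler_wpM2r //.
  case: n => p /=.
    by rewrite -[leLHS]mul1r ler_pM // -exprnP exprn_ege1.
  rewrite -[_ ^ Negz p]/(((rho x ^+ 2) ^+ p.+1)^-1) ler_pdivlMr; last exact: exprn_gt0.
  rewrite mul1r.
  apply: lerXn2r; rewrite ?nnegrE ?ler0n ?(ltW r0) //.
  by rewrite rho_sqr //; lra.
have x0 : x != 0.
  apply: contraTneq h => ->; rewrite /= expr0n /= addr0 mulr0; lra.
have j0 := jac_neq0 x0.
have jJ0 : conjc (jac x) != 0 by rewrite conjc_eq0.
have jn0 : normc (jac x) != 0 by rewrite gt_eqF // normc_gt0.
rewrite tf // !normcM !normcXz normc_conj -expfzDr // -/n normc_jac //; set J := kappa * _ in h *.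
have J0 : 0 < J by exact: lt_trans h.
have tM : normc (f true (transition x)) <= M.
  by apply: fM; exact: transition_disc.
rewrite mulrC [leRHS]mulrAC [leRHS]mulrC; apply: ler_pM => //.
- exact: normc_ge0.
- by rewrite exprz_ge0 // ltW.
by rewrite rho_sqr // -/J; exact: exprz_le_double.
Qed.

Lemma csmooth_bounded (f : R * R -> C) (L : R) : csmooth f ->
  exists2 M, 0 <= M & forall x, `|x.1| <= L -> `|x.2| <= L -> normc (f x) <= M.
Proof.
move=> [/smooth_continuous s1 /smooth_continuous s2].
have [M1 M10 h1] := bounded_box L s1; have [M2 M20 h2] := bounded_box L s2.
exists (M1 + M2); first exact: addr_ge0.
move=> x x1 x2; rewrite (complexE (f x)); apply: (le_trans (normc_add _ _)).
rewrite normcM !normc_real (_ : normc 'i%C = 1); last first.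
  by rewrite /= expr0n expr1n add0r sqrtr1.
by rewrite mul1r lerD ?h1 ?h2.
Qed.

(** An upper bound, free of square roots, of the radius kappa^(-1/2) of the disc kappa |z|^2 <=
    1. *)
Definition disc_box : R := 1 + kappa^-1.

Lemma disc_in_box x : kappa * (x.1 ^+ 2 + x.2 ^+ 2) <= 1 ->
  `|x.1| <= disc_box /\ `|x.2| <= disc_box.
Proof.
rewrite mulrC -ler_pdivlMr // div1r => h.
have kV : 0 < kappa^-1 by rewrite invr_gt0.
have sq (u v : R) : u ^+ 2 + v ^+ 2 <= kappa^-1 -> `|u| <= disc_box.
  move=> uv; rewrite -ler_sqr ?nnegrE ?addr_ge0 ?(ltW kV) //.
  rewrite -normrX ger0_norm ?sqr_ge0 //.
  apply: (@le_trans _ _ kappa^-1); first by rewrite (le_trans _ uv) // lerDl sqr_ge0.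
  by rewrite /disc_box sqrrD expr1n mul1r mulr2n; have := sqr_ge0 kappa^-1; lra.
by split; [exact: sq h|rewrite addrC in h; exact: sq h].
Qed.

(** Compactness of the sphere: the closed discs kappa |z|^2 <= 1 of the two charts cover it, and
    [transforms_bound] carries the bound on the second disc over to the first chart. *)
Lemma tensor_bounded a b f : tensor a b f ->
  exists2 M, 0 <= M & forall x, normc (f false x) <= M * (rho x ^+ 2) ^ (a + b).
Proof.
move=> [sf tf].
have [M1 M10 h1] := csmooth_bounded disc_box (sf false).
have [M2 M20 h2] := csmooth_bounded disc_box (sf true).
exists (2 ^+ absz (a + b) * (M1 + M2)); first by rewrite mulr_ge0 ?exprn_ge0 ?addr_ge0.
move=> x; apply: transforms_bound => //; first exact: addr_ge0.
move=> [] y /disc_in_box[y1 y2].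
  by rewrite (le_trans (h2 _ y1 y2)) // lerDr.
by rewrite (le_trans (h1 _ y1 y2)) // lerDl.
Qed.

Lemma rho_sqr_disc x (n : int) : kappa * (x.1 ^+ 2 + x.2 ^+ 2) <= 1 ->
  1 <= 2 ^+ absz n * (rho x ^+ 2) ^ n.
Proof.
move=> h.
have r1 : 1 <= rho x ^+ 2 by rewrite exprn_ege1 // rho_ge1.
have r0 : 0 < rho x ^+ 2 by rewrite exprn_gt0 // rho_gt0.
have two (p : nat) : 1 <= 2 ^+ p :> R by rewrite exprn_ege1 // ler1n.
case: n => p /=.
  by rewrite -[leLHS]mul1r ler_pM // -exprnP exprn_ege1.
rewrite -[_ ^ Negz p]/(((rho x ^+ 2) ^+ p.+1)^-1) ler_pdivlMr; last exact: exprn_gt0.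
rewrite mul1r.
apply: lerXn2r; rewrite ?nnegrE ?ler0n ?(ltW r0) //.
by rewrite rho_sqr //; lra.
Qed.

(** A derivative gains a factor 1 / rho. Off the disc put q = sqrt kappa |z| > 1, so that |jac| =
    q^2: differentiating [jac ^ a] costs a factor of order 1 / q, and the chain rule for the
    transition a factor 1 / q^2 <= 1 / q, while q and [rho] are comparable. *)
Lemma tensor_cpd_bounded a f : tensor a 0 f ->
  exists2 M, 0 <= M &
    forall i x, normc (cpd i (f false) x) <= M * ((rho x ^+ 2) ^ a / rho x).
Proof.
move=> [sf tf].
have [M0 M00 h0] := csmooth_bounded disc_box (csmooth_cpd 0 (sf false)).
have [M1 M10 h1] := csmooth_bounded disc_box (csmooth_cpd 1 (sf false)).
have [A A0 hA] := csmooth_bounded disc_box (sf true).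
have [B0 B00 hB0] := csmooth_bounded disc_box (csmooth_cpd 0 (sf true)).
have [B1 B10 hB1] := csmooth_bounded disc_box (csmooth_cpd 1 (sf true)).
pose t : R := 2 ^+ absz a.
have t0 : 0 <= t by rewrite exprn_ge0.
pose N : R := normc (a%:~R : C).
have N0 : 0 <= N by exact: normc_ge0.
pose M := t * (2 * (M0 + M1) + 2 * (N * (2 * Num.sqrt kappa) * A + (B0 + B1))).
have sk0 : 0 < Num.sqrt kappa by rewrite sqrtr_gt0.
have M_ge0 : 0 <= M.
  by rewrite /M mulr_ge0 // !addr_ge0 // ?mulr_ge0 ?addr_ge0 ?mulr_ge0 // ltW.
exists M => // i x.
have r1 : 1 <= rho x by exact: rho_ge1.
have r0 : 0 < rho x by exact: rho_gt0.
have ra : 0 <= (rho x ^+ 2) ^ a by rewrite exprz_ge0 // exprn_ge0 // ltW.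
have iE : i = 0 \/ i = 1.
  by case: i => -[|[|]] // p; [left|right]; exact/val_inj.
have [h|h] := leP (kappa * (x.1 ^+ 2 + x.2 ^+ 2)) 1.
  have [y1 y2] := disc_in_box h.
  have cM : normc (cpd i (f false) x) <= M0 + M1.
    case: iE => ->; first by rewrite (le_trans (h0 _ y1 y2)) // lerDl.
    by rewrite (le_trans (h1 _ y1 y2)) // lerDr.
  apply: (le_trans cM).
  have h2 := rho_sqr_disc a h; rewrite -/t in h2.
  have h3 : (rho x)^-1 >= 2^-1.
    rewrite lef_pV2 ?posrE // -ler_sqr ?nnegrE ?(ltW r0) // rho_sqr //; lra.
  have h4 : 2^-1 <= t * (rho x ^+ 2) ^ a / rho x.
    by rewrite -[leLHS]mul1r ler_pM // invr_ge0.
  have MM : (t * (rho x ^+ 2) ^ a / rho x) * (2 * (M0 + M1)) <= M * ((rho x ^+ 2) ^ a / rho x).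
    rewrite /M mulrC !mulrA ler_pM2r ?invr_gt0 // ler_wpM2r // mulrC.
    apply: ler_wpM2l => //; rewrite lerDl mulr_ge0 // addr_ge0 ?addr_ge0 //.
    by rewrite !mulr_ge0 // ltW.
  apply: le_trans MM.
  rewrite [leLHS](_ : _ = 2^-1 * (2 * (M0 + M1))); last by field.
  by apply: ler_wpM2r => //; rewrite mulr_ge0 // addr_ge0.
have x0 : x != 0.
  by apply: contraTneq h => ->; rewrite /= expr0n /= addr0 mulr0; lra.
have j0 := jac_neq0 x0; have dj := csmooth_cdiff x csmooth_jac.
have dt := cdiff_transition x0 (sf true).
rewrite (@near_eq_cpd _ _ _ (fun y => jac y ^ a * f true (transition y))); last first.
  by apply: filterS (near_neq0 x0) => y y0; rewrite tf // expr0z mulr1.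
rewrite cpdM //; last exact: cdiff_exprz.
rewrite cpd_exprz // cpd_transition // cpd_inv_zc // cpd_jac.
have cz1 : normc (cpd i (@zc R) x) = 1.
  by rewrite cpd_zc; case: ifP => _; rewrite /= ?expr0n ?expr1n ?addr0 ?add0r sqrtr1.
set J := kappa * _ in h.
have J0 : 0 < J by exact: lt_trans h.
have jE : normc (jac x) = J by rewrite normc_jac.
pose q := Num.sqrt kappa * normc (zc x).
have q2 : q ^+ 2 = J.
  by rewrite /q exprMn normcE2 (sqr_sqrtr (ltW kappa0)).
have q0 : 0 <= q by rewrite mulr_ge0 ?normc_ge0 // ltW.
have q1 : 1 < q by rewrite -(@ltr_sqr _ 1) ?nnegrE // expr1n q2.
have [y1 y2] : `|(transition x).1| <= disc_box /\ `|(transition x).2| <= disc_box.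
  by apply: disc_in_box; exact: transition_disc.
have nA := hA _ y1 y2; have nB0 := hB0 _ y1 y2; have nB1 := hB1 _ y1 y2.
have E1 : normc (a%:~R * jac x ^ (a - 1) * - (2 * k * zc x * cpd i (@zc R) x) *
    f true (transition x)) <= J ^ a / q * (N * (2 * Num.sqrt kappa) * A).
  rewrite !normcM normc_opp !normcM cz1 mulr1 normcXz jE -/N.
  rewrite (_ : normc (2 : C) = 2); last first.
    rewrite (_ : (2 : C) = (2 : R)%:C%C) ?normc_real ?gtr0_norm //.
    by rewrite rmorph_nat.
  rewrite normc_real gtr0_norm // expfzDr ?gt_eqF // exprN1.
  have kr : kappa * normc (zc x) = Num.sqrt kappa * q.
    by rewrite /q mulrA -expr2 (sqr_sqrtr (ltW kappa0)).
  rewrite [X in X <= _](_ : _ = J ^ a / q * (N * (2 * Num.sqrt kappa) *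
     normc (f true (transition x)))); last first.
    rewrite -(mulrA 2) kr; set T := J ^ a; rewrite -q2.
    by field; rewrite gt_eqF // (lt_trans _ q1).
  apply: ler_wpM2l; first by rewrite mulr_ge0 ?invr_ge0 // exprz_ge0 // ltW.
  by rewrite ler_wpM2l // !mulr_ge0 // ltW.
have E2 : normc (jac x ^ a * (cpd 0 (f true) (transition x) *
    (Re ((jac x)^-1 * cpd i (@zc R) x))%:C%C + cpd 1 (f true) (transition x) *
    (Im ((jac x)^-1 * cpd i (@zc R) x))%:C%C)) <= J ^ a / q * (B0 + B1).
  have nj : normc ((jac x)^-1 * cpd i (@zc R) x) <= q^-1.
    rewrite normcM cz1 mulr1 normcV jE -q2 lef_pV2 ?posrE ?exprn_gt0 // ?(lt_trans _ q1) //.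
    by rewrite expr2 ler_peMr // ltW.
  rewrite normcM normcXz jE -mulrA; apply: ler_wpM2l; first by rewrite exprz_ge0 // ltW.
  apply: (le_trans (normc_add _ _)); rewrite !normcM !normc_real mulrDr.
  by apply: lerD; rewrite mulrC; apply: ler_pM; rewrite ?normr_ge0 ?normc_ge0 //;
    apply: le_trans nj; rewrite ?normc_re ?normc_im.
apply: (le_trans (normc_add _ _)); apply: (le_trans (lerD E1 E2)); rewrite -mulrDr.
set D := N * _ * A + (B0 + B1).
have D0 : 0 <= D by rewrite !addr_ge0 // !mulr_ge0 // ltW.
have qr : q^-1 <= 2 / rho x.
  rewrite -[leLHS]mul1r ler_pdivrMr ?(lt_trans _ q1) // mulrAC ler_pdivlMr // mul1r.
  rewrite -ler_sqr; last 2 first.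
  - by rewrite nnegrE ltW.
  - by rewrite nnegrE; apply: mulr_ge0.
  rewrite exprMn q2 rho_sqr // -/J.
  by clearbody J; lra.
have Jr : J ^ a <= t * (rho x ^+ 2) ^ a.
  by rewrite rho_sqr // -/J; exact: exprz_le_double.
apply: (@le_trans _ _ (t * (rho x ^+ 2) ^ a * (2 / rho x) * D)).
  apply: ler_wpM2r => //; apply: ler_pM => //; last by rewrite invr_ge0.
  by rewrite exprz_ge0 // ltW.
rewrite /M -/D [leRHS](_ : _ = t * (rho x ^+ 2) ^ a * (2 / rho x) * D +
   t * (2 * (M0 + M1)) * ((rho x ^+ 2) ^ a / rho x)); last by field; rewrite gt_eqF.
by rewrite lerDl !mulr_ge0 ?addr_ge0 // invr_ge0 ltW.
Qed.

(** Type (-1, 0) is that of a form F dz, and this is the vanishing of the integral of an exact form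
    on a closed surface. In the chart F is O(rho^-2) and its derivatives are O(rho^-3), so the
    omitted pole contributes nothing. *)
Theorem tensor_flux F : tensor (-1) 0 F ->
  plane_integrable (fun x => Re (db (F false) x)) /\
  plane_int (fun x => Re (db (F false) x)) = 0.
Proof.
move=> tF; have [sF _] := tF.
have [A A0 hA] := tensor_bounded tF; have [B B0 hB] := tensor_cpd_bounded tF.
have r0 x : 0 < rho x by exact: rho_gt0.
have r1 x : 1 <= rho x by exact: rho_ge1.
have sk0 : 0 < Num.sqrt kappa by rewrite sqrtr_gt0.
apply: (@plane_flux R kappa kappa0 (F false) 0 (A + B / Num.sqrt kappa)).
- by move=> x _; exact: csmooth_cdiff.
- by move=> i x _; exact/ccontinuous_csmooth/csmooth_cpd.
- move=> i x x0; apply: (le_trans (hB i x)).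
  rewrite exprN1 -invfM -exprSr mulrDl.
  apply: (@le_trans _ _ (B / Num.sqrt kappa * cauchy_kernel kappa 0 x)).
    by rewrite -mulrA; apply: ler_wpM2l => //; exact: decay_cauchy_kernel.
  by rewrite lerDr; apply: mulr_ge0 => //; exact: cauchy_kernel_ge0.
- move=> x; apply: (le_trans (hA x)); rewrite addr0 exprN1.
  apply: ler_pM => //; first by rewrite invr_ge0 exprn_ge0 // ltW.
    by rewrite lerDl divr_ge0 // ltW.
  by rewrite lef_pV2 ?posrE ?exprn_gt0 // expr2 ler_peMr // ltW.
Qed.

Lemma tensor_integrable a b f : tensor a b f -> a + b = -2 ->
  plane_integrable (fun x => Re (f false x)).
Proof.
move=> tf ab; have [sf _] := tf; have [A A0 hA] := tensor_bounded tf.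
apply: (@plane_integrable_decay R kappa kappa0 _ A).
  by apply: continuous_measurable_plane; exact: smooth_continuous (sf false).1.
move=> x; apply: (le_trans (normc_re _)); apply: (le_trans (hA x)).
have r1 : 1 <= rho x by exact: rho_ge1.
rewrite ab ler_wpM2l // -[_ ^ _]/(((rho x ^+ 2) ^+ 2)^-1) -exprM.
by rewrite lef_pV2 ?posrE ?exprn_gt0 ?rho_gt0 // ler_weXn2l.
Qed.

End Tensors.

(** * Linearity and positivity of the integral over the plane *)

Section PlaneIntLinear.
Variable R : realType.
Implicit Types f g : R * R -> R.

Lemma plane_integrableD f g : plane_integrable f -> plane_integrable g ->
  plane_integrable (fun x => f x + g x).
Proof. by move=> i1 i2; exact: (integrableD measurableT i1 i2). Qed.

Lemma plane_integrableZ c f : plane_integrable f ->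
  plane_integrable (fun x => c * f x).
Proof. by move=> i1; exact: (integrableZl measurableT c i1). Qed.

Lemma plane_intD f g : plane_integrable f -> plane_integrable g ->
  plane_int (fun x => f x + g x) = plane_int f + plane_int g.
Proof. by move=> i1 i2; exact: (RintegralD measurableT i1 i2). Qed.

Lemma plane_intZ c f : plane_integrable f ->
  plane_int (fun x => c * f x) = c * plane_int f.
Proof. by move=> i1; exact: (RintegralZl c measurableT i1). Qed.

Lemma plane_integrableN f : plane_integrable f ->
  plane_integrable (fun x => - f x).
Proof.
move=> i1; have := plane_integrableZ (-1) i1.
by congr plane_integrable; apply/funext => x; rewrite mulN1r.
Qed.

Lemma plane_intN f : plane_integrable f -> plane_int (fun x => - f x) = - plane_int f.
Proof.
move=> i1; rewrite -mulN1r -plane_intZ //; congr plane_int.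
by apply/funext => x; rewrite mulN1r.
Qed.

Lemma plane_intB f g : plane_integrable f -> plane_integrable g ->
  plane_int (fun x => f x - g x) = plane_int f - plane_int g.
Proof. by move=> i1 i2; exact: (RintegralB measurableT i1 i2). Qed.

Lemma plane_int_ge0 f : (forall x, 0 <= f x) -> 0 <= plane_int f.
Proof. by move=> f0; apply: fine_ge0; apply: integral_ge0 => x _; rewrite lee_fin. Qed.

End PlaneIntLinear.

(** * The conformal factor and the twisted derivatives *)

Section SphereCalculus.
Variables (R : realType) (kappa : R).
Hypothesis kappa0 : 0 < kappa.
Local Notation C := R[i].
Local Notation k := (kappa%:C%C : C).
Local Notation d := (dc (-'i%C)).
Local Notation db := (dc ('i%C)).
Local Notation cj := conjc.
Local Notation zb x := (conjc (zc x)).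
Local Notation tensor := (tensor kappa).
Implicit Types (x : R * R) (f g : R * R -> C) (e p : C).

(** The inverse of the conformal factor [lam], the metric being lam^2 |dz|^2. Both are real, and are
    complex valued here only for the sake of computation. *)
Definition ilam (x : R * R) : C := (1 + k * (zc x * zb x)) / 2.
Definition lam (x : R * R) : C := (ilam x)^-1.
Definition lam2 (x : R * R) : C := lam x * lam x.
Definition ilam2 (x : R * R) : C := ilam x * ilam x.

Lemma ilamE x : ilam x = (rho kappa x ^+ 2 / 2)%:C%C.
Proof.
rewrite rho_sqr // /ilam.
rewrite (_ : zc x * zb x = (x.1 ^+ 2 + x.2 ^+ 2)%:C%C); last first.
  by apply: complex_eqP => /=; ring.
by rewrite -rmorphM -(rmorph1 (real_complex R)) -rmorphD -[2 in LHS]/(2%:R)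
  -(rmorph_nat (real_complex R) 2) -fmorphV -rmorphM.
Qed.

Lemma ilam_neq0 x : ilam x != 0.
Proof.
rewrite ilamE fmorph_eq0 mulf_neq0 ?invr_eq0 // ?gt_eqF // exprn_gt0 //.
exact: rho_gt0.
Qed.

Lemma lam_neq0 x : lam x != 0. Proof. by rewrite invr_eq0 ilam_neq0. Qed.

Lemma lamJ x : cj (lam x) = lam x.
Proof. by rewrite /lam ilamE conjc_inv conjc_real. Qed.

Lemma lam2J x : cj (lam2 x) = lam2 x.
Proof. by rewrite /lam2 conjcM lamJ. Qed.

Lemma ilam2J x : cj (ilam2 x) = ilam2 x.
Proof. by rewrite /ilam2 conjcM ilamE conjc_real. Qed.

Lemma lam2K x : lam2 x * ilam2 x = 1.
Proof. by rewrite /lam2 /ilam2 /lam; field; exact: ilam_neq0. Qed.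

Lemma lam_eq x : k * (zc x * zb x) = 2 / lam x - 1.
Proof. by rewrite /lam invrK /ilam; field. Qed.

Lemma csmooth_ilam : csmooth ilam.
Proof.
apply: csmoothM; last exact: csmooth_cst.
apply: csmoothD; first exact: csmooth_cst.
apply: csmoothM; first exact: csmooth_cst.
by apply: csmoothM; [exact: csmooth_zc|apply: csmoothJ; exact: csmooth_zc].
Qed.

Lemma csmooth_lam : csmooth lam.
Proof.
have -> : lam = (fun x => ((rho kappa x ^+ 2 / 2)^-1)%:C%C).
  by apply/funext => x; rewrite /lam ilamE fmorphV.
apply: csmooth_real; apply: smoothV.
  by move=> x; rewrite mulf_neq0 ?invr_eq0 // gt_eqF // exprn_gt0 // rho_gt0.
by have [+ _] := csmooth_ilam; congr smooth; apply/funext => x; rewrite ilamE.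
Qed.

Lemma csmooth_lam2 : csmooth lam2.
Proof. by apply: csmoothM; exact: csmooth_lam. Qed.

Lemma csmooth_ilam2 : csmooth ilam2.
Proof. by apply: csmoothM; exact: csmooth_ilam. Qed.

Lemma iiN : 'i%C * 'i%C = -1 :> C.
Proof. by rewrite -expr2 sqr_i. Qed.

Lemma d_zc x : d (@zc R) x = 2.
Proof. by rewrite dc_zc mulNr iiN opprK. Qed.

Lemma db_zc x : db (@zc R) x = 0.
Proof. by rewrite dc_zc iiN subrr. Qed.

Lemma d_zcJ x : d (fun y : R * R => zb y) x = 0.
Proof.
rewrite dcJ; last exact: cdiff_zc.
rewrite (_ : conjc (-'i%C) = 'i%C :> C) ?db_zc ?conjc0 //.
by apply: complex_eqP => /=; rewrite ?oppr0 ?opprK.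
Qed.

Lemma db_zcJ x : db (fun y : R * R => zb y) x = 2.
Proof.
rewrite dcJ; last exact: cdiff_zc.
rewrite (_ : conjc ('i%C) = -'i%C :> C) ?d_zc ?conjc_nat //.
by apply: complex_eqP => /=; rewrite ?oppr0.
Qed.

Lemma dJ f (x : R * R) : csmooth f -> d (fun y => cj (f y)) x = cj (db f x).
Proof.
move=> sf; rewrite dcJ; last exact: csmooth_cdiff.
by congr (conjc (dc _ _ _)); apply: complex_eqP => /=; rewrite ?oppr0 ?opprK.
Qed.

Lemma dbJ f (x : R * R) : csmooth f -> db (fun y => cj (f y)) x = cj (d f x).
Proof.
move=> sf; rewrite dcJ; last exact: csmooth_cdiff.
by congr (conjc (dc _ _ _)); apply: complex_eqP => /=; rewrite ?oppr0.
Qed.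

Let dcM' e f g x : csmooth f -> csmooth g ->
  dc e (fun y => f y * g y) x = dc e f x * g x + f x * dc e g x.
Proof. by move=> sf sg; rewrite dcM //; exact: csmooth_cdiff. Qed.

Lemma dc_ilam e (x : R * R) :
  dc e ilam x = k / 2 * (dc e (@zc R) x * zb x + zc x * dc e (fun y : R * R => zb y) x).
Proof.
have sz := csmooth_zc R; have szJ := csmoothJ sz.
have s1 : csmooth (fun x : R * R => zc x * zb x) by exact: csmoothM.
have sk : csmooth (fun _ : R * R => k) by exact: csmooth_cst.
rewrite dcM; [|by apply: csmooth_cdiff; apply: csmoothD; [exact: csmooth_cst|exact: csmoothM]
  |exact: cdiff_cst].
rewrite dc_cst dcD; [|exact: cdiff_cst|by apply: csmooth_cdiff; exact: csmoothM].
by rewrite dc_cst dcM' // dc_cst dcM' //; field.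
Qed.

Lemma d_lam x : d lam x = - (k * zb x * lam2 x).
Proof.
rewrite dcV ?ilam_neq0 //; last exact/csmooth_cdiff/csmooth_ilam.
rewrite dc_ilam d_zc d_zcJ /lam2 /lam; field.
by rewrite ilam_neq0.
Qed.

Lemma db_lam x : db lam x = - (k * zc x * lam2 x).
Proof.
rewrite dcV ?ilam_neq0 //; last exact/csmooth_cdiff/csmooth_ilam.
rewrite dc_ilam db_zc db_zcJ /lam2 /lam; field.
by rewrite ilam_neq0.
Qed.

(* [twist p f = lam ^ -p * d (lam ^ p * f)] *)
Definition twist (p : C) (f : R * R -> C) (x : R * R) : C :=
  d f x - p * k * zb x * lam x * f x.

Lemma csmooth_twist p f : csmooth f -> csmooth (twist p f).
Proof.
move=> sf; apply: csmoothB; first exact: csmooth_dc.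
apply: csmoothM => //; apply: csmoothM; last exact: csmooth_lam.
apply: csmoothM; first exact: csmooth_cst.
by apply: csmoothJ; exact: csmooth_zc.
Qed.

Lemma d_lam2M f (x : R * R) : csmooth f ->
  d (fun y => lam2 y * f y) x = lam2 x * twist 2 f x.
Proof.
move=> sf; rewrite dcM' //; last exact: csmooth_lam2.
rewrite /lam2 dcM'; [|exact: csmooth_lam|exact: csmooth_lam].
by rewrite d_lam /twist /lam2; ring.
Qed.

Lemma twist_lam2M p f x : csmooth f ->
  twist p (fun y => lam2 y * f y) x = lam2 x * twist (p + 2) f x.
Proof. by move=> sf; rewrite /twist d_lam2M // /twist; ring. Qed.

Lemma db_lam2MJ f (x : R * R) : csmooth f ->
  db (fun y => lam2 y * cj (f y)) x = lam2 x * cj (twist 2 f x).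
Proof.
move=> sf; rewrite (_ : (fun y => _) = (fun y => cj (lam2 y * f y))); last first.
  by apply/funext => y; rewrite conjcM lam2J.
rewrite dbJ; last by apply: csmoothM => //; exact: csmooth_lam2.
by rewrite d_lam2M // conjcM lam2J.
Qed.

(* The curvature of the sphere: db (lam ^ -1 * d lam) = - kappa lam ^ 2. *)
Lemma db_twist p f x : csmooth f ->
  db (twist p f) x = twist p (db f) x - p * k * lam2 x * f x.
Proof.
move=> sf; have szJ := csmoothJ (csmooth_zc R).
have sl := csmooth_lam; have spk : csmooth (fun _ : R * R => p * k) by exact: csmooth_cst.
have s1 : csmooth (fun y : R * R => p * k * zb y) by exact: csmoothM.
have s2 : csmooth (fun y : R * R => p * k * zb y * lam y) by exact: csmoothM.
rewrite dcB; [|exact/csmooth_cdiff/csmooth_dc|by apply: csmooth_cdiff; exact: csmoothM].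
rewrite dcM' // dcM' // dcM' // dc_cst db_zcJ db_lam dc_swap // /twist /lam2.
have := lam_eq x; have := lam_neq0 x.
move: (lam x) (zc x) (zb x) => l z z' l0 e.
have E : k * z * (l * l) * z' = 2 * l - l * l.
  by rewrite (_ : _ * z' = k * (z * z') * (l * l)); [rewrite e; field|ring].
have -> : p * k * z' * - (k * z * (l * l)) = - (p * k * (2 * l - l * l)).
  by rewrite -E; ring.
by rewrite mul0r add0r; ring.
Qed.

Lemma conjcN (c : C) : cj (- c) = - cj c.
Proof. by apply: complex_eqP; case: c. Qed.

Lemma tensor_lam2 : tensor (-1) (-1) (fun _ => lam2).
Proof.
split=> [_|x x0]; first exact: csmooth_lam2.
have z0 : zc x != 0 by rewrite zc_eq0.
have zb0 : zb x != 0 by rewrite conjc_eq0.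
have k0 : k != 0 by rewrite fmorph_eq0 gt_eqF.
have h1 := ilam_neq0 x; have h2 := ilam_neq0 (transition kappa x).
rewrite /lam2 /lam /jac !exprN1; move: h1 h2.
rewrite /ilam zc_transition /inv_zc conjc_inv !conjcM !conjc_real.
rewrite (_ : cj (- (k * (zc x * zc x))) = - (k * (zb x * zb x))); last first.
  by rewrite conjcN !conjcM conjc_real.
move: (zc x) (zb x) z0 zb0 => z z' z0 zb0 h1 h2.
have -> : (1 + k * ((k * z)^-1 * (k * z')^-1)) / 2 =
    (1 + k * (z * z')) / 2 / (k * (z * z')).
  by field; rewrite ?k0 ?z0 ?zb0.
by set D := (1 + _) / 2 in h1 *; field; rewrite ?h1 ?k0 ?z0 ?zb0.
Qed.

Lemma tensor_ilam2 : tensor 1 1 (fun _ => ilam2).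
Proof.
split=> [_|x x0]; first exact: csmooth_ilam2.
have [_ t] := tensor_lam2.
have e y : ilam2 y = (lam2 y)^-1.
  by rewrite -[LHS]mul1r -(@mulVf _ (lam2 y)) ?mulf_neq0 ?lam_neq0 // -mulrA lam2K mulr1.
by rewrite !e t // !invfM !invr_expz !opprK invrK.
Qed.

End SphereCalculus.

(** * Integral identities for divergence-free fields on the sphere *)

Section SphereIdentities.
Variables (R : realType) (kappa : R).
Hypothesis kappa0 : 0 < kappa.
Local Notation C := R[i].
Local Notation k := (kappa%:C%C : C).
Local Notation d := (dc (-'i%C)).
Local Notation db := (dc ('i%C)).
Local Notation cj := conjc.
Local Notation zb x := (conjc (zc x)).
Local Notation tensor := (tensor kappa).
Local Notation lam := (lam kappa).
Local Notation lam2 := (lam2 kappa).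
Local Notation ilam2 := (ilam2 kappa).
Local Notation twist := (twist kappa).
Implicit Types (x : R * R) (f g h w v : bool -> R * R -> C).

Let dcM' e (f g : R * R -> C) x : csmooth f -> csmooth g ->
  dc e (fun y => f y * g y) x = dc e f x * g x + f x * dc e g x.
Proof. by move=> sf sg; rewrite dcM //; exact: csmooth_cdiff. Qed.

Let slam2 : csmooth lam2. Proof. exact: csmooth_lam2. Qed.

Lemma complex_real_conj (c : C) : cj c = c -> c = (Re c)%:C%C.
Proof.
case: c => a b [] /eqP; rewrite eq_sym -addr_eq0 -mulr2n mulrn_eq0 /= => /eqP ->.
by [].
Qed.

Lemma lam2E x : lam2 x = (Re (lam2 x))%:C%C.
Proof. by apply: complex_real_conj; exact: lam2J. Qed.

(* div u + i rot u, for the field with complex components [w] *)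
Definition curl w (s : bool) x : C := twist 2 (w s) x.

(* the complex components of div S u, when div u = 0 *)
Definition lap w (s : bool) x : C := ilam2 x * twist 2 (db (w s)) x.

Lemma twist2E (f : R * R -> C) x : csmooth f ->
  twist 2 f x = ilam2 x * d (fun y => lam2 y * f y) x.
Proof. by move=> sf; rewrite d_lam2M // mulrA (mulrC (ilam2 x)) lam2K // mul1r. Qed.

Lemma tensor_eq a b a' b' (f g : bool -> R * R -> C) : tensor a b f ->
  a = a' -> b = b' -> (forall s x, f s x = g s x) -> tensor a' b' g.
Proof.
by move=> tf <- <- e; suff -> : g = f by []; apply/funext => s; apply/funext => x.
Qed.

(** Multiplication by [lam2] brings the first weight to 0, where [d] is tensorial, and [ilam2]
    brings it back afterwards. *)
Lemma tensor_twist2 (f : bool -> R * R -> C) b :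
  (forall s, csmooth (f s)) ->
  tensor 0 b (fun s x => lam2 x * f s x) ->
  tensor 0 (b + 1) (fun s => twist 2 (f s)).
Proof.
move=> sf tf.
apply: (tensor_eq (tensorM kappa0 (tensor_ilam2 kappa0) (tensor_d kappa0 tf))).
- by [].
- by rewrite addrC.
- by move=> s x; rewrite twist2E.
Qed.

Lemma tensor_curl w : tensor 1 0 w -> tensor 0 0 (curl w).
Proof.
move=> tw; have [sw _] := tw.
exact: tensor_twist2 sw (tensorM kappa0 (tensor_lam2 kappa0) tw).
Qed.

Lemma tensor_lap w : tensor 1 0 w -> tensor 1 0 (lap w).
Proof.
move=> tw; have tq := tensor_db kappa0 tw; have [sq _] := tq.
have t2 := tensor_twist2 sq (tensorM kappa0 (tensor_lam2 kappa0) tq).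
exact: (tensor_eq (tensorM kappa0 (tensor_ilam2 kappa0) t2)).
Qed.

(** The curvature term in the commutator of [db] and [twist 2] gives the term of order zero, 2 kappa
    u. *)
Lemma lam2_lap w s x : csmooth (w s) ->
  lam2 x * lap w s x = db (curl w s) x + (2 * kappa)%:C%C * (lam2 x * w s x).
Proof.
move=> sw; rewrite /lap mulrA lam2K // mul1r /curl db_twist // rmorphM (rmorph_nat _ 2).
ring.
Qed.

Lemma tensor_cst00 (c : C) : tensor 0 0 (fun _ _ => c).
Proof.
split=> [s|x x0]; first exact: csmooth_cst.
by rewrite !expr0z !mul1r.
Qed.


(* [pairing f g] is the real part of the integral of [cj f * g] over the sphere,
   when [f] is of type (a, b) and [g] of type (- b, - a). *)
Definition pairing f g : R :=
  plane_int (fun x => Re (lam2 x * (cj (f false x) * g false x))).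

Lemma pairing_integrable a b f g : tensor a b f -> tensor (- b) (- a) g ->
  plane_integrable (fun x => Re (lam2 x * (cj (f false x) * g false x))).
Proof.
move=> tf tg; have t := tensorM kappa0 (tensor_lam2 kappa0) (tensorM kappa0 (tensorJ tf) tg).
by apply: (tensor_integrable kappa0 t); rewrite !subrr.
Qed.

Lemma eq_pairing f g f' g' :
  (forall x, Re (lam2 x * (cj (f false x) * g false x)) =
             Re (lam2 x * (cj (f' false x) * g' false x))) ->
  pairing f g = pairing f' g'.
Proof. by move=> e; congr plane_int; apply/funext. Qed.

Lemma eq_pairing0 f g :
  (forall x, Re (lam2 x * (cj (f false x) * g false x)) = 0) -> pairing f g = 0.
Proof.
move=> e; rewrite /pairing (_ : (fun x => _) = fun=> 0) /plane_int; last exact/funext.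
by rewrite integral0.
Qed.

Lemma pairingC f g : pairing f g = pairing g f.
Proof.
apply: eq_pairing => x; rewrite lam2E.
by move: (Re _) (f _ _) (g _ _) => r [f1 f2] [g1 g2] /=; ring.
Qed.

Lemma pairingDr a b f g h : tensor a b f -> tensor (- b) (- a) g ->
  tensor (- b) (- a) h ->
  pairing f (fun s x => g s x + h s x) = pairing f g + pairing f h.
Proof.
move=> tf tg th; rewrite /pairing -plane_intD; [|exact: pairing_integrable tf tg|
  exact: pairing_integrable tf th].
by congr plane_int; apply/funext => x; rewrite !mulrDr raddfD.
Qed.

Lemma pairingZr a b f g (c : R) : tensor a b f -> tensor (- b) (- a) g ->
  pairing f (fun s x => c%:C%C * g s x) = c * pairing f g.
Proof.
move=> tf tg; rewrite /pairing -plane_intZ; last exact: pairing_integrable tf tg.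
congr plane_int; apply/funext => x.
by move: (lam2 x) (f _ _) (g _ _) => [l1 l2] [f1 f2] [g1 g2] /=; ring.
Qed.

Lemma pairing_ge0 f : 0 <= pairing f f.
Proof.
apply: plane_int_ge0 => x; rewrite /lam2 (complex_real_conj (lamJ kappa0 x)).
move: (Re (lam x)) (f _ _) => r [f1 f2] /=.
rewrite (_ : _ - _ = (r * f1) ^+ 2 + (r * f2) ^+ 2); last by ring.
by rewrite addr_ge0 ?sqr_ge0.
Qed.

Lemma pairing_adjoint b f g : tensor 1 b f -> tensor (- b) 0 g ->
  pairing (fun s => twist 2 (f s)) g = - pairing f (fun s => db (g s)).
Proof.
move=> tf tg; have tl := tensor_lam2 kappa0; have [sf _] := tf; have [sg _] := tg.
pose F s x := lam2 x * cj (f s x) * g s x.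
have tF : tensor (-1) 0 F.
  apply: (tensor_eq (tensorM kappa0 (tensorM kappa0 tl (tensorJ tf)) tg)) => //.
  by rewrite addrK.
have tt : tensor 0 b (fun s => twist 2 (f s)).
  have := tensor_twist2 sf (tensorM kappa0 tl tf); rewrite addrAC.
  by move/tensor_eq; apply => //; rewrite addNr add0r.
have tdg := tensor_db kappa0 tg.
have [_ I0] := tensor_flux kappa0 tF.
apply/eqP; rewrite -addr_eq0; apply/eqP; rewrite -[RHS]I0 /pairing -plane_intD.
- congr plane_int; apply/funext => x; rewrite /F dcM' //.
    rewrite db_lam2MJ //; move: (lam2 x) (f false x) (twist _ _ _) (g _ _) (db _ _).
    by move=> [l1 l2] [f1 f2] [t1 t2] [g1 g2] [d1 d2] /=; ring.
  by apply: csmoothM => //; exact: csmoothJ.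
- exact: pairing_integrable tt tg.
- exact: pairing_integrable tf tdg.
Qed.

(* Twice the kinetic energy, the deformation |Su|^2 / 2, the enstrophy and
   |div S u|^2, integrated over the sphere (the last three for div u = 0). *)
Definition energy w : R := pairing w (fun s x => lam2 x * w s x).
Definition deformation w : R := pairing (fun s => db (w s)) (fun s => db (w s)).
Definition enstrophy w : R := pairing (curl w) (curl w).
Definition dissipation w : R := pairing (lap w) (fun s x => lam2 x * lap w s x).

Lemma tensor_lam2w w : tensor 1 0 w -> tensor 0 (-1) (fun s x => lam2 x * w s x).
Proof. by move=> tw; exact: (tensor_eq (tensorM kappa0 (tensor_lam2 kappa0) tw)). Qed.

Lemma pairing_lap w v : tensor 1 0 w -> tensor 1 0 v ->
  pairing (lap w) (fun s x => lam2 x * v s x) =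
  - pairing (fun s => db (w s)) (fun s => db (v s)).
Proof.
move=> tw tv; rewrite -(pairing_adjoint (tensor_db kappa0 tw)) //.
apply: eq_pairing => x; rewrite /lap conjcM ilam2J //; congr Re.
rewrite -[RHS]mul1r -(lam2K kappa0 x).
by move: (lam2 x) (ilam2 x) (cj _) (v _ _) => l i t e; ring.
Qed.

(** Integrate by parts to reach the pairing of [w] with its [lap], replace the latter by means of
    [lam2_lap], and integrate the derivative of [curl w] back by parts. *)
Lemma deformation_enstrophy w : tensor 1 0 w ->
  deformation w = enstrophy w - 2 * kappa * energy w.
Proof.
move=> tw; have [sw _] := tw; have tq := tensor_db kappa0 tw.
have tc := tensor_curl tw; have tdc := tensor_db kappa0 tc.
have tlw := tensor_lam2w tw.
rewrite /deformation -[LHS]opprK -pairing_lap // pairingC.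
rewrite (@eq_pairing _ _ w (fun s x => db (curl w s) x + (2 * kappa)%:C%C * (lam2 x * w s x))).
  rewrite (pairingDr tw); [|exact: (tensor_eq tdc)|exact: (tensor_eq (tensorZ _ tlw))].
  rewrite (pairingZr _ tw) // opprD -(pairing_adjoint tw) //.
move=> x; rewrite -lam2_lap; last exact: sw.
rewrite conjcM lam2J //; congr (Re (_ * _)).
by move: (lam2 x) (cj _) (lap _ _ _) => l a b; ring.
Qed.

(* With [s = lam ^ -2 * db w], Bochner's formula reads
   dissipation = |db s|^2 + 4 kappa deformation. *)
Lemma dissipation_deformation w : tensor 1 0 w ->
  4 * kappa * deformation w <= dissipation w.
Proof.
move=> tw; have tq := tensor_db kappa0 tw; have [sq _] := tq.
have tl := tensor_lap tw; have tdl := tensor_db kappa0 tl.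
(* [db w] has type (1, -1), on which [db] is not tensorial; division by [lam2] gives type (2, 0), on
   which it is. *)
pose s c x := ilam2 x * db (w c) x.
have ts : tensor 2 0 s.
  exact: (tensor_eq (tensorM kappa0 (tensor_ilam2 kappa0) tq)).
have [ss _] := ts; have tds := tensor_db kappa0 ts; have [sds _] := tds.
have tf : tensor 1 (-2) (fun c x => lam2 x * db (s c) x).
  exact: (tensor_eq (tensorM kappa0 (tensor_lam2 kappa0) tds)).
have [sf _] := tf.
rewrite /dissipation (pairing_lap tw tl).
have el c x : lap w c x = twist 4 (s c) x.
  rewrite /lap; have e : db (w c) = fun y => lam2 y * s c y.
    by apply/funext => y; rewrite /s mulrA lam2K // mul1r.
  rewrite e twist_lam2M // mulrA (mulrC (ilam2 x)) lam2K // mul1r.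
  by congr (twist _ _ _); ring.
(* The commutator [db_twist] with p = 4 is the source of the constant 4 kappa, and thereby of the
   decay rate. *)
have edl c x : db (lap w c) x = twist 4 (db (s c)) x + (- (4 * kappa))%:C%C * db (w c) x.
  rewrite (_ : lap w c = twist 4 (s c)); last exact/funext.
  rewrite db_twist // rmorphN rmorphM (rmorph_nat _ 4) mulNr /s; congr (_ - _).
  by rewrite mulrA -[_ * lam2 x * ilam2 x]mulrA lam2K // mulr1.
have tt : tensor 1 (-1) (fun c => twist 4 (db (s c))).
  apply: (tensor_eq (tensorD tdl (tensorZ (4 * kappa)%:C%C tq))) => // c x.
  by rewrite edl rmorphN mulNr subrK.
rewrite (@eq_pairing _ _ (fun s => db (w s))
  (fun c x => twist 4 (db (s c)) x + (- (4 * kappa))%:C%C * db (w c) x)); last first.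
  by move=> x; rewrite edl.
rewrite (pairingDr tq); [|exact: (tensor_eq tt)|exact: (tensor_eq (tensorZ _ tq))].
rewrite (pairingZr _ tq) // opprD mulNr opprK lerDr.
(* The other term becomes, by [pairing_adjoint], the nonnegative integral of lam^4 |db s|^2. *)
rewrite pairingC (@eq_pairing _ _ (fun c => twist 2 (fun x => lam2 x * db (s c) x)) s).
  rewrite (pairing_adjoint tf) // opprK.
  rewrite /pairing; apply: plane_int_ge0 => x; rewrite /lam2 (complex_real_conj (lamJ kappa0 x)).
  move: (Re (lam x)) (db _ _) => r [f1 f2] /=.
  rewrite (_ : _ - _ = (r * r * f1) ^+ 2 + (r * r * f2) ^+ 2); last by ring.
  by rewrite addr_ge0 ?sqr_ge0.
move=> x; rewrite twist_lam2M //.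
have e4 : 2 + 2 = 4 :> C by ring.
rewrite e4 conjcM lam2J // -[db (w false) x]mul1r -(lam2K kappa0 x).
rewrite /s; congr (Re (_ * _)).
by move: (lam2 x) (ilam2 x) (cj _) (db _ _) => l i a b; ring.
Qed.

(** d db is the flat Laplacian, a real operator: conjugation exchanges [d] and [db], and the two
    commute. *)
Lemma d_db_imaginary (f : R * R -> C) x : csmooth f -> (forall y, Re (f y) = 0) ->
  Re (d (db f) x) = 0.
Proof.
move=> sf f0; have e : f = fun y => - cj (f y).
  by apply/funext => y; apply: complex_eqP; have := f0 y; case: (f y) => a b /= h;
    rewrite ?h ?oppr0 ?opprK.
have E : db f = fun y => - cj (d f y).
  apply/funext => y; rewrite {1}e dcN ?dbJ //; exact/csmooth_cdiff/csmoothJ.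
have : d (db f) x = - cj (d (db f) x).
  rewrite {1}E dcN; last exact/csmooth_cdiff/csmoothJ/csmooth_dc.
  rewrite dJ; last exact: csmooth_dc.
  by rewrite [db (d f) x]dc_swap.
case: (d _ _) => a b /= [h _]; lra.
Qed.

(** This removes the pressure. Integrating by parts leaves div (L u), which vanishes when div u = 0:
    by [lam2_lap] it is the real part of a Laplacian of the imaginary function [curl w] plus a
    multiple of [curl w]. *)
Lemma pairing_lap_grad w f : tensor 1 0 w -> tensor 0 0 f ->
  (forall s x, Re (curl w s x) = 0) -> (forall s x, Im (f s x) = 0) ->
  pairing (lap w) (fun s => db (f s)) = 0.
Proof.
move=> tw tf c0 f0; have tl := tensor_lap tw; have [sl _] := tl; have [sw _] := tw.
have [sc _] := tensor_curl tw.
rewrite -[LHS]opprK -(pairing_adjoint tl) //; apply/eqP; rewrite oppr_eq0; apply/eqP.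
apply: eq_pairing0 => x; rewrite twist2E //.
have slw : csmooth (fun y => lam2 y * w false y) by exact: csmoothM.
rewrite (_ : (fun y => lam2 y * lap w false y) =
   fun y => db (curl w false) y + (2 * kappa)%:C%C * (lam2 y * w false y)); last first.
  by apply/funext => y; rewrite lam2_lap.
rewrite dcD; [|exact/csmooth_cdiff/csmooth_dc|apply: csmooth_cdiff; apply: csmoothM => //;
  exact: csmooth_cst].
rewrite dcZ; last exact: csmooth_cdiff.
rewrite d_lam2M // -/(curl w false x) conjcM ilam2J //.
rewrite -mulrA mulrA lam2K // mul1r lam2E.
have := d_db_imaginary x (sc false) (c0 false); have := c0 false x; have := f0 false x.
move: (Re (lam2 x)) (d _ x) (curl _ _ _) (f _ _) => l [a1 a2] [c1 c2] [f1 f2] /= -> -> ->; ring.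
Qed.

(** This removes the convection. In L u as given by [lam2_lap], the term 2 kappa u is pointwise
    orthogonal to rot u times the rotated field. The other term makes the integrand a constant
    multiple of the inner product of u with the gradient of (rot u)^2, whose integral vanishes
    because div u = 0. *)
Lemma pairing_lap_curl w : tensor 1 0 w -> (forall s x, Re (curl w s x) = 0) ->
  pairing (lap w) (fun s x => curl w s x * (lam2 x * w s x)) = 0.
Proof.
move=> tw c0; have tc := tensor_curl tw; have [sc _] := tc; have [sw _] := tw.
have tcc := tensorM kappa0 tc tc.
have : pairing w (fun s => db (fun x => curl w s x * curl w s x)) = 0.
  rewrite -[LHS]opprK -(pairing_adjoint tw) //; apply/eqP; rewrite oppr_eq0; apply/eqP.
  apply: eq_pairing0 => x; rewrite -/(curl w false x) lam2E.
  have := c0 false x; move: (Re (lam2 x)) (curl _ _ _) => l [c1 c2] /= ->; ring.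
rewrite /pairing => I0; rewrite (_ : (fun x => _) = (fun x => (- 2^-1) *
  Re (lam2 x * (cj (w false x) * db (fun x => curl w false x * curl w false x) x)))).
  rewrite plane_intZ ?I0 ?mulr0 //.
  have := @pairing_integrable 1 0 w (fun s => db (fun x => curl w s x * curl w s x)) tw.
  by apply; exact: (tensor_eq (tensor_db kappa0 tcc)).
apply/funext => x; rewrite dcM' // (_ : lam2 x * _ =
  cj (lam2 x * lap w false x) * (curl w false x * (lam2 x * w false x))); last first.
  by rewrite conjcM lam2J //; ring.
rewrite lam2_lap // lam2E.
have := c0 false x; move: (curl _ _ _) (db _ x) (w _ _) (Re (lam2 x)) => [c1 c2] [d1 d2] [w1 w2] l.
by move=> /= ->; field.
Qed.

(* A divergence-free field is orthogonal to gradients. *)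
Lemma pairing_grad w (f : bool -> R * R -> C) : tensor 1 0 w -> tensor 0 0 f ->
  (forall s x, Re (curl w s x) = 0) -> (forall s x, Im (f s x) = 0) ->
  pairing w (fun s => db (f s)) = 0.
Proof.
move=> tw tf c0 f0.
rewrite -[LHS]opprK -(pairing_adjoint tw) //; apply/eqP; rewrite oppr_eq0; apply/eqP.
apply: eq_pairing0 => x; rewrite -/(curl w false x) lam2E.
have := c0 false x; have := f0 false x.
move: (Re (lam2 x)) (curl _ _ _) (f _ _) => l [c1 c2] [f1 f2] /= -> ->; ring.
Qed.

End SphereIdentities.

(** * Lipschitz bounds from bounds on the partial derivatives *)

Section Lipschitz.
Variable R : realType.
Implicit Types (x a : R * R).

Lemma lipschitz_line (f g : R -> R) (M a b : R) :
  (forall t, is_derive t (1 : R) f (g t)) -> (forall t, `|g t| <= M) ->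
  `|f b - f a| <= M * `|b - a|.
Proof.
move=> df gM.
have cf : continuous f.
  by move=> t; apply: differentiable_continuous; apply/derivable1_diffP;
    have d := df t; exact: ex_derive.
have key c e : c <= e -> `|f e - f c| <= M * `|e - c|.
  rewrite le_eqVlt => /orP[/eqP ->|ce]; first by rewrite !subrr normr0 mulr0.
  have [t tt ->] := @MVT _ f g _ _ ce (fun t _ => df t) (continuous_subspaceT cf).
  by rewrite normrM ler_wpM2r.
have [ab|/ltW ba] := leP a b; first exact: key.
by rewrite distrC [in leRHS]distrC key.
Qed.

Lemma lipschitz_plane (f : R * R -> R) (M : R) : (forall x, differentiable f x) ->
  (forall i x, `|pd i f x| <= M) ->
  forall x a, `|f x - f a| <= M * (`|x.1 - a.1| + `|x.2 - a.2|).
Proof.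
move=> df fM [x1 x2] [a1 a2] /=; rewrite mulrDr.
have := ler_normD (f (x1, x2) - f (a1, x2)) (f (a1, x2) - f (a1, a2)).
rewrite addrA subrK => /le_trans; apply; apply: lerD.
- apply: (@lipschitz_line (fun s => f (s, x2)) (fun s => pd 0 f (s, x2))) => // t.
  have := @is_derive_line _ _ _ f (0, x2) (1, 0) t.
  have E s : (0, x2) + s *: (1, 0) = (s, x2) :> R * R.
    by congr (_, _); rewrite /= /GRing.scale /=; ring.
  rewrite E; under eq_fun do rewrite E; apply.
  exact: diff_derivable.
- apply: (@lipschitz_line (fun s => f (a1, s)) (fun s => pd 1 f (a1, s))) => // t.
  have := @is_derive_line _ _ _ f (a1, 0) (0, 1) t.
  have E s : (a1, 0) + s *: (0, 1) = (a1, s) :> R * R.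
    by congr (_, _); rewrite /= /GRing.scale /=; ring.
  rewrite E; under eq_fun do rewrite E; apply.
  exact: diff_derivable.
Qed.

Lemma normc_le2 (c : R[i]) : normc c <= `|Re c| + `|Im c|.
Proof.
rewrite -ler_sqr ?nnegrE ?normc_ge0 ?addr_ge0 // normcE2 sqrrD !real_normK ?num_real //.
by rewrite -addrA lerD2l lerDr mulrn_wge0 // mulr_ge0.
Qed.

Lemma lipschitz_cplane (h : R * R -> R[i]) (M : R) : 0 <= M -> csmooth h ->
  (forall i x, normc (cpd i h x) <= M) ->
  forall x a, normc (h x - h a) <= 4 * M * normc (zc x - zc a).
Proof.
move=> M0 [s1 s2] hM x a.
have p1 i y : `|pd i (fun y => Re (h y)) y| <= M.
  apply: le_trans (hM i y); rewrite cpd.unlock.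
  exact: (le_trans _ (normc_re _)).
have p2 i y : `|pd i (fun y => Im (h y)) y| <= M.
  apply: le_trans (hM i y); rewrite cpd.unlock.
  exact: (le_trans _ (normc_im _)).
have l1 := lipschitz_plane (smooth_differentiable s1) p1 x a.
have l2 := lipschitz_plane (smooth_differentiable s2) p2 x a.
apply: (le_trans (normc_le2 _)); rewrite reD imD reN imN.
have n1 : `|x.1 - a.1| <= normc (zc x - zc a) by exact: (normc_re (zc x - zc a)).
have n2 : `|x.2 - a.2| <= normc (zc x - zc a) by exact: (normc_im (zc x - zc a)).
apply: (le_trans (lerD l1 l2)).
rewrite -mulrDr (mulrC 4) -mulrA ler_wpM2l //; lra.
Qed.

End Lipschitz.

(** * The plane as a sigma-finite measure space *)

Section PlaneMeasure.
Variable R : realType.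
Local Notation mu := (@lebesgue_measure R).
Local Notation mu2 := (mu \x mu)%E.

Lemma plane_sigma_finite : sigma_finite setT mu2.
Proof.
have /sigma_finiteP[F [TF ndF Foo]] := sigma_finiteT mu.
exists (fun n => F n `*` F n).
  rewrite -setXTT TF predeqE => -[x y]; split => [[/= [n _ Fnx] [k _ Gky]]|].
    exists (maxn n k) => //; split.
      by move: x Fnx; exact/subsetPset/ndF/leq_maxl.
    by move: y Gky; exact/subsetPset/ndF/leq_maxr.
  by move=> [n _ []/= ? ?]; split; exists n.
move=> k; have [? ?] := Foo k.
split; first exact: measurableX.
by rewrite product_measure1E// lte_mul_pinfty// ge0_fin_numE.
Qed.

(** A named copy of the product measure that carries a sigma-finite structure of its own, for the
    use of Tonelli's theorem on a product of two planes. *)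
Definition plane_measure : set (measurableTypeR R * measurableTypeR R) -> \bar R := mu2.
HB.instance Definition _ := Measure.on plane_measure.
HB.instance Definition _ :=
  Measure_isSigmaFinite.Build _ _ _ plane_measure plane_sigma_finite.

End PlaneMeasure.

(** * The weighted Cauchy kernel and Schur's test *)

Section KernelEstimates.
Variables (R : realType) (kappa : R).
Hypothesis kappa0 : 0 < kappa.
Local Notation rho := (rho kappa).
Local Notation cauchy_kernel := (cauchy_kernel kappa).
Implicit Types (x a : R * R).

Let sk0 : 0 <= Num.sqrt kappa. Proof. exact: sqrtr_ge0. Qed.

Lemma rho_shift a x : rho x <= rho a + Num.sqrt kappa * normc (zc x - zc a).
Proof.
have r0 := rho_gt0 kappa0 a; have d0 := normc_ge0 (zc x - zc a).
rewrite -ler_sqr ?nnegrE ?addr_ge0 ?mulr_ge0 // ?(ltW r0) ?(ltW (rho_gt0 _ _)) //.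
have := normc_add (zc a) (zc x - zc a); rewrite addrC subrK => t.
have t2 : normc (zc x) ^+ 2 <= (normc (zc a) + normc (zc x - zc a)) ^+ 2.
  by rewrite ler_sqr ?nnegrE ?addr_ge0 ?normc_ge0.
have ra := rho_le kappa0 a.
have e y : rho y ^+ 2 = 1 + kappa * normc (zc y) ^+ 2 by rewrite rho_sqr // normcE2.
have ks : Num.sqrt kappa ^+ 2 = kappa by rewrite sqr_sqrtr // ltW.
rewrite sqrrD !e exprMn ks.
have k1 := ler_wpM2l (ltW kappa0) t2.
have k2 : Num.sqrt kappa * normc (zc a) * (Num.sqrt kappa * normc (zc x - zc a)) <=
  rho a * (Num.sqrt kappa * normc (zc x - zc a)) by rewrite ler_wpM2r // mulr_ge0.
move: k1 k2 ks; pose s : R := Num.sqrt kappa; pose na : R := normc (zc a).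
pose nx : R := normc (zc x); pose d : R := normc (zc x - zc a); pose r : R := rho a.
rewrite -/s -/na -/nx -/d -/r => k1 k2 ks.
rewrite -mulr_natr sqrrD -mulr_natr in k1 *.
rewrite -ks in k1 *; clearbody s na nx d r.
by move: k1 k2; clear => k1 k2; lra.
Qed.

Local Notation mu := (@lebesgue_measure R).
Local Notation mu2 := (mu \x mu)%E.

(** The kernel through which [korn_integral] bounds a field by its [db]; the exponent 3 comes from
    the bound rho a / rho x on the cube of [mult a]. *)
Definition decaying_kernel a x : R := (rho x ^+ 3)^-1 * (normc (zc (x - a)))^-1.
Local Notation K := decaying_kernel.

Lemma zcB x a : zc (x - a) = zc x - zc a :> R[i].
Proof. by apply: complex_eqP. Qed.

Lemma decaying_kernel_ge0 a x : 0 <= K a x.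
Proof. by rewrite mulr_ge0 // invr_ge0 ?normc_ge0 // exprn_ge0 // ltW // rho_gt0. Qed.

Lemma continuous_rho : continuous rho.
Proof.
move=> x; apply: (@cvg_comp _ _ _ _ Num.sqrt); last exact: sqrt_continuous.
apply: cvgD; first exact: cvg_cst.
apply: cvgM; first exact: cvg_cst.
have c1 : y.1 @[y --> x] --> x.1 by exact: cvg_fst.
have c2 : y.2 @[y --> x] --> x.2 by exact: cvg_snd.
by apply: cvgD; under eq_fun do rewrite expr2; rewrite expr2; apply: cvgM.
Qed.

Lemma measurable_rho : measurable_fun setT rho.
Proof. exact: continuous_measurable_plane continuous_rho. Qed.

Lemma measurable_inv_rhoX n : measurable_fun setT (fun x => (rho x ^+ n)^-1).
Proof.
apply: continuous_measurable_plane => x; apply: cvgV.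
  by rewrite expf_neq0 // gt_eqF // rho_gt0.
elim: n => [|n IH]; first exact: cvg_cst.
under eq_fun do rewrite exprS; rewrite exprS.
by apply: cvgM => //; exact: continuous_rho.
Qed.

Lemma measurable_inv_normc : measurable_fun setT (fun x => (normc (zc x : R[i]))^-1).
Proof.
apply: (@punctured_measurable_plane R _ 0) => x x0.
apply: cvgV; first by rewrite gt_eqF // normc_gt0 // zc_eq0.
apply: (@cvg_comp _ _ _ _ Num.sqrt); last exact: sqrt_continuous.
have c1 : y.1 @[y --> x] --> x.1 by exact: cvg_fst.
have c2 : y.2 @[y --> x] --> x.2 by exact: cvg_snd.
by apply: cvgD; under eq_fun do rewrite expr2; rewrite expr2; apply: cvgM.
Qed.

Lemma measurable_decaying_kernel :
  measurable_fun setT (fun ax : (R * R) * (R * R) => K ax.1 ax.2).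
Proof.
apply: measurable_funM.
  exact: (measurableT_comp (measurable_inv_rhoX 3) measurable_snd).
apply: (measurableT_comp measurable_inv_normc).
apply: measurable_fun_pair; apply: measurable_funB.
- exact: (measurableT_comp measurable_fst measurable_snd).
- exact: (measurableT_comp measurable_fst measurable_fst).
- exact: (measurableT_comp measurable_snd measurable_snd).
- exact: (measurableT_comp measurable_snd measurable_fst).
Qed.

Lemma measurable_decaying_kernel2 a : measurable_fun setT (K a).
Proof.
have := measurableT_comp measurable_decaying_kernel (measurable_pair1 a).
exact.
Qed.

(** By [rho_shift], rho a <= rho x + sqrt kappa |x - a|. Hence rho a times the kernel is at most the
    sum of rho^-2 / |x - a| and sqrt kappa rho^-3, each of which has integral at most
    [kernel_mass]. *)
Lemma integral_decaying_kernel a :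
  (\int[mu2]_x (K a x)%:E <= (2 * kernel_mass kappa / rho a)%:E)%E.
Proof.
have ra := rho_gt0 kappa0 a.
pose f x := (rho x ^+ 2)^-1 * (normc (zc (x - a)))^-1.
have mf : measurable_fun setT f.
  apply: measurable_funM; first exact: (measurable_inv_rhoX 2).
  apply: (measurableT_comp measurable_inv_normc).
  by apply: measurable_fun_pair; apply: measurable_funB => //; exact: measurable_cst.
have mr : measurable_fun setT (fun x => Num.sqrt kappa * (rho x ^+ 3)^-1).
  by apply: measurable_funM; [exact: measurable_cst|exact: measurable_inv_rhoX].
have f0 x : 0 <= f x.
  by rewrite mulr_ge0 // invr_ge0 ?normc_ge0 // exprn_ge0 // ltW // rho_gt0.
have r0 x : 0 <= Num.sqrt kappa * (rho x ^+ 3)^-1.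
  by rewrite mulr_ge0 // invr_ge0 exprn_ge0 // ltW // rho_gt0.
have key x : K a x <= (rho a)^-1 * (f x + Num.sqrt kappa * (rho x ^+ 3)^-1).
  rewrite ler_pdivlMl // /K /f zcB.
  (* At x = a the kernel is 0, because 0^-1 = 0. *)
  have rx := rho_gt0 kappa0 x; have [xa|xa] := eqVneq x a.
    rewrite xa subrr normc0 invr0 !mulr0 add0r.
    by rewrite mulr_ge0 // invr_ge0 exprn_ge0 // ltW.
  have d0 : 0 < normc (zc x - zc a) by rewrite normc_gt0 // -zcB zc_eq0 subr_eq0.
  have := rho_shift x a; rewrite -[normc (zc a - _)]normc_opp opprB.
  move: (normc _) (rho x) (rho a) rx d0 => d r r' rx d0 h.
  rewrite (_ : _ + _ = (r ^+ 3)^-1 * d^-1 * (r + Num.sqrt kappa * d)); last first.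
    by field; rewrite !gt_eqF.
  rewrite mulrC ler_wpM2l // mulr_ge0 // invr_ge0 ?ltW // exprn_gt0 //.
have mg1 : measurable_fun setT (EFin \o (fun x => f x + Num.sqrt kappa * (rho x ^+ 3)^-1)).
  by apply/measurable_EFinP/measurable_funD.
have mg : measurable_fun setT
    (EFin \o (fun x => (rho a)^-1 * (f x + Num.sqrt kappa * (rho x ^+ 3)^-1))).
  apply/measurable_EFinP/measurable_funM; first exact: measurable_cst.
  exact: measurable_funD.
apply: (@le_trans _ _ (\int[mu2]_x ((rho a)^-1%:E *
    ((f x)%:E + (Num.sqrt kappa * (rho x ^+ 3)^-1)%:E)))%E).
  apply: ge0_le_integral => //.
  - by move=> x _; rewrite lee_fin decaying_kernel_ge0.
  - by apply/measurable_EFinP; exact: measurable_decaying_kernel2.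
  - by move=> x _; rewrite -EFinD -EFinM lee_fin.
rewrite ge0_integralZl //; last 2 first.
- by move=> x _; rewrite -EFinD lee_fin addr_ge0.
- by rewrite lee_fin invr_ge0 ltW.
rewrite (mulrC _ (_^-1)) EFinM; apply: lee_wpmul2l; first by rewrite lee_fin invr_ge0 ltW.
rewrite ge0_integralD //; last 4 first.
- by move=> x _; rewrite lee_fin.
- exact/measurable_EFinP.
- by move=> x _; rewrite lee_fin.
- exact/measurable_EFinP.
rewrite mulr_natl mulr2n EFinD -[kernel_mass kappa]mul1r; apply: leeD.
  apply: (@integral_le_cauchy_kernel R kappa kappa0 a) => // x xa.
  by rewrite mul1r /f zcB.
apply: (@integral_le_cauchy_kernel R kappa kappa0 0) => // x x0.
rewrite mul1r -(ler_pM2l (x := (Num.sqrt kappa)^-1)) ?invr_gt0 ?sqrtr_gt0 //.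
rewrite mulKf ?gt_eqF ?sqrtr_gt0 //; exact: decay_cauchy_kernel.
Qed.

(* Schur's test for the Cauchy kernel with the weights [rho]. *)
Lemma schur_bound (g : R * R -> R) : measurable_fun setT g -> (forall x, 0 <= g x) ->
  (\int[mu2]_a (((rho a ^+ 3)^-1)%:E * \int[mu2]_x (K a x * g x)%:E) <=
   (2 * kernel_mass kappa)%:E * \int[mu2]_x ((rho x ^+ 4)^-1 * g x)%:E)%E.
Proof.
move=> mg g0.
have i0 n x : 0 <= (rho x ^+ n)^-1 by rewrite invr_ge0 exprn_ge0 // ltW // rho_gt0.
pose f (ax : (R * R) * (R * R)) := ((rho ax.1 ^+ 3)^-1 * (K ax.1 ax.2 * g ax.2))%:E.
have mf : measurable_fun setT f.
  apply/measurable_EFinP; apply: measurable_funM.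
    exact: (measurableT_comp (measurable_inv_rhoX 3) measurable_fst).
  apply: measurable_funM; first exact: measurable_decaying_kernel.
  exact: (measurableT_comp mg measurable_snd).
have kg0 a x : 0 <= K a x * g x by apply: mulr_ge0 => //; exact: decaying_kernel_ge0.
have f0 ax : (0 <= f ax)%E by rewrite lee_fin; exact: mulr_ge0.
have mK a : measurable_fun setT (EFin \o K a).
  by apply/measurable_EFinP; exact: measurable_decaying_kernel2.
have mg4 : measurable_fun setT (EFin \o (fun x => 2 * kernel_mass kappa * ((rho x ^+ 4)^-1 * g x))).
  apply/measurable_EFinP/measurable_funM; first exact: measurable_cst.
  by apply: measurable_funM => //; exact: measurable_inv_rhoX.
have : (\int[mu2]_a \int[mu2]_x f (a, x) = \int[mu2]_x \int[mu2]_a f (a, x))%E.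
  exact: (@fubini_tonelli _ _ _ _ R (@plane_measure R) (@plane_measure R) f mf f0).
have mG : measurable_fun setT (fun x => \int[mu2]_a f (a, x))%E.
  exact: (@measurable_fun_fubini_tonelli_G _ _ _ _ R (@plane_measure R) f mf f0).
have inner a : ((rho a ^- 3)%:E * \int[mu2]_x (K a x * g x)%:E =
    \int[mu2]_x f (a, x))%E.
  rewrite -ge0_integralZl //.
  - by apply/measurable_EFinP/measurable_funM => //; exact: measurable_decaying_kernel2.
  - by move=> x _; rewrite lee_fin.
  - by rewrite lee_fin.
under [X in _ -> (X <= _)%E]eq_integral do rewrite inner.
move=> ->.
rewrite -ge0_integralZl //; last 3 first.
- by apply/measurable_EFinP/measurable_funM => //; exact: measurable_inv_rhoX.
- by move=> x _; rewrite lee_fin mulr_ge0.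
- by rewrite lee_fin mulr_ge0 // /kernel_mass !mulr_ge0 ?pi_ge0 // addr_ge0 ?invr_ge0 ?ltW.
apply: ge0_le_integral => //.
- by move=> x _; apply: integral_ge0.
(* The product of rho(a)^-3 and K(a, x) is symmetric in a and x, so the inner integral is again the
   mass of a kernel. *)
move=> x _; have -> : (\int[mu2]_a f (a, x) =
    \int[mu2]_a (((rho x ^+ 3)^-1 * g x)%:E * (K x a)%:E))%E.
  apply: eq_integral => a _; rewrite /f -EFinM /= /K !zcB -(normc_opp (zc x - zc a)) opprB.
  by congr EFin; ring.
rewrite ge0_integralZl //; last 3 first.
- exact: mK.
- by move=> a _; rewrite lee_fin decaying_kernel_ge0.
- by rewrite lee_fin mulr_ge0.
apply: (le_trans (lee_wpmul2l _ (integral_decaying_kernel x))).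
  by rewrite lee_fin mulr_ge0.
rewrite -!EFinM lee_fin le_eqVlt; apply/orP; left; apply/eqP.
have := rho_gt0 kappa0 x; move: (rho x) (g x) (kernel_mass _) => r gx c r0.
by field; rewrite gt_eqF.
Qed.

End KernelEstimates.

(** * Holomorphic vector fields and the conformal multiplier *)

Section Korn.
Variables (R : realType) (kappa : R).
Hypothesis kappa0 : 0 < kappa.
Local Notation C := R[i].
Local Notation k := (kappa%:C%C : C).
Local Notation d := (dc (-'i%C)).
Local Notation db := (dc ('i%C)).
Local Notation cj := conjc.
Local Notation zb x := (conjc (zc x)).
Local Notation tensor := (tensor kappa).
Local Notation lam := (lam kappa).
Local Notation lam2 := (lam2 kappa).
Local Notation ilam2 := (ilam2 kappa).
Local Notation twist := (twist kappa).
Local Notation rho := (rho kappa).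
Local Notation pairing := (pairing kappa).
Local Notation mu := (@lebesgue_measure R).
Local Notation mu2 := (mu \x mu)%E.
Implicit Types (x a : R * R) (w : bool -> R * R -> C).

(* The holomorphic vector fields of the sphere. *)
Definition quad (c0 c1 c2 : C) (s : bool) x : C :=
  if s then - (k * c0 * (zc x * zc x) + c1 * zc x + c2 / k)
  else c0 + c1 * zc x + c2 * (zc x * zc x).

Lemma csmooth_quad c0 c1 c2 s : csmooth (quad c0 c1 c2 s).
Proof.
have sz := csmooth_zc R.
have szz : csmooth (fun x : R * R => zc x * zc x) by exact: csmoothM.
have sc c : csmooth (fun _ : R * R => c : C) by exact: csmooth_cst.
case: s; rewrite /quad; [apply: csmoothN|]; apply: csmoothD => //; try apply: csmoothD => //;
  exact: csmoothM.
Qed.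

Lemma tensor_quad c0 c1 c2 : tensor 1 0 (quad c0 c1 c2).
Proof.
split=> [s|x x0]; first exact: csmooth_quad.
have z0 : zc x != 0 by rewrite zc_eq0.
have k0 : k != 0 by rewrite fmorph_eq0 gt_eqF.
rewrite expr0z mulr1 expr1z /quad zc_transition /inv_zc /jac.
by move: (zc x) z0 k0 => z z0 k0; field; rewrite z0 k0.
Qed.

(* The conformal factor of the rotation that moves [a] to the origin; its
   square is of type (-1, 0), and [db (mult a)] vanishes at [a]. *)
Definition mult a x : C := lam x / 2 * (1 + k * zc a * zb x).

Lemma csmooth_mult a : csmooth (mult a).
Proof.
apply: csmoothM; first by apply: csmoothM; [exact: csmooth_lam|exact: csmooth_cst].
apply: csmoothD; first exact: csmooth_cst.
by apply: csmoothM; [exact: csmooth_cst|apply/csmoothJ/csmooth_zc].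
Qed.

Lemma mult_id a : mult a a = 1.
Proof.
rewrite /mult -[k * _ * _]mulrA lam_eq; have := lam_neq0 kappa0 a; move: (lam a) => l l0.
by field.
Qed.

Lemma d_mult a x : d (mult a) x = - (k * zb x * lam2 x) / 2 * (1 + k * zc a * zb x).
Proof.
have sl := csmooth_lam kappa0; have szJ := csmoothJ (csmooth_zc R).
have s1 : csmooth (fun x : R * R => lam x / 2) by apply: csmoothM => //; exact: csmooth_cst.
have s2 : csmooth (fun x : R * R => k * zc a * zb x) by apply: csmoothM => //; exact: csmooth_cst.
rewrite dcM; [|exact: csmooth_cdiff|apply/csmooth_cdiff/csmoothD => //; exact: csmooth_cst].
rewrite dcM; [|exact: csmooth_cdiff|exact: cdiff_cst].
rewrite dc_cst dcD; [|exact: cdiff_cst|exact: csmooth_cdiff].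
rewrite dc_cst dcZ; last exact: csmooth_cdiff.
by rewrite d_lam // d_zcJ; ring.
Qed.

Lemma db_mult a x : db (mult a) x = k / 2 * lam2 x * (zc a - zc x).
Proof.
have sl := csmooth_lam kappa0; have szJ := csmoothJ (csmooth_zc R).
have s1 : csmooth (fun x : R * R => lam x / 2) by apply: csmoothM => //; exact: csmooth_cst.
have s2 : csmooth (fun x : R * R => k * zc a * zb x) by apply: csmoothM => //; exact: csmooth_cst.
rewrite dcM; [|exact: csmooth_cdiff|apply/csmooth_cdiff/csmoothD => //; exact: csmooth_cst].
rewrite dcM; [|exact: csmooth_cdiff|exact: cdiff_cst].
rewrite dc_cst dcD; [|exact: cdiff_cst|exact: csmooth_cdiff].
rewrite dc_cst dcZ; last exact: csmooth_cdiff.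
rewrite db_lam // db_zcJ.
have := lam_eq kappa x; have := lam_neq0 kappa0 x; rewrite /lam2.
move: (lam x) (zc x) (zb x) => l z z' l0 e.
have E : k * (z * z') * l = 2 - l by rewrite e; field.
transitivity ((- (k * z * (l * l)) - k * zc a * (k * (z * z') * l) * l + 2 * l * k * zc a) / 2).
  by field.
by rewrite E; field.
Qed.

(** Cauchy-Schwarz for the vectors (1, sqrt kappa a) and (1, sqrt kappa x) of C^2; the defect of the
    squares is kappa |a - x|^2. *)
Lemma polar_bound a x : normc (1 + k * zc a * zb x) <= rho a * rho x.
Proof.
have ra := rho_gt0 kappa0 a; have rx := rho_gt0 kappa0 x.
rewrite -ler_sqr ?nnegrE ?normc_ge0 ?mulr_ge0 ?(ltW ra) ?(ltW rx) // exprMn !rho_sqr // normcE2.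
case: a x {ra rx} => a1 a2 [x1 x2] /=.
rewrite -subr_ge0 (_ : _ - _ = kappa * ((a1 - x1) ^+ 2 + (a2 - x2) ^+ 2)); last by ring.
by rewrite mulr_ge0 ?addr_ge0 ?sqr_ge0 // ltW.
Qed.

Lemma mult_bound a x : normc (mult a x) <= rho a / rho x.
Proof.
have rx := rho_gt0 kappa0 x.
have -> : mult a x = ((rho x ^+ 2)^-1)%:C%C * (1 + k * zc a * zb x).
  rewrite /mult /lam ilamE // fmorphV rmorphM fmorphV (rmorph_nat _ 2); congr (_ * _).
  by rewrite invfM invrK -mulrA mulfV ?mulr1 // pnatr_eq0.
rewrite normcM normc_real ger0_norm ?invr_ge0 ?exprn_ge0 ?(ltW rx) //.
rewrite ler_pdivrMl ?exprn_gt0 // (le_trans (polar_bound a x)) // le_eqVlt.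
by apply/orP; left; apply/eqP; field; rewrite gt_eqF.
Qed.

Lemma cpd_bound (f : R * R -> C) i x (M N : R) : normc (d f x) <= M -> normc (db f x) <= N ->
  normc (cpd i f x) <= M + N.
Proof.
move=> hM hN; have M0 := le_trans (normc_ge0 _) hM; have N0 := le_trans (normc_ge0 _) hN.
have ii := iiN R.
have n2 : normc (2^-1 : C) = 2^-1.
  by rewrite normcV -[2]/(2%:R) -(rmorph_nat (real_complex R) 2) normc_real ger0_norm.
have ni : normc ('i%C : C) = 1 by rewrite /= expr0n expr1n add0r sqrtr1.
have key (u v : C) : normc u <= M -> normc v <= N -> normc (2^-1 * (u + v)) <= M + N.
  move=> uM vN; rewrite normcM n2.
  have := le_trans (normc_add u v) (lerD uM vN); have := normc_ge0 (u + v).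
  by move: (normc (u + v)) => t; lra.
have e0 : cpd 0 f x = 2^-1 * (d f x + db f x) by rewrite dc.unlock; field.
have e1 : cpd 1 f x = 2^-1 * ('i%C * d f x + (- 'i%C * db f x)).
  rewrite dc.unlock; transitivity (- ('i%C * 'i%C) * cpd 1 f x); last by field.
  by rewrite ii opprK mul1r.
have [->|->] : i = 0 \/ i = 1.
  by case: i => [[|[|//]] hi]; [left|right]; exact: val_inj.
- by rewrite e0; exact: key.
- by rewrite e1; apply: key; rewrite ?mulNr ?normc_opp normcM ni mul1r.
Qed.

Lemma normc_lam2 x : normc (lam2 x) = 4 / rho x ^+ 4.
Proof.
have rx := rho_gt0 kappa0 x.
rewrite /lam2 /lam ilamE // -fmorphV -rmorphM normc_real ger0_norm.
  by field; rewrite gt_eqF.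
by rewrite mulr_ge0 // invr_ge0 divr_ge0 ?exprn_ge0 // ltW.
Qed.

Lemma cpd_mult_bound a i x :
  normc (cpd i (mult a) x) <= 6 * Num.sqrt kappa * rho a / rho x ^+ 2.
Proof.
have ra := rho_ge1 kappa0 a; have rx := rho_ge1 kappa0 x.
have sk0 : 0 <= Num.sqrt kappa by exact: sqrtr_ge0.
have rx0 : 0 < rho x by exact: rho_gt0.
have nk : normc k = Num.sqrt kappa ^+ 2.
  by rewrite normc_real ger0_norm ?sqr_sqrtr // ltW.
have n2 : normc (2^-1 : C) = 2^-1.
  by rewrite normcV -[2]/(2%:R) -(rmorph_nat (real_complex R) 2) normc_real ger0_norm.
have hx := rho_le kappa0 x; have ha := rho_le kappa0 a.
have zJ : normc (zb x) = normc (zc x) by rewrite normc_conj.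
rewrite (_ : 6 * _ * _ / _ = 2 * (Num.sqrt kappa * rho a / rho x ^+ 2) +
  4 * (Num.sqrt kappa * rho a / rho x ^+ 2)); last by field; rewrite gt_eqF.
apply: cpd_bound.
  rewrite d_mult normcM; have := polar_bound a x.
  move: (lam2 x) (normc_lam2 x) => l hl.
  rewrite normcM normc_opp !normcM n2 nk zJ hl.
  move: (normc (1 + _)) (normc_ge0 (1 + k * zc a * zb x)) => p p0 hp.
  move: hx ra rx0 (normc_ge0 (zc x)); rewrite expr2.
  move: (Num.sqrt kappa) sk0 (normc (zc x)) (rho a) (rho x) hp.
  move=> s s0 n r' r hp hn r'0 r0 n0.
  rewrite [leLHS](_ : _ = 2 * s * (s * n) / r ^+ 4 * p); last by field; rewrite gt_eqF.
  rewrite [leRHS](_ : _ = 2 * s * r / r ^+ 4 * (r' * r)); last by field; rewrite gt_eqF.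
  apply: ler_pM => //; last by rewrite ler_wpM2r ?ler_wpM2l ?invr_ge0 ?exprn_ge0 ?mulr_ge0 ?(ltW r0).
  by rewrite !mulr_ge0 // invr_ge0 exprn_ge0 // ltW.
rewrite db_mult; move: (lam2 x) (normc_lam2 x) => l hl; rewrite !normcM n2 nk hl.
have := normc_add (zc a) (- zc x); rewrite normc_opp.
have := normc_ge0 (zc a - zc x).
move: hx ha ra rx; move: (Num.sqrt kappa) sk0 (normc (_ - _)) (normc (zc a)) (normc (zc x)).
move: (rho a) (rho x) rx0 => r' r r0 s s0 n na nx hx ha r'1 r1 n0 hn.
rewrite [leLHS](_ : _ = 2 * s * (s * n) / r ^+ 4); last by field; rewrite gt_eqF.
rewrite [leRHS](_ : _ = 2 * s * (2 * r' * r ^+ 2) / r ^+ 4); last by field; rewrite gt_eqF.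
rewrite ler_wpM2r ?invr_ge0 ?exprn_ge0 ?(ltW r0) // ler_wpM2l ?mulr_ge0 //.
have h1 : s * n <= s * na + s * nx by rewrite -mulrDr ler_wpM2l.
have h2 : 0 <= (r' - 1) * (r - 1) by rewrite mulr_ge0 // subr_ge0.
have h3 : 0 <= r' * (r * (r - 1)) by rewrite !mulr_ge0 ?subr_ge0 // (le_trans ler01).
have h4 : 0 <= r' * (r - 1) by rewrite !mulr_ge0 ?subr_ge0 // (le_trans ler01).
have h5 : 0 <= r * (r' - 1) by rewrite !mulr_ge0 ?subr_ge0 // (le_trans ler01).
by move: h1 h2 h3 h4 h5 hx ha; clear; move=> *; lra.
Qed.

End Korn.

(** * The Cauchy formula for fields orthogonal to the holomorphic ones *)

Section Korn.
Variables (R : realType) (kappa : R).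
Hypothesis kappa0 : 0 < kappa.
Local Notation C := R[i].
Local Notation k := (kappa%:C%C : C).
Local Notation d := (dc (-'i%C)).
Local Notation db := (dc ('i%C)).
Local Notation cj := conjc.
Local Notation zb x := (conjc (zc x)).
Local Notation tensor := (tensor kappa).
Local Notation lam := (lam kappa).
Local Notation lam2 := (lam2 kappa).
Local Notation rho := (rho kappa).
Local Notation pairing := (pairing kappa).
Local Notation mult := (mult kappa).
Local Notation quad := (quad kappa).
Local Notation K := (decaying_kernel kappa).
Local Notation mu := (@lebesgue_measure R).
Local Notation mu2 := (mu \x mu)%E.
Implicit Types (x a : R * R) (w : bool -> R * R -> C).

Lemma near_neq x a : x != a -> \near x, x != a.
Proof.
move=> xa; have : nbhs x (~` [set a]).
  apply: open_nbhs_nbhs; split; last exact/eqP.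
  apply: closed_openC.
  exact: (accessible_closed_set1 (hausdorff_accessible (@norm_hausdorff _ _))).
by apply: filterS => y /eqP.
Qed.

Lemma near_eq_ccontinuous (f g : R * R -> C) x : (\near x, f x = g x) ->
  ccontinuous_at g x -> ccontinuous_at f x.
Proof.
move=> fg [c1 c2].
have key (P : C -> R) : {for x, continuous (fun y => P (g y))} ->
    {for x, continuous (fun y => P (f y))}.
  move=> c; have e : \near x, P (f x) = P (g x) by apply: filterS fg => y ->.
  have ex : P (f x) = P (g x) := nbhs_singleton e.
  have c' : P (f y) @[y --> x] --> P (g x).
    by apply: cvg_trans c; apply: near_eq_cvg; apply: filterS e => y ->.
  by move: c'; rewrite -ex.
by split; exact: key.
Qed.

Lemma cdiff_ccontinuous (f : R * R -> C) x : cdiff f x -> ccontinuous_at f x.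
Proof. by move=> [d1 d2]; split; exact: differentiable_continuous. Qed.

Section Quotient.
Variables (a : R * R) (f : R * R -> C).
Hypothesis sf : csmooth f.
Let D x := zc a - zc x.
Let F x := f x / D x.

Let D0 x : x != a -> D x != 0.
Proof. by move=> xa; rewrite /D -zcB zc_eq0 subr_eq0 eq_sym. Qed.

Let sD : csmooth D.
Proof. by apply: csmoothB; [exact: csmooth_cst|exact: csmooth_zc]. Qed.

Lemma cdiff_quotient x : x != a -> cdiff F x.
Proof.
move=> xa; apply: cdiffM; first exact: csmooth_cdiff.
by apply: cdiffV; [exact: D0|exact: csmooth_cdiff].
Qed.

Lemma cpd_quotient i x : x != a ->
  cpd i F x = cpd i f x / D x + f x * cpd i (@zc R) x / (D x * D x).
Proof.
move=> xa; rewrite cpdM; [|exact: csmooth_cdiff|apply: cdiffV; [exact: D0|exact: csmooth_cdiff]].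
rewrite cpdV; [|exact: D0|exact: csmooth_cdiff].
rewrite cpdD; [|exact: cdiff_cst|apply: cdiffN; exact: cdiff_zc].
rewrite cpd_cst cpdN; last exact: cdiff_zc.
by rewrite sub0r mulNr opprK mulrA.
Qed.

Lemma ccontinuous_quotient i x : x != a -> ccontinuous_at (cpd i F) x.
Proof.
move=> xa; apply: (@near_eq_ccontinuous _ (fun y =>
   cpd i f y / D y + f y * cpd i (@zc R) y / (D y * D y))).
  near=> y; apply: cpd_quotient; near: y; exact: near_neq.
have cV (g : R * R -> C) : csmooth g -> g x != 0 -> cdiff (fun y => (g y)^-1) x.
  by move=> sg g0; apply: cdiffV => //; exact: csmooth_cdiff.
apply/cdiff_ccontinuous/cdiffD; apply: cdiffM.
- exact/csmooth_cdiff/csmooth_cpd.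
- by apply: cV => //; exact: D0.
- by apply/csmooth_cdiff/csmoothM => //; exact/csmooth_cpd/csmooth_zc.
- by apply: cV; [exact: csmoothM|rewrite mulf_neq0 ?D0].
Unshelve. all: by end_near. Qed.

Lemma db_quotient x : x != a -> db F x = db f x / D x.
Proof.
move=> xa; rewrite dcM; [|exact: csmooth_cdiff|apply: cdiffV; [exact: D0|exact: csmooth_cdiff]].
rewrite dcV; [|exact: D0|exact: csmooth_cdiff].
rewrite dcB; [|exact: cdiff_cst|exact: cdiff_zc].
by rewrite dc_cst db_zc subrr mul0r oppr0 mulr0 addr0.
Qed.

End Quotient.

(** The integral of [mult a ^ 2] times [lam2 * w] is thus a pairing of [w] with a holomorphic field,
    and disappears under the orthogonality assumption. *)
Lemma quad_mult a x :
  lam2 x * cj (quad 4^-1 (k * zb a / 2) (k * k * (zb a * zb a) / 4) false x) =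
  mult a x * mult a x.
Proof.
have -> c0 c1 c2 : quad c0 c1 c2 false x = c0 + c1 * zc x + c2 * (zc x * zc x) by [].
have cD (u v : C) : cj (u + v) = cj u + cj v.
  exact: (rmorphD (conjc : {rmorphism C -> C})).
rewrite !cD !conjcM !conjcK !conjc_inv !(conjc_nat _ 4) !(conjc_nat _ 2) conjc_real.
rewrite /mult /lam2.
by move: (lam x) (zc a) (zb x) => l z z'; field.
Qed.

Lemma ae_neq_plane a : {ae mu2, forall x, x != a}.
Proof.
exists [set a]; split.
- rewrite (_ : [set a] = [set a.1] `*` [set a.2]); first exact: measurableX.
  by apply/seteqP; split => [x ->|[x1 x2] [/= -> ->]] //; case: a.
- rewrite (_ : [set a] = [set a.1] `*` [set a.2]).
    rewrite [LHS]product_measure1E // -[RHS](mul0e 0%E); congr (_ * _)%E;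
      exact: lebesgue_measure_set1.
  by apply/seteqP; split => [x ->|[x1 x2] [/= -> ->]] //; case: a.
- by move=> x /= /negP; rewrite negbK => /eqP.
Qed.

Lemma plane_int_le_ae (G H : R * R -> R) a : plane_integrable G ->
  measurable_fun setT H -> (forall x, 0 <= H x) -> (forall x, x != a -> `|G x| <= H x) ->
  ((plane_int G)%:E <= \int[mu2]_x (H x)%:E)%E.
Proof.
move=> iG mH H0 GH.
have fG : (\int[mu2]_x (G x)%:E)%E \is a fin_num by exact: integrable_fin_num.
rewrite /plane_int fineK //.
have mG : measurable_fun setT (EFin \o G) by exact: measurable_int iG.
apply: (@le_trans _ _ (\int[mu2]_x `|(G x)%:E|)%E).
  apply: le_trans (lee_abs _) _; exact: le_abse_integral.
apply: ae_ge0_le_integral => //.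
- by apply: measurableT_comp.
- by move=> x _; rewrite lee_fin.
- exact/measurable_EFinP.
have aeF := ae_filter_ringOfSetsType mu2.
by have := ae_neq_plane a; apply: filterS => x xa _; rewrite lee_fin GH.
Qed.


Lemma continuous_normc (f : R * R -> C) : csmooth f -> continuous (fun x => normc (f x)).
Proof.
move=> [s1 s2] x.
have -> : (fun x => normc (f x)) = fun x => Num.sqrt (Re (f x) * Re (f x) + Im (f x) * Im (f x)).
  by apply/funext => y; case: (f y) => a b /=; rewrite !expr2.
apply: (@cvg_comp _ _ _ _ Num.sqrt); last exact: sqrt_continuous.
have c1 := smooth_continuous s1; have c2 := smooth_continuous s2.
by apply: cvgD; apply: cvgM; [exact: c1|exact: c1|exact: c2|exact: c2].
Qed.

(* Stokes' theorem for the field [mult a * (mult a ^ 2 * w - w a) / (a - z)]. *)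
Lemma korn_integral w a : tensor 1 0 w ->
  (forall c0 c1 c2, pairing (quad c0 c1 c2) (fun s x => lam2 x * w s x) = 0) ->
  ((kappa / 2 * plane_int (fun x => Re (lam2 x)) * normc (w false a) ^+ 2)%:E <=
   \int[mu2]_x (normc (w false a) * rho a ^+ 3 * (K a x * normc (db (w false) x)))%:E)%E.
Proof.
move=> tw orth; have [sw _] := tw; set wa := w false a.
have ra := rho_gt0 kappa0 a.
have tl := tensor_lam2 kappa0; have [sl _] := tl.
(* [Q c] is c times the holomorphic field of [quad_mult], so that lam2 conj(Q 1) is the square of
   [mult a]. *)
pose Q c := quad (c * 4^-1) (c * (k * zb a / 2)) (c * (k * k * (zb a * zb a) / 4)).
have QE c x : Q c false x = c * Q 1 false x.
  by rewrite /Q /quad !mul1r !mulrDr !mulrA.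
pose msq s x := lam2 x * cj (Q 1 s x).
pose m := mult a.
have sm : csmooth m := csmooth_mult kappa0 a.
have mb : forall x, normc (m x) <= rho a / rho x := mult_bound kappa0 a.
have mb' : forall i x, normc (cpd i m x) <= 6 * Num.sqrt kappa * rho a / rho x ^+ 2 :=
  cpd_mult_bound kappa0 a.
have dbm : forall x, db m x = k / 2 * lam2 x * (zc a - zc x) := db_mult kappa0 a.
have m1 : m a = 1 := mult_id kappa0 a.
have msqE x : msq false x = m x * m x.
  by rewrite /msq /Q !mul1r quad_mult.
have tmw : tensor 0 0 (fun s x => msq s x * w s x).
  have tQ : tensor 1 0 (Q 1) by exact: tensor_quad.
  have tmsq : tensor (-1) 0 msq := tensorM kappa0 tl (tensorJ tQ).
  exact: (tensorM kappa0 tmsq tw).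
(* [h] is a bounded Lipschitz function that vanishes at [a]. So h / (a - z) is bounded, and its
   derivatives are no more singular than the Cauchy kernel; the extra factor [m] provides the decay
   that [plane_flux] asks for. *)
pose h s x := msq s x * w s x + - wa.
have th : tensor 0 0 h by apply: tensorD => //; exact: tensor_cst00.
have [sh' _] := th; have sh := sh' false.
clearbody m.
have ha : h false a = 0 by rewrite /h msqE m1 !mul1r subrr.
have [M1 M10 hM1] := tensor_bounded kappa0 th.
have [M2 M20 hM2] := tensor_cpd_bounded kappa0 th.
pose f x := cj wa * (m x * h false x).
have sf : csmooth f by apply: csmoothM; [exact: csmooth_cst|exact: csmoothM].
pose F x := f x / (zc a - zc x).
have h1 x : normc (h false x) <= M1 by have := hM1 x; rewrite expr0z mulr1.
have h2 i x : normc (cpd i (h false) x) <= M2 / rho x by have := hM2 i x; rewrite expr0z mul1r.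
have h3 x : normc (h false x) <= 4 * M2 * normc (zc a - zc x).
  have := @lipschitz_cplane _ (h false) M2 M20 sh _ x a.
  rewrite ha subr0 -[normc (zc x - _)]normc_opp opprB; apply => i y.
  apply: (le_trans (h2 i y)); rewrite ler_pdivrMr ?rho_gt0 // ler_peMr //.
  exact: rho_ge1.
pose L := 4 * M2 * rho a + Num.sqrt kappa * M1.
have h4 x : rho x * normc (h false x) <= L * normc (zc a - zc x).
  have := rho_shift kappa0 a x; rewrite -[normc (zc x - _)]normc_opp opprB => sx.
  apply: (le_trans (ler_wpM2r (normc_ge0 _) sx)).
  rewrite mulrDl /L mulrDl; apply: lerD.
    by rewrite mulrAC [leRHS]mulrC ler_wpM2l // ltW.
  rewrite -!mulrA ler_wpM2l ?sqrtr_ge0 // mulrC ler_wpM2r ?normc_ge0 //.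
have nwa := normc_ge0 wa.
have dn x : x != a -> 0 < normc (zc a - zc x).
  by move=> xa; rewrite normc_gt0 // -zcB zc_eq0 subr_eq0 eq_sym.
have nzc i x : normc (cpd i (@zc R) x) = 1.
  have [->|->] : i = 0 \/ i = 1.
    by case: i => [[|[|//]] hi]; [left|right]; exact: val_inj.
  - by rewrite cpd0_zc normc1.
  - by rewrite cpd1_zc /= expr0n expr1n add0r sqrtr1.
pose B := normc wa * (6 * Num.sqrt kappa * rho a * M1 + rho a * M2 + rho a * L).
have bF i x : x != a -> normc (cpd i F x) <= B * cauchy_kernel kappa a x.
  move=> xa; rewrite cpd_quotient //.
  have -> : cpd i f x = cj wa * (cpd i m x * h false x + m x * cpd i (h false) x).
    rewrite cpdM; [|exact: cdiff_cst|apply/csmooth_cdiff/csmoothM => //].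
    by rewrite cpd_cst mul0r add0r cpdM //; exact: csmooth_cdiff.
  have rx := rho_gt0 kappa0 x; have dx := dn _ xa.
  have n1 := mb x; have n2 := mb' i x; have n3 := h1 x; have n4 := h2 i x; have n5 := h4 x.
  apply: (le_trans (normc_add _ _)).
  rewrite /f !normcM !normcV !normcM nzc mulr1 normc_conj.
  rewrite /cauchy_kernel -[normc (zc x - _)]normc_opp opprB.
  have n6 : normc (cpd i m x * h false x + m x * cpd i (h false) x) <=
      (6 * Num.sqrt kappa * rho a * M1 + rho a * M2) / rho x ^+ 2.
    apply: (le_trans (normc_add _ _)); rewrite !normcM mulrDl; apply: lerD.
      by rewrite mulrAC ler_pM // normc_ge0.
    rewrite [leRHS](_ : _ = (rho a / rho x) * (M2 / rho x)); last by field; rewrite gt_eqF.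
    by rewrite ler_pM // normc_ge0.
  have n7 : normc (m x) * normc (h false x) / normc (zc a - zc x) <= rho a * L / rho x ^+ 2.
    rewrite ler_pdivrMr // [leRHS](_ : _ = (rho a / rho x) * (L * normc (zc a - zc x) / rho x)).
      by rewrite ler_pM ?normc_ge0 // ler_pdivlMr // mulrC.
    by field; rewrite gt_eqF.
  move: n6 n7 dx rx nwa; rewrite /B; move: (normc (_ + _)) (normc (m x) * _) (normc (zc a - _)).
  move: (6 * _ * _ * _) (rho a * M2) (rho a * L) (rho x) (normc wa).
  move=> b1 b2 b3 r nw u v e n6 n7 e0 r0 nw0.
  rewrite [leLHS](_ : _ = nw / e * (u + v / e)); last by field; rewrite gt_eqF.
  rewrite [leRHS](_ : _ = nw / e * ((b1 + b2) / r ^+ 2 + b3 / r ^+ 2)); last by field; rewrite !gt_eqF.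
  by apply: ler_wpM2l; [rewrite divr_ge0 // ltW|exact: lerD].
have dF x : normc (F x) <= (normc wa * rho a * (4 * M2)) / rho x.
  have rx := rho_gt0 kappa0 x; rewrite /F /f !normcM normcV normc_conj.
  have [->|xa] := eqVneq x a.
    by rewrite subrr normc0 invr0 mulr0 !mulr_ge0 // ?invr_ge0 ltW.
  have dx := dn _ xa.
  rewrite ler_pdivrMr // [leRHS](_ : _ = normc wa * ((rho a / rho x) * (4 * M2 * normc (zc a - zc x)))).
    by rewrite ler_wpM2l // ler_pM ?normc_ge0.
  by field; rewrite gt_eqF.
pose B' := B + normc wa * rho a * (4 * M2).
have [iF IF] : plane_integrable (fun x => Re (db F x)) /\
    plane_int (fun x => Re (db F x)) = 0.
  have B0 : 0 <= B.
    by rewrite mulr_ge0 // !addr_ge0 // !mulr_ge0 ?addr_ge0 ?mulr_ge0 ?sqrtr_ge0 // ltW.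
  have B'0 : 0 <= normc wa * rho a * (4 * M2) by rewrite !mulr_ge0 // ltW.
  apply: (plane_flux kappa0 (fun x xa => cdiff_quotient sf xa)
    (fun i x xa => ccontinuous_quotient sf i xa) (C := B')) => [i x xa|x].
    apply: (le_trans (bF i x xa)); apply: ler_wpM2r; first exact: cauchy_kernel_ge0.
    by rewrite lerDl.
  apply: (le_trans (dF x)); apply: ler_wpM2r; first by rewrite invr_ge0 ltW // rho_gt0.
  by rewrite lerDr.
have tQw : tensor 1 0 (Q wa) by exact: tensor_quad.
have tlw := tensor_lam2w kappa0 tw.
have iQ := pairing_integrable kappa0 tQw (tensor_eq tlw erefl erefl (fun s x => erefl)).
have il : plane_integrable (fun x => Re (lam2 x)).
  exact: (tensor_integrable kappa0 tl).
(* Since db m = kappa / 2 lam2 (a - z), the derivatives of [m] in db F cancel the denominator. They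
   give a term that integrates to 0 by orthogonality and a multiple of |w(a)|^2 lam2, whose integral
   is the left-hand side. [G] is db F with both compensated, so only m^3 db w / (a - z) is left in
   it ([GE]). *)
pose G x := Re (db F x) + - (3 * kappa / 2) * Re (lam2 x * (cj (Q wa false x) * (lam2 x * w false x))) +
  kappa / 2 * normc wa ^+ 2 * Re (lam2 x).
have iG1 : plane_integrable (fun x => Re (db F x) + - (3 * kappa / 2) *
    Re (lam2 x * (cj (Q wa false x) * (lam2 x * w false x)))).
  by apply: plane_integrableD => //; exact: plane_integrableZ.
have iG : plane_integrable G by apply: plane_integrableD => //; exact: plane_integrableZ.
have IG : plane_int G = kappa / 2 * plane_int (fun x => Re (lam2 x)) * normc wa ^+ 2.
  rewrite /G plane_intD //; last exact: plane_integrableZ.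
  rewrite plane_intD //; last exact: plane_integrableZ.
  rewrite IF add0r plane_intZ // plane_intZ //.
  have := orth (wa * 4^-1) (wa * (k * zb a / 2)) (wa * (k * k * (zb a * zb a) / 4)).
  rewrite /pairing => ->; ring.
rewrite -IG; apply: (@plane_int_le_ae _ _ a) => //.
- apply: measurable_funM; first exact: measurable_cst.
  apply: measurable_funM; first exact: measurable_decaying_kernel2.
  have sq : csmooth (db (w false)) by apply: csmooth_dc; exact: sw.
  exact: (continuous_measurable_plane (continuous_normc sq)).
- move=> x; apply: mulr_ge0; first by apply: mulr_ge0 => //; rewrite exprn_ge0 // ltW.
  by apply: mulr_ge0; [exact: decaying_kernel_ge0|exact: normc_ge0].
move=> x xa; have rx := rho_gt0 kappa0 x; have dx := dn _ xa.
have D0 : zc a - zc x != 0 by rewrite -zcB zc_eq0 subr_eq0 eq_sym.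
have dbh : db (h false) x = (db m x * m x + m x * db m x) * w false x + m x * m x * db (w false) x.
  have -> : h false = fun y => m y * m y * w false y + - wa.
    by apply/funext => y; rewrite /h msqE.
  have smm : csmooth (fun y => m y * m y) by exact: csmoothM.
  rewrite dcD; [|by apply: csmooth_cdiff; apply: csmoothM => //; exact: sw|exact: cdiff_cst].
  rewrite dc_cst addr0 dcM; [|exact: csmooth_cdiff|exact/csmooth_cdiff/sw].
  by rewrite dcM //; exact: csmooth_cdiff.
have dbf : db f x = cj wa * (db m x * h false x + m x * db (h false) x).
  rewrite dcZ; last exact/csmooth_cdiff/csmoothM.
  by rewrite dcM //; exact: csmooth_cdiff.
have GE : G x = Re (cj wa * (m x * m x * m x * db (w false) x) / (zc a - zc x)).
  have e1 : db F x = cj wa * (m x * m x * m x * db (w false) x) / (zc a - zc x) +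
     (3 * kappa / 2)%:C%C * (lam2 x * (cj wa * (m x * m x) * w false x)) -
     (kappa / 2)%:C%C * (cj wa * wa) * lam2 x.
    rewrite db_quotient // dbf dbh dbm {1}/h msqE.
    rewrite !rmorphM !fmorphV (rmorph_nat _ 2) (rmorph_nat _ 3) /=.
    move: (lam2 x) (db (w false) x) (w false x) (m x) (zc a - zc x) D0 (cj wa).
    by generalize wa => c' l q v m' D D0 c; field.
  have e2 : lam2 x * (cj (Q wa false x) * (lam2 x * w false x)) =
      lam2 x * (cj wa * (m x * m x) * w false x).
    by rewrite -msqE /msq QE conjcM; ring.
  have cw : cj wa * wa = (normc wa ^+ 2)%:C%C.
    by rewrite normcE2; generalize wa => -[w1 w2]; apply: complex_eqP => /=; ring.
  rewrite /G e2 e1 cw; move: (lam2 x) (normc wa) (cj wa * _ / _) (lam2 x * (_ * _)).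
  by move=> [l1 l2] n [y1 y2] [x1 x2] /=; field.
rewrite GE; apply: (le_trans (normc_re _)).
rewrite !normcM normcV normc_conj /decaying_kernel zcB -[normc (zc x - _)]normc_opp opprB.
have n3 : normc (m x) * normc (m x) * normc (m x) <= (rho a / rho x) ^+ 3.
  have hm := mb x; have m0 := normc_ge0 (m x).
  by rewrite !exprS expr0 mulr1 mulrA; rewrite !ler_pM // mulr_ge0.
move: n3 dx rx nwa (normc_ge0 (db (w false) x)).
move: (normc (m x) * _ * _) (normc (zc a - zc x)) (rho a) (rho x) (normc wa) (normc (db _ x)).
move=> m3 e r' r n q n3 e0 r0 n0 q0.
rewrite [leLHS](_ : _ = (n * q / e) * m3); last by field; rewrite gt_eqF.
rewrite [leRHS](_ : _ = (n * q / e) * (r' / r) ^+ 3); last by field; rewrite !gt_eqF.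
by apply: ler_wpM2l; rewrite // divr_ge0 ?mulr_ge0 // ltW.
Qed.

End Korn.

(** * Korn's inequality *)

Section Korn.
Variables (R : realType) (kappa : R).
Hypothesis kappa0 : 0 < kappa.
Local Notation C := R[i].
Local Notation k := (kappa%:C%C : C).
Local Notation d := (dc (-'i%C)).
Local Notation db := (dc ('i%C)).
Local Notation cj := conjc.
Local Notation zb x := (conjc (zc x)).
Local Notation tensor := (tensor kappa).
Local Notation lam := (lam kappa).
Local Notation lam2 := (lam2 kappa).
Local Notation rho := (rho kappa).
Local Notation pairing := (pairing kappa).
Local Notation mult := (mult kappa).
Local Notation quad := (quad kappa).
Local Notation K := (decaying_kernel kappa).
Local Notation mu := (@lebesgue_measure R).
Local Notation mu2 := (mu \x mu)%E.
Implicit Types (x a : R * R) (w : bool -> R * R -> C).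

Lemma kernel_mass_gt0 : 0 < kernel_mass kappa.
Proof. by rewrite /kernel_mass !mulr_gt0 ?pi_gt0 // addr_gt0 // invr_gt0. Qed.

Lemma lam2_mass_gt0 : 0 < plane_int (fun x => Re (lam2 x)).
Proof.
have lE x : Re (lam2 x) = 4 / rho x ^+ 4.
  have r0 := rho_gt0 kappa0 x.
  rewrite /lam2 /lam ilamE // -fmorphV -rmorphM /=.
  by field; rewrite gt_eqF.
have il : plane_integrable (fun x => Re (lam2 x)).
  exact: (tensor_integrable kappa0 (tensor_lam2 kappa0)).
(* A lower bound of lam^2 = 4 / rho^4 on the unit square, where rho^2 <= 1 + 2 kappa. *)
pose c : R := 4 / (1 + 2 * kappa) ^+ 2.
have k1 : 0 < 1 + 2 * kappa by rewrite addr_gt0 // mulr_gt0.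
have c0 : 0 < c by rewrite divr_gt0 // exprn_gt0.
pose B : set (R * R) := `[0, 1]%classic `*` `[0, 1]%classic.
have mB : measurable B by apply: measurableX.
have l0 x : 0 <= Re (lam2 x).
  by rewrite lE divr_ge0 // exprn_ge0 // ltW // rho_gt0.
have ml : measurable_fun setT (EFin \o (fun x => Re (lam2 x))) by exact: measurable_int il.
suff : (c%:E <= \int[mu2]_x (Re (lam2 x))%:E)%E.
  rewrite -(fineK (integrable_fin_num _ il)) // lee_fin => h.
  exact: lt_le_trans h.
have -> : c%:E = (\int[mu2]_(x in B) c%:E)%E.
  have mB1 : mu2 B = 1%E.
    have m1 : mu `[0, 1]%classic = 1%E.
      by rewrite lebesgue_measure_itv /= lte_fin ltr01 oppr0 adde0.
    by rewrite [LHS]product_measure1E // -[RHS]mule1; congr (_ * _)%E; exact: m1.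
  by rewrite integral_cst // -[LHS]mule1; congr (_ * _)%E; exact/esym.
apply: (@le_trans _ _ (\int[mu2]_(x in B) (Re (lam2 x))%:E)%E).
  apply: ge0_le_integral => //.
  - by move=> x _; rewrite lee_fin ltW.
  - exact: measurable_funTS.
  - have BE x : B x -> (0 <= x.1 <= 1) /\ (0 <= x.2 <= 1).
      by case: x => x1 x2 [/=]; rewrite !in_itv.
    move=> z /BE; move: z => z [/andP[x0 x1] /andP[y0 y1]].
    rewrite lee_fin lE /c ler_pM2l // lef_pV2 ?posrE ?exprn_gt0 ?rho_gt0 //.
    rewrite (exprM _ 2 2) ler_sqr ?nnegrE ?exprn_ge0 ?(ltW k1) ?(ltW (rho_gt0 _ _)) //.
    rewrite rho_sqr // lerD2l mulrC ler_pM2r //.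
    have h1 : z.1 ^+ 2 <= 1 by rewrite expr_le1.
    have h2 : z.2 ^+ 2 <= 1 by rewrite expr_le1.
    by lra.
apply: ge0_subset_integral => // x _.
by rewrite lee_fin.
Qed.

(* Young's inequality in [korn_integral], with the optimal parameter. *)
Lemma korn_pointwise w a : tensor 1 0 w ->
  (forall c0 c1 c2, pairing (quad c0 c1 c2) (fun s x => lam2 x * w s x) = 0) ->
  (((kappa / 2 * plane_int (fun x => Re (lam2 x)) * normc (w false a)) ^+ 2)%:E <=
   (2 * kernel_mass kappa * rho a ^+ 5)%:E *
   \int[mu2]_x (K a x * normc (db (w false) x) ^+ 2)%:E)%E.
Proof.
move=> tw orth; have := korn_integral kappa0 a tw orth.
have ra := rho_gt0 kappa0 a; have [sw _] := tw.
have V0 := lam2_mass_gt0; have km0 := kernel_mass_gt0.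
set c := kappa / 2 * _; have c0 : 0 < c by rewrite mulr_gt0 // divr_gt0.
set n := normc (w false a); pose q x := normc (db (w false) x).
set b := 2 * kernel_mass kappa / rho a.
have b0 : 0 < b by rewrite divr_gt0 // mulr_gt0.
have n0 : 0 <= n by exact: normc_ge0.
have mq : measurable_fun setT q.
  have sq : csmooth (db (w false)) by apply: csmooth_dc; exact: sw.
  exact: (continuous_measurable_plane (continuous_normc sq)).
have mK : measurable_fun setT (K a) by exact: measurable_decaying_kernel2.
have K0 x : 0 <= K a x by exact: decaying_kernel_ge0.
have q0 x : 0 <= q x by exact: normc_ge0.
have mq2 : measurable_fun setT (fun x => K a x * q x ^+ 2).
  by apply: measurable_funM => //; exact: measurable_funX.
have [M M0 hM] := tensor_bounded kappa0 (tensor_db kappa0 tw).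
have qM x : q x <= M by have := hM x; rewrite expr0z mulr1.
have IK := integral_decaying_kernel kappa0 a.
have A0 : (0 <= \int[mu2]_x (K a x * q x ^+ 2)%:E)%E.
  by apply: integral_ge0 => x _; rewrite lee_fin; apply: mulr_ge0 => //; rewrite sqr_ge0.
have AM : (\int[mu2]_x (K a x * q x ^+ 2)%:E <= (M ^+ 2 * b)%:E)%E.
  apply: (@le_trans _ _ (\int[mu2]_x ((M ^+ 2)%:E * (K a x)%:E))%E).
    apply: ge0_le_integral => //.
    - by move=> x _; rewrite lee_fin; apply: mulr_ge0 => //; rewrite sqr_ge0.
    - exact/measurable_EFinP.
    - have m2 : measurable_fun setT (EFin \o (fun x => M ^+ 2 * K a x)).
        by apply/measurable_EFinP/measurable_funM => //; exact: measurable_cst.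
      exact: m2.
    - move=> x _; rewrite -EFinM lee_fin mulrC; apply: ler_wpM2r => //.
      by rewrite ler_sqr ?nnegrE.
  rewrite ge0_integralZl //; last 3 first.
  - exact/measurable_EFinP.
  - by move=> x _; rewrite lee_fin.
  - by rewrite lee_fin sqr_ge0.
  by rewrite (EFinM (M ^+ 2)); apply: lee_wpmul2l => //; rewrite lee_fin sqr_ge0.
(* Finiteness, which follows from the boundedness of [db w] (type (1, -1), total weight 0), permits
   the computation to go on with real numbers. *)
have Afin : (\int[mu2]_x (K a x * q x ^+ 2)%:E)%E \is a fin_num.
  by rewrite ge0_fin_numE // (le_lt_trans AM) // ltry.
set A := (\int[mu2]_x _)%E in A0 AM Afin *; set A' := fine A.
have AE : A = A'%:E by rewrite fineK.
have A'0 : 0 <= A' by rewrite -lee_fin -AE.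
move=> h.
(* Under the integral, 2 q <= s q^2 + 1 / s, with [s] still free. *)
have key s : 0 < s -> c * n ^+ 2 <= n * rho a ^+ 3 / 2 * (s * A' + b / s).
  move=> s0; rewrite -lee_fin; apply: (le_trans h).
  pose e : R := n * rho a ^+ 3 / 2.
  have r30 : 0 <= rho a ^+ 3 by rewrite exprn_ge0 // ltW.
  have e0 : 0 <= e by apply: divr_ge0 => //; exact: mulr_ge0.
  apply: (@le_trans _ _ (\int[mu2]_x ((e * s)%:E * (K a x * q x ^+ 2)%:E + (e / s)%:E * (K a x)%:E))%E).
    apply: ge0_le_integral => //.
    - move=> x _; rewrite lee_fin; apply: mulr_ge0; first exact: mulr_ge0.
      by apply: mulr_ge0; [exact: K0|exact: q0].
    - apply/measurable_EFinP/measurable_funM; first exact: measurable_cst.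
      exact: measurable_funM.
    - have m2 : measurable_fun setT (EFin \o (fun x => e * s * (K a x * q x ^+ 2) + e / s * K a x)).
        by apply/measurable_EFinP/measurable_funD; apply: measurable_funM => //;
          exact: measurable_cst.
      exact: m2.
    - move=> x _; rewrite -!EFinM -EFinD lee_fin.
      have := sqr_ge0 (s * q x - 1).
      rewrite -/(q x) (_ : n * rho a ^+ 3 = 2 * e); last by rewrite /e; field.
      move: (K a x) (K0 x) (q x) => kx k0 qx h2; rewrite -subr_ge0.
      rewrite (_ : _ - _ = e * kx / s * (s * qx - 1) ^+ 2); last by field; rewrite gt_eqF.
      by rewrite mulr_ge0 // divr_ge0 ?mulr_ge0 // ltW.
  rewrite ge0_integralD //; last 4 first.
  - move=> x _; rewrite -EFinM lee_fin; apply: mulr_ge0; first by rewrite mulr_ge0 // ltW.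
    by apply: mulr_ge0 => //; rewrite sqr_ge0.
  - have m2 : measurable_fun setT (EFin \o (fun x => e * s * (K a x * q x ^+ 2))).
      by apply/measurable_EFinP/measurable_funM => //; exact: measurable_cst.
    exact: m2.
  - by move=> x _; rewrite -EFinM lee_fin; apply: mulr_ge0 => //; rewrite divr_ge0 // ltW.
  - have m2 : measurable_fun setT (EFin \o (fun x => e / s * K a x)).
      by apply/measurable_EFinP/measurable_funM => //; exact: measurable_cst.
    exact: m2.
  rewrite ge0_integralZl //; last 3 first.
  - exact/measurable_EFinP.
  - by move=> x _; rewrite lee_fin; apply: mulr_ge0 => //; rewrite sqr_ge0.
  - by rewrite lee_fin mulr_ge0 // ltW.
  rewrite ge0_integralZl //; last 3 first.
  - exact/measurable_EFinP.
  - by move=> x _; rewrite lee_fin.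
  - by rewrite lee_fin divr_ge0 // ltW.
  rewrite -/A AE mulrDr EFinD -EFinM; apply: leeD; first by rewrite lee_fin mulrA.
  rewrite (_ : _ * (b / s) = e / s * b); last by rewrite /e; field; rewrite gt_eqF.
  by rewrite (EFinM (e / s)); apply: lee_wpmul2l => //; rewrite lee_fin divr_ge0 // ltW.
rewrite AE -EFinM lee_fin.
have [n00|nn0] := eqVneq n 0.
  rewrite n00 mulr0 expr0n; apply: mulr_ge0 => //.
  by apply: mulr_ge0; [rewrite mulr_ge0 // ltW|rewrite exprn_ge0 // ltW].
have np : 0 < n by rewrite lt_def nn0.
have X0 : 0 < c * n by exact: mulr_gt0.
(* For this value of the parameter the term in b / s equals half of the left-hand side and is
   absorbed by it. *)
have s0 : 0 < rho a ^+ 3 * b / (c * n) by rewrite divr_gt0 // mulr_gt0 // exprn_gt0.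
have := key _ s0.
rewrite (_ : _ * (_ + _) = n / 2 * ((rho a ^+ 6 * b) * A' / (c * n) + c * n)); last first.
  by field; rewrite !gt_eqF.
rewrite (_ : c * n ^+ 2 = n / 2 * (2 * (c * n))); last by field.
rewrite ler_pM2l ?divr_gt0 // => h2.
have : c * n <= rho a ^+ 6 * b * A' / (c * n) by move: h2; set X := c * n; set Y := _ / X; lra.
rewrite ler_pdivlMr // -expr2 => /le_trans; apply.
by rewrite le_eqVlt; apply/orP; left; apply/eqP; rewrite /b; field; rewrite gt_eqF.
Qed.


Lemma lam2_rho x : lam2 x = (4 / rho x ^+ 4)%:C%C.
Proof.
have r0 := rho_gt0 kappa0 x.
rewrite /lam2 /lam ilamE // -fmorphV -rmorphM; congr (_%:C%C).
by field; rewrite gt_eqF.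
Qed.

Lemma normc_sqr (c : C) : cj c * c = (normc c ^+ 2)%:C%C.
Proof. by rewrite normcE2; case: c => a b; apply: complex_eqP => /=; ring. Qed.

(** The square of the pointwise bound is integrated against lam^4 = 16 / rho^8. The growth rho^5 in
    [korn_pointwise] leaves exactly the weight rho^-3 of [schur_bound], which yields the integral of
    rho^-4 |db w|^2, a quarter of the deformation; hence the factor 4 in the constant. *)
Theorem korn : exists2 B : R, 0 <= B & forall w, tensor 1 0 w ->
  (forall c0 c1 c2, pairing (quad c0 c1 c2) (fun s x => lam2 x * w s x) = 0) ->
  energy kappa w <= B * deformation kappa w.
Proof.
set c := kappa / 2 * plane_int (fun x => Re (lam2 x)).
have c0 : 0 < c by rewrite mulr_gt0 ?lam2_mass_gt0 // divr_gt0.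
have km0 := kernel_mass_gt0; set km := 2 * kernel_mass kappa.
have km1 : 0 < km by rewrite mulr_gt0.
exists (4 * km ^+ 2 / c ^+ 2) => [|w tw orth].
  by rewrite divr_ge0 ?sqr_ge0 // mulr_ge0 ?sqr_ge0.
have [sw _] := tw; have sq : csmooth (db (w false)) by apply: csmooth_dc; exact: sw.
have tq := tensor_db kappa0 tw.
have i0 n x : 0 <= (rho x ^+ n)^-1 by rewrite invr_ge0 exprn_ge0 // ltW // rho_gt0.
pose g x := normc (db (w false) x) ^+ 2.
have g0 x : 0 <= g x by exact: sqr_ge0.
have mg : measurable_fun setT g.
  by apply: measurable_funX; exact: (continuous_measurable_plane (continuous_normc sq)).
have mw : measurable_fun setT (fun x => normc (w false x) ^+ 2).
  by apply: measurable_funX; exact: (continuous_measurable_plane (continuous_normc (sw false))).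
have EE : (energy kappa w)%:E =
    (\int[mu2]_x (16 * ((rho x ^+ 8)^-1 * normc (w false x) ^+ 2))%:E)%E.
  have ie := pairing_integrable kappa0 tw
    (tensor_eq (tensor_lam2w kappa0 tw) erefl erefl (fun s x => erefl)).
  rewrite /energy /pairing /plane_int fineK; last exact: integrable_fin_num ie.
  apply: eq_integral => x _; congr EFin.
  have -> : lam2 x * (cj (w false x) * (lam2 x * w false x)) =
      lam2 x * lam2 x * (cj (w false x) * w false x) by ring.
  rewrite normc_sqr !lam2_rho -!rmorphM /=; field.
  by rewrite gt_eqF // rho_gt0.
have ED : (deformation kappa w)%:E = (4%:E * \int[mu2]_x ((rho x ^+ 4)^-1 * g x)%:E)%E.
  have id := pairing_integrable kappa0 tq
    (tensor_eq tq erefl erefl (fun s x => erefl)).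
  rewrite /deformation /pairing /plane_int fineK; last exact: integrable_fin_num id.
  rewrite -ge0_integralZl //; last 2 first.
  - by apply/measurable_EFinP/measurable_funM => //; exact: measurable_inv_rhoX.
  - by move=> x _; rewrite lee_fin mulr_ge0.
  apply: eq_integral => x _; rewrite -EFinM; congr EFin.
  rewrite normc_sqr lam2_rho -!rmorphM /= /g; field.
  by rewrite gt_eqF // rho_gt0.
rewrite -lee_fin EE EFinM ED.
pose A a := (\int[mu2]_x (K a x * g x)%:E)%E.
have A0 a : (0 <= A a)%E.
  by apply: integral_ge0 => x _; rewrite lee_fin; apply: mulr_ge0 => //; exact: decaying_kernel_ge0.
have mf : measurable_fun setT (fun ax : (R * R) * (R * R) => (K ax.1 ax.2 * g ax.2)%:E).
  apply/measurable_EFinP/measurable_funM; first exact: measurable_decaying_kernel.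
  exact: (measurableT_comp mg measurable_snd).
have mA : measurable_fun setT A.
  apply: (@measurable_fun_fubini_tonelli_F _ _ _ _ R (@plane_measure R) _ mf) => ax.
  by rewrite lee_fin; apply: mulr_ge0 => //; exact: decaying_kernel_ge0.
have mr : measurable_fun setT (fun a => (((rho a ^+ 3)^-1)%:E * A a)%E).
  apply: emeasurable_funM => //; apply/measurable_EFinP; exact: measurable_inv_rhoX.
apply: (@le_trans _ _ (\int[mu2]_a ((16 * km / c ^+ 2)%:E * (((rho a ^+ 3)^-1)%:E * A a)))%E).
  apply: ge0_le_integral => //.
  - by move=> x _; rewrite lee_fin; apply: mulr_ge0 => //; apply: mulr_ge0 => //; exact: sqr_ge0.
  - apply/measurable_EFinP/measurable_funM; first exact: measurable_cst.
    by apply: measurable_funM => //; exact: measurable_inv_rhoX.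
  - by apply: emeasurable_funM => //; exact: measurable_cst.
  move=> a _; have := korn_pointwise a tw orth; rewrite -/c -/km -/(A a).
  have ra := rho_gt0 kappa0 a.
  have e0 : 0 < 16 * (c ^+ 2 * rho a ^+ 8)^-1.
    by rewrite mulr_gt0 // invr_gt0 mulr_gt0 // exprn_gt0.
  move/(lee_wpmul2l (x := (16 * (c ^+ 2 * rho a ^+ 8)^-1)%:E)); rewrite lee_fin => /(_ (ltW e0)).
  rewrite -EFinM (_ : _ * (c * _) ^+ 2 = 16 * ((rho a ^+ 8)^-1 * normc (w false a) ^+ 2)); last first.
    by field; rewrite !gt_eqF.
  move/le_trans; apply; rewrite !muleA -!EFinM; apply: lee_wpmul2r => //.
  by rewrite lee_fin le_eqVlt; apply/orP; left; apply/eqP; field; rewrite !gt_eqF.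
rewrite ge0_integralZl //; last 2 first.
- by move=> a _; apply: mule_ge0 => //; rewrite lee_fin.
- by rewrite lee_fin divr_ge0 ?sqr_ge0 // mulr_ge0 // ltW.
apply: (@le_trans _ _ ((16 * km / c ^+ 2)%:E * (km%:E * \int[mu2]_x ((rho x ^+ 4)^-1 * g x)%:E))%E).
  apply: lee_wpmul2l; first by rewrite lee_fin divr_ge0 ?sqr_ge0 // mulr_ge0 // ltW.
  exact: schur_bound.
rewrite !muleA -!EFinM; apply: lee_wpmul2r.
  by apply: integral_ge0 => x _; rewrite lee_fin mulr_ge0.
by rewrite lee_fin le_eqVlt; apply/orP; left; apply/eqP; field; rewrite gt_eqF.
Qed.

End Korn.

(** * The six holomorphic fields and orthogonality to them *)

Section Korn.
Variables (R : realType) (kappa : R).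
Hypothesis kappa0 : 0 < kappa.
Local Notation C := R[i].
Local Notation k := (kappa%:C%C : C).
Local Notation d := (dc (-'i%C)).
Local Notation db := (dc ('i%C)).
Local Notation cj := conjc.
Local Notation zb x := (conjc (zc x)).
Local Notation tensor := (tensor kappa).
Local Notation lam := (lam kappa).
Local Notation lam2 := (lam2 kappa).
Local Notation rho := (rho kappa).
Local Notation pairing := (pairing kappa).
Local Notation mult := (mult kappa).
Local Notation quad := (quad kappa).
Local Notation K := (decaying_kernel kappa).
Local Notation mu := (@lebesgue_measure R).
Local Notation mu2 := (mu \x mu)%E.
Implicit Types (x a : R * R) (w : bool -> R * R -> C).

(** This and the next two functions are, up to constant factors, the ambient coordinates restricted
    to the sphere. Their gradients are the holomorphic fields that complement the Killing ones. *)
Definition height (s : bool) x : C := if s then 1 - lam x else lam x - 1.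
Definition coord_re (s : bool) x : C := lam x * zc x + lam x * zb x.
Definition coord_im (s : bool) x : C :=
  if s then 'i%C * (lam x * zc x - lam x * zb x) else 'i%C * (lam x * zb x - lam x * zc x).

Let sz : csmooth (@zc R). Proof. exact: csmooth_zc. Qed.
Let szJ : csmooth (fun x : R * R => zb x). Proof. exact/csmoothJ/csmooth_zc. Qed.
Let sl : csmooth lam. Proof. exact: csmooth_lam. Qed.
Let sc c : csmooth (fun _ : R * R => c : C). Proof. exact: csmooth_cst. Qed.
Let slz : csmooth (fun x => lam x * zc x). Proof. exact: csmoothM. Qed.
Let slzJ : csmooth (fun x => lam x * zb x). Proof. exact: csmoothM. Qed.

Lemma lam_transition x : x != 0 -> lam (transition kappa x) = 2 - lam x.
Proof.
move=> x0; have z0 : zc x != 0 by rewrite zc_eq0.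
have zb0 : zb x != 0 by rewrite conjc_eq0.
have k0 : k != 0 by rewrite fmorph_eq0 gt_eqF.
have := ilam_neq0 kappa0 x; have := ilam_neq0 kappa0 (transition kappa x).
rewrite /lam /ilam zc_transition /inv_zc conjc_inv conjcM conjc_real.
move: (zc x) (zb x) z0 zb0 => z z' z0 z0'.
have -> : k * ((k * z)^-1 * (k * z')^-1) = (k * (z * z'))^-1 by field; rewrite k0 z0 z0'.
have : k * (z * z') != 0 by rewrite !mulf_neq0.
move: (k * (z * z')) => t t0 h1 h2.
have h3 : 1 + t != 0 by move: h2; apply: contra => /eqP ->; rewrite mul0r.
have h4 : t + 1 != 0 by rewrite addrC.
by field; rewrite ?t0 ?h3 ?h4.
Qed.

Lemma lamz_transition x : x != 0 ->
  lam (transition kappa x) * zc (transition kappa x) = lam x * zb x.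
Proof.
move=> x0; rewrite lam_transition // zc_transition /inv_zc.
have z0 : zc x != 0 by rewrite zc_eq0.
have k0 : k != 0 by rewrite fmorph_eq0 gt_eqF.
have := lam_eq kappa x; have := lam_neq0 kappa0 x.
move: (lam x) (zc x) (zb x) z0 => l z z' z0 l0 e.
have -> : 2 - l = k * (z * z') * l by rewrite e; field.
by field; rewrite k0 z0.
Qed.

Lemma lamzJ_transition x : x != 0 ->
  lam (transition kappa x) * zb (transition kappa x) = lam x * zc x.
Proof.
move=> x0; have := lamz_transition x0 => /(congr1 (conjc : C -> C)).
by rewrite !conjcM conjcK !lamJ.
Qed.

Lemma tensor_height : tensor 0 0 height.
Proof.
split=> [[]|x x0]; rewrite /height; try exact: csmoothB.
by rewrite lam_transition // !expr0z; ring.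
Qed.

Lemma tensor_coord_re : tensor 0 0 coord_re.
Proof.
split=> [s|x x0]; rewrite /coord_re; first exact: csmoothD.
by rewrite lamz_transition // lamzJ_transition // !expr0z; ring.
Qed.

Lemma tensor_coord_im : tensor 0 0 coord_im.
Proof.
split=> [[]|x x0]; rewrite /coord_im; try by apply: csmoothM => //; exact: csmoothB.
by rewrite lamz_transition // lamzJ_transition // !expr0z; ring.
Qed.

Lemma db_lamz x : db (fun y => lam y * zc y) x = - (k * lam2 x * (zc x * zc x)).
Proof.
rewrite dcM; [|exact: csmooth_cdiff|exact: csmooth_cdiff].
by rewrite db_lam // db_zc; ring.
Qed.

Lemma db_lamzJ x : db (fun y => lam y * zb y) x = lam2 x.
Proof.
rewrite dcM; [|exact: csmooth_cdiff|exact: csmooth_cdiff].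
rewrite db_lam // db_zcJ; have := lam_eq kappa x; have := lam_neq0 kappa0 x.
rewrite /lam2; move: (lam x) (zc x) (zb x) => l z z' l0 e.
rewrite (_ : - (k * z * (l * l)) * z' = - (k * (z * z') * (l * l))); last by ring.
by rewrite e; field.
Qed.

Section Orthogonality.
Variable w : bool -> R * R -> C.
Hypotheses (tw : tensor 1 0 w) (curl_im : forall s x, Re (curl kappa w s x) = 0).
Local Notation orth c0 c1 c2 := (pairing (quad c0 c1 c2) (fun s x => lam2 x * w s x)).

Let tlw := tensor_lam2w kappa0 tw.

Lemma orth_gradient f (c0 c1 c2 : C) : tensor 0 0 f -> (forall s x, Im (f s x) = 0) ->
  (forall x, db (f false) x = lam2 x * quad c0 c1 c2 false x) -> orth c0 c1 c2 = 0.
Proof.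
move=> tf f0 e; have := pairing_grad kappa0 tw tf curl_im f0; rewrite pairingC // => <-.
apply: eq_pairing => x; rewrite e conjcM lam2J //; congr Re; ring.
Qed.

Lemma orthD c0 c1 c2 c0' c1' c2' :
  orth (c0 + c0') (c1 + c1') (c2 + c2') = orth c0 c1 c2 + orth c0' c1' c2'.
Proof.
rewrite !(pairingC kappa0 (quad _ _ _)).
rewrite -(@pairingDr _ _ kappa0 0 (-1)) //; try exact: tensor_quad.
apply: eq_pairing => x; congr (Re (_ * (_ * _))).
by rewrite /quad; ring.
Qed.

Lemma orthZ (r : R) c0 c1 c2 : orth (r%:C%C * c0) (r%:C%C * c1) (r%:C%C * c2) = r * orth c0 c1 c2.
Proof.
rewrite !(pairingC kappa0 (quad _ _ _)).
rewrite -(@pairingZr _ _ kappa0 0 (-1)) //; try exact: tensor_quad.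
apply: eq_pairing => x; congr (Re (_ * (_ * _))).
by rewrite /quad; ring.
Qed.

(** The hypotheses concern the three Killing fields. The other three generators, [o4] to [o6], are
    gradients of the ambient coordinates, to which a divergence-free field is orthogonal; together
    the six span the holomorphic fields over the reals. *)
Lemma orth_quad : orth 0 'i%C 0 = 0 -> orth 1 0 k = 0 -> orth 'i%C 0 (- 'i%C * k) = 0 ->
  forall c0 c1 c2, orth c0 c1 c2 = 0.
Proof.
move=> o1 o2 o3 [a0 b0] [a1 b1] [a2 b2].
have kn0 : kappa != 0 by rewrite gt_eqF.
have rlam x : Im (lam x) = 0 by have := lamJ kappa0 x; case: (lam x) => l1 l2 [] /=; lra.
have o4 : orth 0 (- k) 0 = 0.
  apply: (orth_gradient tensor_height) => [[] x|x]; rewrite /height.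
  - by rewrite imD imN rlam /= ?oppr0 addr0.
  - by rewrite imD imN rlam /= ?oppr0 addr0.
  rewrite dcB; [|exact: csmooth_cdiff|exact: cdiff_cst].
  by rewrite db_lam // dc_cst /quad; ring.
have o5 : orth 1 0 (- k) = 0.
  apply: (orth_gradient tensor_coord_re) => [s x|x]; rewrite /coord_re.
  - by move: (rlam x); case: (lam x) (zc x) => l1 l2 [z1 z2] /= ->; ring.
  rewrite dcD; [|exact: csmooth_cdiff|exact: csmooth_cdiff].
  by rewrite db_lamz db_lamzJ /quad; ring.
have o6 : orth 'i%C 0 ('i%C * k) = 0.
  apply: (orth_gradient tensor_coord_im) => [[] x|x]; rewrite /coord_im.
  - by move: (rlam x); case: (lam x) (zc x) => l1 l2 [z1 z2] /= ->; ring.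
  - by move: (rlam x); case: (lam x) (zc x) => l1 l2 [z1 z2] /= ->; ring.
  rewrite dcZ; last exact/csmooth_cdiff/csmoothB.
  rewrite dcB; [|exact: csmooth_cdiff|exact: csmooth_cdiff].
  by rewrite db_lamz db_lamzJ /quad; ring.
(* Coefficients of the given field in the basis of the six fields, in the order of [o1] to [o6]. *)
pose al := (a0 + a2 / kappa) / 2; pose be := (a0 - a2 / kappa) / 2.
pose ga := (b0 - b2 / kappa) / 2; pose de := (b0 + b2 / kappa) / 2.
pose S (u1 u2 u3 u4 u5 u6 : C) := b1%:C%C * u1 + (al%:C%C * u2 + (ga%:C%C * u3 +
  ((- (a1 / kappa))%:C%C * u4 + (be%:C%C * u5 + de%:C%C * u6)))).
have OS u1 u2 u3 u4 u5 u6 v1 v2 v3 v4 v5 v6 t1 t2 t3 t4 t5 t6 :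
    orth u1 v1 t1 = 0 -> orth u2 v2 t2 = 0 -> orth u3 v3 t3 = 0 ->
    orth u4 v4 t4 = 0 -> orth u5 v5 t5 = 0 -> orth u6 v6 t6 = 0 ->
    orth (S u1 u2 u3 u4 u5 u6) (S v1 v2 v3 v4 v5 v6) (S t1 t2 t3 t4 t5 t6) = 0.
  move=> e1 e2 e3 e4 e5 e6; rewrite /S !orthD !orthZ e1 e2 e3 e4 e5 e6; ring.
have := OS _ _ _ _ _ _ _ _ _ _ _ _ _ _ _ _ _ _ o1 o2 o3 o4 o5 o6.
set s0 := S _ _ _ _ _ _; set s1 := S _ _ _ _ _ _; set s2 := S _ _ _ _ _ _.
have -> : s0 = (a0 +i* b0)%C.
  by apply: complex_eqP; rewrite /s0 /S /al /be /ga /de /=; field.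
have -> : s1 = (a1 +i* b1)%C.
  by apply: complex_eqP; rewrite /s1 /S /al /be /ga /de /=; field.
have -> : s2 = (a2 +i* b2)%C.
  by apply: complex_eqP; rewrite /s2 /S /al /be /ga /de /=; field.
by [].
Qed.

End Orthogonality.
End Korn.

(** * The stereographic charts and the induced metric *)

Section Chart.
Variables (R : realType) (kappa : R).
Hypothesis kappa0 : 0 < kappa.
Local Notation sk := (Num.sqrt kappa).
Implicit Types (x : R * R) (s : bool).

Lemma ord2P (i : 'I_2) : i = 0 \/ i = 1.
Proof. by case: i => [[|[|//]] hi]; [left|right]; exact: val_inj. Qed.

(** [ilr] and [lr] are the real-valued versions of [ilam] and [lam] ([lam_lr]), for the tensor
    calculus in coordinates. *)
Definition ilr x : R := (1 + kappa * (x.1 ^+ 2 + x.2 ^+ 2)) / 2.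
Definition lr x : R := (ilr x)^-1.

Lemma ilr_gt0 x : 0 < ilr x.
Proof.
rewrite divr_gt0 // (lt_le_trans ltr01) // lerDl mulr_ge0 ?(ltW kappa0) //.
by rewrite addr_ge0 ?sqr_ge0.
Qed.

Lemma lr_gt0 x : 0 < lr x. Proof. by rewrite invr_gt0 ilr_gt0. Qed.

Lemma lrE x : kappa * (x.1 ^+ 2 + x.2 ^+ 2) * lr x = 2 - lr x.
Proof. by have := ilr_gt0 x; rewrite /lr /ilr => h; field; move: h; rewrite pmulr_lgt0 // => /lt0r_neq0. Qed.

Lemma smooth_lr : smooth lr.
Proof.
have s1 := smooth_coord1 R; have s2 := smooth_coord2 R.
apply: smoothV; first by move=> x; rewrite gt_eqF // ilr_gt0.
rewrite /ilr; apply: smoothM; last exact: smooth_cst.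
apply: smoothD; first exact: smooth_cst.
apply: smoothM; first exact: smooth_cst.
by apply: smoothD; under eq_fun do rewrite expr2; exact: smoothM.
Qed.

Definition cx (i : 'I_2) x : R := if i == 0 then x.1 else x.2.

Lemma smooth_cx i : smooth (cx i).
Proof. by case: (ord2P i) => ->; [exact: smooth_coord1|exact: smooth_coord2]. Qed.

Lemma pd_cx i j x : pd i (cx j) x = (i == j)%:R.
Proof.
have e0 : pd i (fun y : R * R => y.1) x = (i == 0)%:R.
  by rewrite /pd derive_coord1 /coord_dir; case: (ord2P i) => ->.
have e1 : pd i (fun y : R * R => y.2) x = (i == 1)%:R.
  by rewrite /pd derive_coord2 /coord_dir; case: (ord2P i) => ->.
by case: (ord2P j) => ->.
Qed.

Lemma pd_lr i x : pd i lr x = - (kappa * cx i x * lr x ^+ 2).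
Proof.
have dx j := smooth_differentiable (smooth_cx j) x.
have dM j := differentiableM (dx j) (dx j).
have i0 := ilr_gt0 x.
have E : ilr = fun y => 2^-1 + kappa / 2 * (cx 0 y * cx 0 y + cx 1 y * cx 1 y).
  by apply/funext => y; rewrite /ilr /cx /= !expr2; field.
have dS := differentiableD (dM 0) (dM 1).
have dZ := differentiableM (differentiable_cst (kappa / 2) x) dS.
have p2 : pd i ilr x = kappa * cx i x.
  rewrite E pdD; [|exact: differentiable_cst|exact: dZ].
  rewrite pd_cst pdM; [|exact: differentiable_cst|exact: dS].
  rewrite pd_cst pdD; [|exact: dM|exact: dM].
  by rewrite !pdM // !pd_cx; case: (ord2P i) => -> /=; field.
have di : differentiable ilr x by rewrite E; exact: differentiableD (differentiable_cst _ _) dZ.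
rewrite pdV ?gt_eqF // p2.
by rewrite /lr; field; rewrite gt_eqF.
Qed.

Definition sg s : R := (-1) ^+ s.

Lemma sgg s : sg s * sg s = 1. Proof. by rewrite /sg -expr2 sqrr_sign. Qed.

Lemma sk_sqr : sk * sk = kappa. Proof. by rewrite -expr2 sqr_sqrtr // ltW. Qed.

Lemma sk_gt0 : 0 < sk. Proof. by rewrite sqrtr_gt0. Qed.

Lemma chart0 s x : chart kappa s x 0 0 = lr x * x.1.
Proof.
rewrite /chart !mxE /= /lr /ilr; have := ilr_gt0 x; rewrite /ilr pmulr_lgt0 // => /lt0r_neq0 h.
by field.
Qed.

Lemma chart1 s x : chart kappa s x 0 1 = sg s * (lr x * x.2).
Proof.
rewrite /chart !mxE /= /lr /ilr; have := ilr_gt0 x; rewrite /ilr pmulr_lgt0 // => /lt0r_neq0 h.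
by rewrite -/(sg s); field.
Qed.

Lemma chart2 s x : chart kappa s x 0 2 = sg s * (sk^-1 * (lr x - 1)).
Proof.
rewrite /chart !mxE /= /lr /ilr; have := ilr_gt0 x; rewrite /ilr pmulr_lgt0 // => /lt0r_neq0 h.
have := sk_gt0 => /lt0r_neq0 k0; rewrite -/(sg s); field.
by rewrite h k0.
Qed.

Lemma dot3 (a b : 'rV[R]_3) : dot a b = a 0 0 * b 0 0 + a 0 1 * b 0 1 + a 0 2 * b 0 2.
Proof.
have e1 : lift ord0 ord0 = 1 :> 'I_3 by apply: val_inj.
have e2 : lift ord0 (lift ord0 ord0) = 2 :> 'I_3 by apply: val_inj.
by rewrite /dot !big_ord_recl big_ord0 addr0 addrA e1 e2.
Qed.

Lemma ord3P (i : 'I_3) : [\/ i = 0, i = 1 | i = 2].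
Proof. by case: i => [[|[|[|//]]] hi]; [constructor 1|constructor 2|constructor 3]; exact: val_inj. Qed.

Let dl x : differentiable lr x. Proof. exact/smooth_differentiable/smooth_lr. Qed.
Let dx j x : differentiable (cx j) x. Proof. exact/smooth_differentiable/smooth_cx. Qed.

Lemma differentiable_chart s (k : 'I_3) x : differentiable (fun y => chart kappa s y 0 k) x.
Proof.
case: (ord3P k) => ->; under eq_fun do rewrite ?chart0 ?chart1 ?chart2.
- exact: differentiableM (dl x) (dx 0 x).
- apply: differentiableM; first exact: differentiable_cst.
  exact: differentiableM (dl x) (dx 1 x).
- apply: differentiableM; first exact: differentiable_cst.
  apply: differentiableM; first exact: differentiable_cst.
  by apply: differentiableB; [exact: dl|exact: differentiable_cst].
Qed.

Lemma pd_chartE s i k x : pd i (chart kappa s) x 0 k = pd i (fun y => chart kappa s y 0 k) x.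
Proof.
rewrite /pd derive_mx ?mxE //; apply/derivable_mxP => j j'.
by rewrite ord1; exact/diff_derivable/differentiable_chart.
Qed.

Lemma pd_chart0 s i x : pd i (chart kappa s) x 0 0 =
  (i == 0)%:R * lr x - kappa * cx i x * lr x ^+ 2 * x.1.
Proof.
rewrite pd_chartE; under eq_fun do rewrite chart0.
rewrite (@pdM _ i lr (cx 0)) // pd_lr pd_cx [cx 0 x]/=.
by ring.
Qed.

Lemma pd_chart1 s i x : pd i (chart kappa s) x 0 1 =
  sg s * ((i == 1)%:R * lr x - kappa * cx i x * lr x ^+ 2 * x.2).
Proof.
rewrite pd_chartE; under eq_fun do rewrite chart1.
rewrite pdM; [|exact: differentiable_cst|exact: differentiableM (dl x) (dx 1 x)].
rewrite (@pdM _ i lr (cx 1)) // pd_cst pd_lr pd_cx [cx 1 x]/=.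
by ring.
Qed.

Lemma pd_chart2 s i x : pd i (chart kappa s) x 0 2 = - (sg s * (sk * cx i x * lr x ^+ 2)).
Proof.
rewrite pd_chartE; under eq_fun do rewrite chart2.
have d1 := differentiableB (dl x) (differentiable_cst (1 : R) x).
have d2 := differentiableM (differentiable_cst sk^-1 x) d1.
rewrite pdM; [|exact: differentiable_cst|exact: d2].
rewrite pdM; [|exact: differentiable_cst|exact: d1].
rewrite pdB; [|exact: dl|exact: differentiable_cst].
rewrite !pd_cst pd_lr; have k0 := lt0r_neq0 sk_gt0.
move: (lr x) (cx i x) (sg s) => l c g; have := sk_sqr; move: sk k0 => q q0 <-.
by field.
Qed.

Definition tangent0 i x : R := (i == 0)%:R * lr x - kappa * cx i x * lr x ^+ 2 * x.1.
Definition tangent1 s i x : R :=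
  sg s * ((i == 1)%:R * lr x - kappa * cx i x * lr x ^+ 2 * x.2).
Definition tangent2 s i x : R := - (sg s * (sk * cx i x * lr x ^+ 2)).

Lemma dot_tangent s i x (V : 'rV[R]_3) : dot V (pd i (chart kappa s) x) =
  V 0 0 * tangent0 i x + V 0 1 * tangent1 s i x + V 0 2 * tangent2 s i x.
Proof.
rewrite dot3; congr (_ * _ + _ * _ + _ * _);
  [exact: pd_chart0|exact: pd_chart1|exact: pd_chart2].
Qed.

Lemma dot_chart s i j x : dot (pd i (chart kappa s) x) (pd j (chart kappa s) x) =
  tangent0 i x * tangent0 j x + tangent1 s i x * tangent1 s j x +
  tangent2 s i x * tangent2 s j x.
Proof.
rewrite dot_tangent; congr (_ * _ + _ * _ + _ * _);
  [exact: pd_chart0|exact: pd_chart1|exact: pd_chart2].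
Qed.

Lemma metric_chart s x : metric (chart kappa s) x = (lr x ^+ 2)%:M.
Proof.
apply/matrixP => i j; rewrite /metric mxE [RHS]mxE dot_chart.
have [g1|g1] : sg s = 1 \/ sg s = -1 by case: (s); [right|left].
all: rewrite /tangent0 /tangent1 /tangent2 g1; have := lrE x; move: (lr x) (sk_sqr) => l; move: sk => q <-.
(* Each entry differs from its expected value by a multiple of the relation [lrE], and [t] carries
   the monomial of that multiple. *)
all: move=> e; have key (t a b : R) :
    a - b = q * q * l ^+ 3 * t * (q * q * (x.1 ^+ 2 + x.2 ^+ 2) * l - (2 - l)) -> a = b.
  1,3: by rewrite e subrr mulr0 => /subr0_eq.
all: case: (ord2P i) => ->; case: (ord2P j) => ->; rewrite /cx /= ?mulr1n ?mulr0n.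
all: by [apply: (key (x.1 * x.1)); ring | apply: (key (x.1 * x.2)); ring |
         apply: (key (x.2 * x.2)); ring].
Qed.

End Chart.

(** * From index notation to complex notation *)

Section ChartGeometry.
Variables (R : realType) (kappa : R).
Hypothesis kappa0 : 0 < kappa.
Local Notation lr := (lr kappa).
Implicit Types (x : R * R) (U : 'I_2 -> R * R -> R).

Lemma sum2 (F : 'I_2 -> R) : \sum_l F l = F 0 + F 1.
Proof.
have e1 : lift ord0 ord0 = 1 :> 'I_2 by apply: val_inj.
by rewrite !big_ord_recl big_ord0 addr0 e1.
Qed.

(** The partial derivatives of log lr, through which all Christoffel symbols of a conformal metric
    are expressed. *)
Definition phi (i : 'I_2) x : R := - (kappa * cx i x * lr x).

Let dl x : differentiable lr x. Proof. exact/smooth_differentiable/smooth_lr. Qed.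

Lemma pd_lr2 i x : pd i (fun y => lr y ^+ 2) x = 2 * lr x ^+ 2 * phi i x.
Proof.
under eq_fun do rewrite expr2; rewrite pdM // pd_lr // /phi; ring.
Qed.

Lemma lr2_neq0 x : lr x ^+ 2 != 0.
Proof. by rewrite expf_neq0 // gt_eqF // lr_gt0. Qed.

Section Fixed.
Variable s : bool.
Local Notation sigma := (chart kappa s).

Lemma metricE i j x : metric sigma x i j = (i == j)%:R * lr x ^+ 2.
Proof. by rewrite metric_chart // mxE mulr_natl. Qed.

Lemma metric_invE i j x : metric_inv sigma x i j = (i == j)%:R * (lr x ^+ 2)^-1.
Proof. by rewrite /metric_inv metric_chart // invmx_scalar mxE mulr_natl. Qed.

Lemma pd_metric i j l x : pd i (fun y => metric sigma y j l) x =
  (j == l)%:R * (2 * lr x ^+ 2 * phi i x).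
Proof.
have -> : (fun y => metric sigma y j l) = fun y => (j == l)%:R * lr y ^+ 2.
  by apply/funext => y; exact: metricE.
have d2 : differentiable (fun y => lr y ^+ 2) x.
  by under eq_fun do rewrite expr2; exact: differentiableM.
rewrite pdM; [|exact: differentiable_cst|exact: d2].
by rewrite pd_cst pd_lr2; ring.
Qed.

Lemma christoffelE k i j x : christoffel sigma k i j x =
  (k == j)%:R * phi i x + (k == i)%:R * phi j x - (i == j)%:R * phi k x.
Proof.
rewrite /christoffel sum2 !metric_invE !pd_metric.
have := lr2_neq0 x; move: (lr x ^+ 2) (phi^~ x) => l p l0.
by case: (ord2P k) => ->; case: (ord2P i) => ->; case: (ord2P j) => -> /=; field.
Qed.

Lemma cov1E U k i x : cov1 sigma U k i x =
  pd i (U k) x + phi i x * U k x + (k == i)%:R * (phi 0 x * U 0 x + phi 1 x * U 1 x)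
  - phi k x * U i x.
Proof.
rewrite /cov1 sum2 !christoffelE.
by case: (ord2P k) => ->; case: (ord2P i) => -> /=; ring.
Qed.

Lemma cov2E U k i j x : cov2 sigma U k i j x = pd j (cov1 sigma U k i) x +
  ((k == j)%:R * (phi 0 x * cov1 sigma U 0 i x + phi 1 x * cov1 sigma U 1 i x)
   - phi k x * cov1 sigma U j i x - phi i x * cov1 sigma U k j x
   + (j == i)%:R * (phi 0 x * cov1 sigma U k 0 x + phi 1 x * cov1 sigma U k 1 x)).
Proof.
rewrite /cov2 !sum2 !christoffelE -!addrA; congr (_ + _).
pose c a b := cov1 sigma U a b x; rewrite -!/(c _ _); move: c (phi^~ x) => c p.
by case: (ord2P k) => ->; case: (ord2P i) => ->; case: (ord2P j) => -> /=; ring.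
Qed.

Lemma divergenceE U x : divergence sigma U x =
  pd 0 (U 0) x + pd 1 (U 1) x + 2 * (phi 0 x * U 0 x + phi 1 x * U 1 x).
Proof. by rewrite /divergence sum2 !cov1E /=; ring. Qed.

Lemma area_densityE x : area_density sigma x = lr x ^+ 2.
Proof.
rewrite /area_density metric_chart // det_scalar sqrtr_sqr ger0_norm //.
exact: sqr_ge0.
Qed.

Lemma opKE U : opK sigma U = fun k x => if k == 0 then U 1 x else - U 0 x.
Proof.
apply/funext => k; apply/funext => x.
rewrite /opK sum2 !sum2 !metric_invE /epsilon area_densityE.
have := lr2_neq0 x; move: (lr x ^+ 2) => l l0.
by case: (ord2P k) => -> /=; field.
Qed.

Lemma vrotE U x : (forall k, differentiable (U k) x) -> vrot sigma U x =
  pd 0 (U 1) x - pd 1 (U 0) x + 2 * (phi 0 x * U 1 x - phi 1 x * U 0 x).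
Proof.
by move=> dU; rewrite /vrot opKE divergenceE /= pdN //; ring.
Qed.

Lemma innerE U V x : inner sigma U V x = lr x ^+ 2 * (U 0 x * V 0 x + U 1 x * V 1 x).
Proof. by rewrite /inner sum2 !sum2 !metricE /=; ring. Qed.

Lemma opSE U k j x : opS sigma U k j x =
  (lr x ^+ 2)^-1 * (cov1 sigma U j k x + cov1 sigma U k j x).
Proof.
rewrite /opS sum2 !metric_invE.
by case: (ord2P k) => ->; case: (ord2P j) => -> /=; ring.
Qed.

Lemma gradE f k x : grad sigma f k x = (lr x ^+ 2)^-1 * pd k f x.
Proof.
rewrite /grad sum2 !metric_invE; move: (lr x ^+ 2) (fun i => pd i f x) => l g.
by case: (ord2P k) => -> /=; ring.
Qed.

Lemma opLE U j x : opL sigma U j x = (lr x ^+ 2)^-1 *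
  (cov2 sigma U j 0 0 x + cov2 sigma U j 1 1 x + cov2 sigma U 0 j 0 x + cov2 sigma U 1 j 1 x).
Proof.
pose c a b e := cov2 sigma U a b e x.
rewrite /opL sum2 !sum2 !metric_invE -!/(c _ _ _); move: c (lr x ^+ 2) => c l.
by case: (ord2P j) => -> /=; ring.
Qed.

End Fixed.

Local Notation C := R[i].
Local Notation k := (kappa%:C%C : C).
Local Notation d := (dc (-'i%C)).
Local Notation db := (dc ('i%C)).
Local Notation cj := conjc.
Local Notation zb x := (conjc (zc x)).
Local Notation lam := (lam kappa).
Local Notation lam2 := (lam2 kappa).
Local Notation ilam2 := (ilam2 kappa).

Definition cfield U x : C := (U 0 x +i* U 1 x)%C.

Lemma lam_lr x : lam x = (lr x)%:C%C.
Proof.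
rewrite /lam ilamE // -fmorphV /lr /ilr; congr (_%:C%C).
by rewrite rho_sqr.
Qed.

Lemma lam2_lr x : lam2 x = (lr x ^+ 2)%:C%C.
Proof. by rewrite /lam2 lam_lr -rmorphM expr2. Qed.

Lemma ilam2_lr x : ilam2 x = ((lr x ^+ 2)^-1)%:C%C.
Proof.
have l0 : lam2 x != 0 by rewrite mulf_neq0 ?lam_neq0.
by apply: (mulfI l0); rewrite lam2K // lam2_lr -rmorphM mulfV // lr2_neq0.
Qed.

Lemma smooth_cfield U : (forall i, smooth (U i)) -> csmooth (cfield U).
Proof. by move=> sU; split; exact: sU. Qed.

Lemma d_cfield U x : d (cfield U) x =
  ((pd 0 (U 0) x + pd 1 (U 1) x) +i* (pd 0 (U 1) x - pd 1 (U 0) x))%C.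
Proof. by rewrite dc.unlock cpd.unlock; apply: complex_eqP => /=; ring. Qed.

Lemma db_cfield U x : db (cfield U) x =
  ((pd 0 (U 0) x - pd 1 (U 1) x) +i* (pd 0 (U 1) x + pd 1 (U 0) x))%C.
Proof. by rewrite dc.unlock cpd.unlock; apply: complex_eqP => /=; ring. Qed.

Lemma curl_cfield s U x : (forall i, smooth (U i)) -> twist kappa 2 (cfield U) x =
  (divergence (chart kappa s) U x +i* vrot (chart kappa s) U x)%C.
Proof.
move=> sU; rewrite divergenceE vrotE; last by move=> i; exact: smooth_differentiable.
rewrite /twist d_cfield lam_lr /phi /cx /cfield.
move: (lr x) (pd 0 _ x) (pd 1 _ x) (pd 0 (U 1) x) (pd 1 (U 0) x) (U 0 x) (U 1 x).
by case: x => x1 x2 *; apply: complex_eqP => /=; ring.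
Qed.

Lemma db_cfield_cov s U x : db (cfield U) x =
  ((cov1 (chart kappa s) U 0 0 x - cov1 (chart kappa s) U 1 1 x) +i*
   (cov1 (chart kappa s) U 1 0 x + cov1 (chart kappa s) U 0 1 x))%C.
Proof.
by rewrite db_cfield !cov1E; apply: complex_eqP => /=; ring.
Qed.

Lemma smooth_phi i : smooth (phi i).
Proof.
apply: smoothN; apply: smoothM; last exact: smooth_lr.
by apply: smoothM; [exact: smooth_cst|exact: smooth_cx].
Qed.

Lemma smooth_cov1 s U k' i : (forall i, smooth (U i)) ->
  smooth (cov1 (chart kappa s) U k' i).
Proof.
move=> sU; rewrite (funext (cov1E s U k' i)).
have sM a b : smooth (fun x => phi a x * U b x) by exact/smoothM/sU/smooth_phi.
apply: smoothB => //; apply: smoothD; last first.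
  by apply: smoothM; [exact: smooth_cst|exact: smoothD].
by apply: smoothD => //; apply: smooth_derive; exact: sU.
Qed.

(** When div u = 0 the symmetric tensor S u is trace free, hence amounts to the single complex
    function [db] of the field, and its divergence is a twisted derivative of that function. *)
Lemma opL_cfield s U x : (forall i, smooth (U i)) ->
  (forall y, divergence (chart kappa s) U y = 0) ->
  ilam2 x * twist kappa 2 (db (cfield U)) x =
  (opL (chart kappa s) U 0 x +i* opL (chart kappa s) U 1 x)%C.
Proof.
move=> sU dU; set sigma := chart kappa s.
pose A := cov1 sigma U 0 0; pose B := cov1 sigma U 0 1; pose D := cov1 sigma U 1 0.
have dif i j y : differentiable (cov1 sigma U i j) y.
  by apply: smooth_differentiable; exact: smooth_cov1.
have E11 : cov1 sigma U 1 1 = fun y => - A y.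
  by apply/funext => y; have := dU y; rewrite /divergence sum2 addrC => /eqP; rewrite addr_eq0 => /eqP.
pose Q (i : 'I_2) y : R := if i == 0 then 2 * A y else D y + B y.
have qE : db (cfield U) = cfield Q.
  apply/funext => y; rewrite (db_cfield_cov s) -/sigma E11; apply: complex_eqP => //=.
  by rewrite -/A /Q eqxx; move: (A y) => t; ring.
have dA i : pd i (fun y => 2 * A y) x = 2 * pd i A x.
  rewrite pdM; [|exact: differentiable_cst|exact: dif].
  by rewrite pd_cst; ring.
have dBD i : pd i (fun y => D y + B y) x = pd i D x + pd i B x.
  by rewrite pdD; [|exact: dif|exact: dif].
have pN i : pd i (fun y => - A y) x = - pd i A x by rewrite pdN //; exact: dif.
rewrite qE /twist d_cfield !opLE !cov2E -/A -/B -/D E11 !pN [Q 0]/Q [Q 1]/Q.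
rewrite [0 == 0 :> 'I_2]/= [1 == 0 :> 'I_2]/= !dA !dBD ilam2_lr lam_lr.
have -> : cfield Q x = (2 * A x +i* (D x + B x))%C by [].
rewrite /phi; have l0 := lt0r_neq0 (lr_gt0 kappa0 x).
move: (pd 0 A x) (pd 1 A x) (pd 0 B x) (pd 1 B x) (pd 0 D x) (pd 1 D x) (A x) (B x) (D x).
move: (lr x) l0 => l l0 a0 a1 b0 b1 d0 d1 a b dd; rewrite /zc.
have -> : cx 0 x = x.1 by []. have -> : cx 1 x = x.2 by [].
by move: x.1 x.2 => x1 x2; apply: complex_eqP => /=; field.
Qed.

(** The Lamb form of the convection: rot u times the field rotated by a right angle, plus the
    gradient of |u|^2 / 2. The gradient can then be joined to the pressure. *)
Lemma nabla_cfield s U x : (forall i, smooth (U i)) ->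
  (forall y, divergence (chart kappa s) U y = 0) ->
  (nabla (chart kappa s) U U 0 x +i* nabla (chart kappa s) U U 1 x)%C =
  twist kappa 2 (cfield U) x * cfield U x +
  ilam2 x * db (fun y => lam2 y * (cj (cfield U y) * cfield U y) / 2) x.
Proof.
move=> sU dU; have sw := smooth_cfield sU; have swJ := csmoothJ sw.
have sww := csmoothM swJ sw; have sl2 := csmooth_lam2 kappa0.
have s1 := csmoothM sl2 sww.
rewrite dcM; [|exact: csmooth_cdiff|exact: cdiff_cst].
rewrite dc_cst mulr0 addr0.
rewrite (_ : (fun y => lam2 y * _) = fun y => (lam2 y * cj (cfield U y)) * cfield U y); last first.
  by apply/funext => y; rewrite mulrA.
rewrite dcM; [|apply: csmooth_cdiff; exact: csmoothM|exact: csmooth_cdiff].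
rewrite db_lam2MJ // (_ : ilam2 x * _ = lam2 x * ilam2 x *
  ((cj (twist kappa 2 (cfield U) x) * cfield U x + cj (cfield U x) * db (cfield U) x) / 2)); last first.
  move: (cj (cfield U x)) (cj (twist _ _ _ _)) => c1 c2.
  by move: (lam2 x) (ilam2 x) (cfield U x) (db _ _) => *; ring.
rewrite lam2K // mul1r (curl_cfield s) // dU (db_cfield_cov s).
have -> : vrot (chart kappa s) U x = cov1 (chart kappa s) U 1 0 x - cov1 (chart kappa s) U 0 1 x.
  rewrite vrotE; last by move=> i; exact: smooth_differentiable.
  by rewrite !cov1E /=; ring.
have E11 : cov1 (chart kappa s) U 1 1 x = - cov1 (chart kappa s) U 0 0 x.
  by have := dU x; rewrite /divergence sum2 addrC => /eqP; rewrite addr_eq0 => /eqP.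
rewrite /nabla !sum2 E11 /cfield.
move: (U 0 x) (U 1 x) (cov1 _ _ 0 0 x) (cov1 _ _ 0 1 x) (cov1 _ _ 1 0 x) => u0 u1 a b c.
by apply: complex_eqP => /=; field.
Qed.

Lemma grad_cfield s f x :
  (grad (chart kappa s) f 0 x +i* grad (chart kappa s) f 1 x)%C =
  ilam2 x * db (fun y => (f y)%:C%C) x.
Proof.
by rewrite !gradE // ilam2_lr dc.unlock !cpd_real; apply: complex_eqP => /=; ring.
Qed.

(* For div u = 0, the vector field is Killing exactly when [db] kills it. *)
Lemma killing_cov s U : (forall i, smooth (U i)) ->
  (forall k j x, opS (chart kappa s) U k j x = 0) <->
  (forall x, db (cfield U) x = 0 /\ Re (twist kappa 2 (cfield U) x) = 0).
Proof.
move=> sU; have l0 x : (lr x ^+ 2)^-1 != 0 by rewrite invr_eq0 lr2_neq0.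
split=> [S0 x|H i j x].
  have key i j : cov1 (chart kappa s) U j i x + cov1 (chart kappa s) U i j x = 0.
    have := S0 i j x; rewrite opSE // => /eqP; rewrite mulf_eq0 (negbTE (l0 x)) /= => /eqP.
    exact.
  have := key 0 0; have := key 1 1; have := key 0 1.
  rewrite (db_cfield_cov s) (curl_cfield s) // /divergence sum2.
  move: (cov1 _ U 0 0 x) (cov1 _ U 0 1 x) (cov1 _ U 1 0 x) (cov1 _ U 1 1 x) (vrot _ _ _).
  move=> a b c e r h1 h2 h3.
  split; first by apply: complex_eqP => /=; lra.
  by rewrite /=; lra.
have [] := H x; rewrite (db_cfield_cov s) (curl_cfield s) // /divergence sum2 => -[h1 h2] /= h3.
rewrite opSE //; apply/eqP; rewrite mulf_eq0; apply/orP; right; apply/eqP.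
move: h1 h2 h3; pose c a b := cov1 (chart kappa s) U a b x; rewrite -!/(c _ _); move: c => c.
by case: (ord2P i) => ->; case: (ord2P j) => ->; lra.
Qed.

End ChartGeometry.

(** * Tangent fields of the sphere as tensors of type (1, 0) *)

Section Fields.
Variables (R : realType) (kappa : R).
Hypothesis kappa0 : 0 < kappa.
Local Notation C := R[i].
Local Notation k := (kappa%:C%C : C).
Local Notation sk := (Num.sqrt kappa).
Local Notation d := (dc (-'i%C)).
Local Notation db := (dc ('i%C)).
Local Notation cj := conjc.
Local Notation zb x := (conjc (zc x)).
Local Notation tensor := (tensor kappa).
Local Notation lam := (lam kappa).
Local Notation lam2 := (lam2 kappa).
Local Notation ilam2 := (ilam2 kappa).
Local Notation lr := (lr kappa).
Implicit Types (x : R * R) (s : bool) (v : 'rV[R]_3 -> 'rV[R]_3).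

Definition field_comp v s x : C := cfield (components (chart kappa s) v) x.

Lemma eq_components s v v' : (forall x, v (chart kappa s x) = v' (chart kappa s x)) ->
  components (chart kappa s) v = components (chart kappa s) v'.
Proof.
by move=> e; apply/funext => i; apply/funext => x; rewrite /components e.
Qed.

Lemma componentsE s v i x : components (chart kappa s) v i x =
  (lr x ^+ 2)^-1 * dot (v (chart kappa s x)) (pd i (chart kappa s) x).
Proof.
rewrite /components sum2 !metric_invE //; move: (_^-1) => l.
by case: (ord2P i) => -> /=; rewrite mul1r mul0r ?mul0r ?add0r ?addr0.
Qed.

Lemma field_compD v v' v'' s x :
  v (chart kappa s x) = v' (chart kappa s x) + v'' (chart kappa s x) ->
  field_comp v s x = field_comp v' s x + field_comp v'' s x.
Proof.
move=> e; have dD (a b c : 'rV[R]_3) : dot (a + b) c = dot a c + dot b c.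
  by rewrite !dot3 !mxE; ring.
have E i : components (chart kappa s) v i x =
    components (chart kappa s) v' i x + components (chart kappa s) v'' i x.
  rewrite 3!componentsE e -mulrDr; congr (_ * _); exact: dD.
by rewrite /field_comp /cfield !E.
Qed.

Lemma sphere_chart s x : sphere kappa (chart kappa s x).
Proof.
rewrite /sphere /= dot3 chart0 // chart1 // chart2 //.
have := sgg R s; have := sk_sqr kappa0; have := lt0r_neq0 (sk_gt0 kappa0).
have := lrE kappa0 x; move: (sg R s) (lr x) sk => e l q e1 q0 e2 e3.
rewrite -e2 in e1 *.
rewrite (_ : _ + _ = l ^+ 2 * x.1 ^+ 2 + (e * e) * l ^+ 2 * x.2 ^+ 2 + (e * e) * (q * q)^-1 * (l - 1) ^+ 2); last first.
  by field.
rewrite e3 (_ : _ + _ = (q * q)^-1 * (q * q * (x.1 ^+ 2 + x.2 ^+ 2) * l * l + (l - 1) ^+ 2)); last by field.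
by rewrite e1; field.
Qed.

(** Tangency eliminates the quadratic terms of the tangent vectors. What remains is linear in the
    ambient vector and involves the chart only through [lr], z and a sign, a form in which the two
    charts can be compared. *)
Lemma field_compE v s x : dot (v (chart kappa s x)) (chart kappa s x) = 0 ->
  field_comp v s x = (lr x)^-1%:C%C *
    ((v (chart kappa s x) 0 0)%:C%C + (sg R s)%:C%C *
     ('i%C * (v (chart kappa s x) 0 1)%:C%C - sk%:C%C * zc x * (v (chart kappa s x) 0 2)%:C%C)).
Proof.
set V := v (chart kappa s x) => t0.
have E i : components (chart kappa s) v i x = (lr x ^+ 2)^-1 *
    (V 0 0 * tangent0 kappa i x + V 0 1 * tangent1 kappa s i x + V 0 2 * tangent2 kappa s i x).
  by rewrite componentsE; congr (_ * _); exact: dot_tangent.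
have {}t0 : V 0 0 * (lr x * x.1) + V 0 1 * (sg R s * (lr x * x.2)) +
    V 0 2 * (sg R s * (sk^-1 * (lr x - 1))) = 0.
  rewrite -[RHS]t0 dot3; congr (_ * _ + _ * _ + _ * _); apply: esym;
    [exact: chart0|exact: chart1|exact: chart2].
rewrite /field_comp /cfield !E; move: (V 0 0) (V 0 1) (V 0 2) t0 => V0 V1 V2 {E V}.
rewrite /tangent0 /tangent1 /tangent2 /zc.
have -> : cx 0 x = x.1 by []. have -> : cx 1 x = x.2 by [].
have l0 := lt0r_neq0 (lr_gt0 kappa0 x); have q0 := lt0r_neq0 (sk_gt0 kappa0).
have kE := sk_sqr kappa0.
move: (lr x) l0 (sg R s) => l l0 e; move: sk q0 kE => q q0 <-.
move: x.1 x.2 => x1 x2 t0.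
have t1 : l * (x1 * V0 + e * x2 * V1) = - (e * (l - 1) * V2 / q).
  apply/eqP; rewrite -subr_eq0 -[X in _ == X]t0; apply/eqP; field; exact: q0.
apply: complex_eqP => /=.
- rewrite (_ : _^-1 * _ = l^-1 * V0 - q * q * x1 * (l * (x1 * V0 + e * x2 * V1) + e * l * V2 / q) / l); last first.
    by field; rewrite l0 q0.
  by rewrite t1; field; rewrite l0 q0.
- rewrite (_ : _^-1 * _ = l^-1 * (e * V1) - q * q * x2 * (l * (x1 * V0 + e * x2 * V1) + e * l * V2 / q) / l); last first.
    by field; rewrite l0 q0.
  by rewrite t1; field; rewrite l0 q0.
Qed.


Lemma lr_transition x : x != 0 ->
  [/\ lr (transition kappa x) = 2 - lr x,
      lr (transition kappa x) * (transition kappa x).1 = lr x * x.1 &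
      lr (transition kappa x) * (transition kappa x).2 = - (lr x * x.2)].
Proof.
move=> x0; have h1 := lam_transition kappa0 x0; have h2 := lamz_transition kappa0 x0.
rewrite !lam_lr // in h1 h2; split.
- have := congr1 (@complex.Re R) h1; rewrite reD reN /= => ->.
  by [].
- by have := congr1 (@complex.Re R) h2; rewrite !reM /= !mul0r !subr0.
- by have := congr1 (@complex.Im R) h2; rewrite !imM /= !mul0r !addr0 => ->; rewrite mulrN.
Qed.

Lemma chart_transition x : x != 0 ->
  chart kappa false x = chart kappa true (transition kappa x).
Proof.
move=> x0; have [h1 h2 h3] := lr_transition x0.
have e0 : chart kappa false x 0 0 = chart kappa true (transition kappa x) 0 0.
  by rewrite (chart0 kappa0 false x) (chart0 kappa0 true (transition kappa x)) h2.
have e1 : chart kappa false x 0 1 = chart kappa true (transition kappa x) 0 1.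
  rewrite (chart1 kappa0 false x) (chart1 kappa0 true (transition kappa x)) h3.
  by rewrite /sg expr0 expr1; ring.
have e2 : chart kappa false x 0 2 = chart kappa true (transition kappa x) 0 2.
  rewrite (chart2 kappa0 false x) (chart2 kappa0 true (transition kappa x)) h1.
  by rewrite /sg expr0 expr1; ring.
apply/matrixP => i j; rewrite ord1.
by have [->|->|->] := ord3P j.
Qed.

(** The same ambient vector is expressed at [x] and at its image in the other chart by
    [field_compE]; the weight law is then an algebraic identity modulo tangency. *)
Lemma tensor_field v : (forall y, sphere kappa y -> dot (v y) y = 0) ->
  (forall s i, smooth (components (chart kappa s) v i)) ->
  tensor 1 0 (field_comp v).
Proof.
move=> tv sv; split=> [s|x x0]; first by apply: smooth_cfield; exact: sv.
have [h1 h2 h3] := lr_transition x0.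
have t0 s y : dot (v (chart kappa s y)) (chart kappa s y) = 0 by apply/tv/sphere_chart.
have t1 := t0 false x; rewrite !field_compE // -(chart_transition x0).
move: t1; set V := v _ => t1.
have {}t1 : V 0 0 * (lr x * x.1) + V 0 1 * (lr x * x.2) + V 0 2 * (sk^-1 * (lr x - 1)) = 0.
  rewrite -[RHS]t1 dot3; congr (_ * _ + _ * _ + _ * _); apply: esym.
  - exact: chart0.
  - by rewrite (chart1 kappa0 false x) /sg expr0 mul1r.
  - by rewrite (chart2 kappa0 false x) /sg expr0 mul1r.
rewrite expr0z mulr1 expr1z zc_transition /inv_zc /jac /sg expr0 expr1 h1.
move: (V 0 0) (V 0 1) (V 0 2) t1 => V0 V1 V2 t1.
have l0 : (lr x)%:C%C != 0 :> C by rewrite fmorph_eq0 lt0r_neq0 // lr_gt0.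
have q0 : sk%:C%C != 0 :> C by rewrite fmorph_eq0 lt0r_neq0 // sk_gt0.
have z0 : zc x != 0 by rewrite zc_eq0.
have z0' : zb x != 0 by rewrite conjc_eq0.
have kq : k = sk%:C%C * sk%:C%C by rewrite -rmorphM sk_sqr.
have e : sk%:C%C * sk%:C%C * (zc x * zb x) = 2 / (lr x)%:C%C - 1.
  by rewrite -kq lam_eq // lam_lr.
(* Tangency [t1] in complex form. *)
have T : zb x * (V0%:C%C + 'i%C * V1%:C%C) + zc x * (V0%:C%C - 'i%C * V1%:C%C) =
    - (2 * ((lr x)%:C%C - 1) * V2%:C%C / (sk%:C%C * (lr x)%:C%C)).
  apply: (mulfI l0); rewrite (_ : _ * - _ = - 2 * (((lr x - 1) * V2 / sk)%:C%C)); last first.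
    have -> l q : ((l - 1) * V2 / q)%:C%C = (l%:C%C - 1) * V2%:C%C / q%:C%C :> C.
      by rewrite 2!rmorphM rmorphB rmorph1 fmorphV.
    by move: (lr x)%:C%C sk%:C%C V2%:C%C l0 q0 => l q W l0 q0; field; rewrite l0 q0.
  have -> : (lr x - 1) * V2 / sk = - (V0 * (lr x * x.1) + V1 * (lr x * x.2)).
    by apply/eqP; rewrite -subr_eq0 opprK -[X in _ == X]t1; apply/eqP; ring.
  by apply: complex_eqP => /=; ring.
have L : (2 - lr x)%:C%C = sk%:C%C * sk%:C%C * (zc x * zb x) * (lr x)%:C%C :> C.
  by rewrite e rmorphB (rmorph_nat _ 2); field.
have Vr (r : R) : (r^-1)%:C%C = (r%:C%C)^-1 :> C by rewrite fmorphV.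
have N1 : (-1 : R)%:C%C = -1 :> C by rewrite rmorphN rmorph1.
have O1 : (1 : R)%:C%C = 1 :> C by [].
rewrite (Vr (lr x)) (Vr (2 - lr x)) L kq N1 O1.
move: (zc x) (zb x) (lr x)%:C%C sk%:C%C z0 z0' l0 q0 e T => z z' l q z0 z0' l0 q0 e T {L}.
apply: subr0_eq; transitivity ((l * z')^-1 * ((z' * (V0%:C%C + 'i%C * V1%:C%C) +
   z * (V0%:C%C - 'i%C * V1%:C%C)) - q * q * (z * z') * V2%:C%C / q + V2%:C%C / q)).
  by field; rewrite l0 z0 z0' q0.
by rewrite T e; field; rewrite l0 z0' q0.
Qed.

End Fields.

(** * The rotations are Killing fields with components in [quad] *)

Section Fields.
Variables (R : realType) (kappa : R).
Hypothesis kappa0 : 0 < kappa.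
Local Notation C := R[i].
Local Notation k := (kappa%:C%C : C).
Local Notation sk := (Num.sqrt kappa).
Local Notation d := (dc (-'i%C)).
Local Notation db := (dc ('i%C)).
Local Notation cj := conjc.
Local Notation zb x := (conjc (zc x)).
Local Notation tensor := (tensor kappa).
Local Notation lam := (lam kappa).
Local Notation lam2 := (lam2 kappa).
Local Notation ilam2 := (ilam2 kappa).
Local Notation lr := (lr kappa).
Implicit Types (x : R * R) (s : bool) (v : 'rV[R]_3 -> 'rV[R]_3).

Local Notation quad := (quad kappa).

Lemma d_zczc (e : C) x : dc e (fun y => zc y * zc y) x = 2 * dc e (@zc R) x * zc x.
Proof. by rewrite dcM; [ring|exact: cdiff_zc|exact: cdiff_zc]. Qed.

Lemma dc_quad (e : C) c0 c1 c2 s x : dc e (quad c0 c1 c2 s) x =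
  dc e (@zc R) x * (if s then - (2 * k * c0 * zc x + c1) else c1 + 2 * c2 * zc x).
Proof.
have cz := cdiff_zc x; have czz : cdiff (fun y : R * R => zc y * zc y) x by exact: cdiffM.
have cZ c (f : R * R -> C) : cdiff f x -> cdiff (fun y => c * f y) x.
  by move=> cf; apply: cdiffM => //; exact: cdiff_cst.
case: s; rewrite /quad.
  rewrite dcN; last by apply: cdiffD; [apply: cdiffD; exact: cZ|exact: cdiff_cst].
  rewrite dcD; [|apply: cdiffD; exact: cZ|exact: cdiff_cst].
  rewrite dcD; [|exact: cZ|exact: cZ].
  by rewrite dc_cst !dcZ // d_zczc; ring.
rewrite dcD; [|by apply: cdiffD; [exact: cdiff_cst|exact: cZ]|exact: cZ].
rewrite dcD; [|exact: cdiff_cst|exact: cZ].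
by rewrite dc_cst !dcZ // d_zczc; ring.
Qed.

Lemma killing_quad v c0 c1 c2 : (forall y, sphere kappa y -> dot (v y) y = 0) ->
  (forall s x, field_comp kappa v s x = quad c0 c1 c2 s x) ->
  (forall s x, Re (twist kappa 2 (quad c0 c1 c2 s) x) = 0) -> killing kappa v.
Proof.
move=> tv vE q0; have sv s i : smooth (components (chart kappa s) v i).
  have [s1 s2] := csmooth_quad kappa c0 c1 c2 s.
  have [->|->] := ord2P i.
    by rewrite (_ : components _ _ _ = fun x => Re (quad c0 c1 c2 s x)) //;
      apply/funext => x; rewrite -vE.
  by rewrite (_ : components _ _ _ = fun x => Im (quad c0 c1 c2 s x)) //;
    apply/funext => x; rewrite -vE.
split=> // s; apply/(killing_cov kappa0 s (sv s)) => x.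
have -> : cfield (components (chart kappa s) v) = quad c0 c1 c2 s.
  by apply/funext => y; exact: vE.
by split; [rewrite dc_quad db_zc mul0r|exact: q0].
Qed.

(** A linear field; it is an infinitesimal rotation when c = - a and f = - b, the matrix being then
    antisymmetric. *)
Definition spin (a b c e f : R) (y : 'rV[R]_3) : 'rV[R]_3 :=
  \row_(i < 3) (if i == 0 then a * y 0 1 + b * y 0 2 else
    if i == 1 then c * y 0 0 + e * y 0 2 else f * y 0 0 - e * y 0 1).

Lemma spinE a b c e f y : [/\ spin a b c e f y 0 0 = a * y 0 1 + b * y 0 2,
  spin a b c e f y 0 1 = c * y 0 0 + e * y 0 2 &
  spin a b c e f y 0 2 = f * y 0 0 - e * y 0 1].
Proof. by split; rewrite mxE. Qed.

Lemma spin_tangent a b e y : dot (spin a b (- a) e (- b) y) y = 0.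
Proof. by rewrite dot3; have [-> -> ->] := spinE a b (- a) e (- b) y; ring. Qed.

Lemma field_comp_spin a b e s x : field_comp kappa (spin a b (- a) e (- b)) s x =
  (lr x)^-1%:C%C * ((a * (sg R s * (lr x * x.2)) + b * (sg R s * (sk^-1 * (lr x - 1))))%:C%C +
   (sg R s)%:C%C * ('i%C * (- a * (lr x * x.1) + e * (sg R s * (sk^-1 * (lr x - 1))))%:C%C
     - sk%:C%C * zc x * (- b * (lr x * x.1) - e * (sg R s * (lr x * x.2)))%:C%C)).
Proof.
rewrite field_compE //; last exact: spin_tangent.
have [-> -> ->] := spinE a b (- a) e (- b) (chart kappa s x).
by rewrite (chart0 kappa0 s x) (chart1 kappa0 s x) (chart2 kappa0 s x).
Qed.

Lemma killing_spin a b e c0 c1 c2 :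
  (forall s x, field_comp kappa (spin a b (- a) e (- b)) s x = quad c0 c1 c2 s x) ->
  (forall s x, Re (twist kappa 2 (quad c0 c1 c2 s) x) = 0) ->
  exists2 v, killing kappa v & forall s x, field_comp kappa v s x = quad c0 c1 c2 s x.
Proof.
move=> E q0; exists (spin a b (- a) e (- b)) => //.
by apply: killing_quad E q0 => y _; exact: spin_tangent.
Qed.

Let kV : k^-1 = (kappa^-1)%:C%C. Proof. by rewrite fmorphV. Qed.
Let kn0 : kappa != 0. Proof. by rewrite gt_eqF. Qed.

Let t_neq0 x : 1 + kappa * (x.1 ^+ 2 + x.2 ^+ 2) != 0.
Proof.
by rewrite lt0r_neq0 // ltr_pwDl // mulr_ge0 ?(ltW kappa0) // addr_ge0 ?sqr_ge0.
Qed.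

Let lrV x : lr x = 2 / (1 + kappa * (x.1 ^+ 2 + x.2 ^+ 2)).
Proof. by rewrite /lr /ilr invf_div. Qed.

(** Rotation about the third axis; the next two lemmas use the second and the first axis. The
    factors 2 sqrt kappa there normalize the constant coefficient to 1 and to i. *)
Lemma killing_quad0 :
  exists2 v, killing kappa v & forall s x, field_comp kappa v s x = quad 0 'i%C 0 s x.
Proof.
apply: (@killing_spin (-1) 0 0) => [s x|s x].
  rewrite field_comp_spin /quad /zc kV.
  have l0 := lt0r_neq0 (lr_gt0 kappa0 x); have q0 := lt0r_neq0 (sk_gt0 kappa0).
  move: (lr x) sk l0 q0 => l q l0 q0.
  by case: s; rewrite /sg ?expr0 ?expr1; apply: complex_eqP => /=; field; rewrite ?kn0 ?l0 ?q0.
rewrite /twist dc_quad d_zc lam_lr // /quad /zc kV; move: (lr x) => l.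
by case: s => /=; field; rewrite ?kn0 ?t0.
Qed.

Lemma killing_quad1 :
  exists2 v, killing kappa v & forall s x, field_comp kappa v s x = quad 1 0 k s x.
Proof.
apply: (@killing_spin 0 (2 * sk) 0) => [s x|s x].
  rewrite field_comp_spin /quad /zc kV lrV.
  have q0 := lt0r_neq0 (sk_gt0 kappa0); have := t_neq0 x; have := sk_sqr kappa0.
  move: x.1 x.2 sk q0 => x1 x2 q q0 <- t0.
  by case: s; rewrite /sg ?expr0 ?expr1; apply: complex_eqP => /=; field; rewrite ?t0 ?q0.
rewrite /twist dc_quad d_zc lam_lr // /quad /zc kV lrV; have := t_neq0 x.
by move: x.1 x.2 => x1 x2 t0; case: s => /=; field; rewrite ?kn0 ?t0.
Qed.

Lemma killing_quad2 :
  exists2 v, killing kappa v & forall s x, field_comp kappa v s x = quad 'i%C 0 (- 'i%C * k) s x.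
Proof.
apply: (@killing_spin 0 0 (2 * sk)) => [s x|s x].
  rewrite field_comp_spin /quad /zc kV lrV.
  have q0 := lt0r_neq0 (sk_gt0 kappa0); have := t_neq0 x; have := sk_sqr kappa0.
  move: x.1 x.2 sk q0 => x1 x2 q q0 <- t0.
  by case: s; rewrite /sg ?expr0 ?expr1; apply: complex_eqP => /=; field; rewrite ?t0 ?q0.
rewrite /twist dc_quad d_zc lam_lr // /quad /zc kV lrV; have := t_neq0 x.
by move: x.1 x.2 => x1 x2 t0; case: s => /=; field; rewrite ?kn0 ?t0.
Qed.

End Fields.

(** * Differentiating the deformation in time *)

Section TimeEvolution.
Variables (R : realType) (kappa : R).
Hypothesis kappa0 : 0 < kappa.
Local Notation C := R[i].
Local Notation d := (dc (-'i%C)).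
Local Notation db := (dc ('i%C)).
Local Notation cj := conjc.
Local Notation tensor := (tensor kappa).
Local Notation lam2 := (lam2 kappa).
Local Notation lr := (lr kappa).
Local Notation rho := (rho kappa).
Local Notation mu := (@lebesgue_measure R).
Local Notation mu2 := (mu \x mu)%E.
Implicit Types (x : R * R) (s : bool) (t : R).

Variable F : bool -> 'I_2 -> R * (R * R) -> R.
Hypothesis sF : forall s i, smooth (F s i).

(** [F] plays the role of the smooth extensions of the components to all times; its slices are
    assumed to be vector fields on the sphere only for t >= 0. *)
Definition slice t s x : C := cfield (fun i x => F s i (t, x)) x.
Hypothesis tensor_slice : forall t, 0 <= t -> tensor 1 0 (slice t).

Local Notation e_t := ((1, 0) : R * (R * R)).
Local Notation e_x i := ((0, coord_dir R i) : R * (R * R)).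

Definition dslice t s x : C := cfield (fun i x => 'D_e_t (F s i) (t, x)) x.

(* The components of [db (slice t s)], as functions of time and space. *)
Definition strain s (i : 'I_2) : R * (R * R) -> R := fun p =>
  if i == 0 then 'D_(e_x 0) (F s 0) p - 'D_(e_x 1) (F s 1) p
  else 'D_(e_x 0) (F s 1) p + 'D_(e_x 1) (F s 0) p.

Lemma smooth_strain s i : smooth (strain s i).
Proof.
rewrite /strain; case: (ord2P i) => ->.
  by apply: smoothB; exact: smooth_derive.
by apply: smoothD; exact: smooth_derive.
Qed.

Lemma pd_section (G : R * (R * R) -> R) i t x : smooth G ->
  pd i (fun y => G (t, y)) x = 'D_(e_x i) G (t, x).
Proof. by move=> sG; exact: (is_derive_section _ (smooth_differentiable sG _)).2. Qed.

Lemma db_slice t s x : db (slice t s) x = cfield (fun i x => strain s i (t, x)) x.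
Proof.
rewrite db_cfield !(pd_section _ _ _ (sF _ _)).
by apply: complex_eqP => /=.
Qed.

Lemma db_dslice t s x : db (dslice t s) x = cfield (fun i x => 'D_e_t (strain s i) (t, x)) x.
Proof.
have sdF i : smooth (fun p => 'D_e_t (F s i) p) by exact: smooth_derive.
have sw i j : 'D_(e_x i) (fun p => 'D_e_t (F s j) p) (t, x) =
    'D_e_t (fun p => 'D_(e_x i) (F s j) p) (t, x) by exact: derive_swap.
have dd i j : derivable (fun p => 'D_(e_x i) (F s j) p) (t, x) e_t.
  by apply: smooth_derivable; exact: smooth_derive.
have E a i : pd a (fun y => 'D_e_t (F s i) (t, y)) x =
    'D_e_t (fun p => 'D_(e_x a) (F s i) p) (t, x).
  have h := @pd_section (fun p => 'D_e_t (F s i) p) a t x (sdF i).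
  cbv beta in h; rewrite h; exact (sw a i).
have es0 : strain s 0 = (fun p => 'D_(e_x 0) (F s 0) p) - (fun p => 'D_(e_x 1) (F s 1) p).
  by [].
have es1 : strain s 1 = (fun p => 'D_(e_x 0) (F s 1) p) + (fun p => 'D_(e_x 1) (F s 0) p).
  by [].
rewrite db_cfield /cfield es0 es1 (deriveB (dd 0 0) (dd 1 1)) (deriveD (dd 0 1) (dd 1 0)).
by apply: complex_eqP; [exact: (congr2 (fun a b => a - b) (E 0 0) (E 1 1))|
  exact: (congr2 (fun a b => a + b) (E 0 1) (E 1 0))].
Qed.

Lemma smooth_slice t s : csmooth (slice t s).
Proof. by apply: smooth_cfield => i; exact: smooth_section. Qed.

Lemma smooth_dslice t s : csmooth (dslice t s).
Proof.
apply: smooth_cfield => i.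
exact: (@smooth_section _ _ (fun p => 'D_e_t (F s i) p) t (smooth_derive _ (sF s i))).
Qed.

Lemma near_pos t : 0 < t -> \near t, 0 <= t.
Proof. by move=> t0; apply: filterS (lt_nbhsr t0) => y /ltW. Qed.

(** The transition law is differentiated in t. It is known for nonnegative times only, hence near t
    as soon as t > 0. *)
Lemma tensor_dslice t : 0 < t -> tensor 1 0 (dslice t).
Proof.
move=> t0; split=> [s|x x0]; first exact: smooth_dslice.
set y := transition kappa x; rewrite expr0z mulr1 expr1z.
have dt s i z := is_derive_time (smooth_differentiable (sF s i) (t, z)).
have nr : \near t, slice t false x = jac kappa x * slice t true y.
  apply: filterS (near_pos t0) => t' t'0; have [_ ->] := tensor_slice t'0 => //.
  by rewrite expr0z mulr1 expr1z.
have nre : \near t, F false 0 (t, x) =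
    Re (jac kappa x) * F true 0 (t, y) - Im (jac kappa x) * F true 1 (t, y).
  by apply: filterS nr => t' /(congr1 (@complex.Re R)); rewrite reM.
have nim : \near t, F false 1 (t, x) =
    Re (jac kappa x) * F true 1 (t, y) + Im (jac kappa x) * F true 0 (t, y).
  by apply: filterS nr => t' /(congr1 (@complex.Im R)); rewrite imM.
have dV s i z : 'D_1 (fun t' => F s i (t', z)) t = 'D_e_t (F s i) (t, z).
  by have h := dt s i z; exact: derive_val.
have dD s i z : derivable (fun t' => F s i (t', z)) t 1.
  by have h := dt s i z; exact: ex_derive.
apply: complex_eqP; rewrite ?reM ?imM /= -!dV.
- rewrite (near_eq_derive _ nre) ?oner_neq0 // deriveB; [|exact: derivableZ|exact: derivableZ].
  by rewrite !deriveZ.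
- rewrite (near_eq_derive _ nim) ?oner_neq0 // deriveD; [|exact: derivableZ|exact: derivableZ].
  by rewrite !deriveZ.
Qed.


Lemma cfield_disc_bound (G : bool -> 'I_2 -> R * (R * R) -> R) (T : R) :
  (forall s i, smooth (G s i)) -> exists2 M, 0 <= M &
  forall t, 0 <= t <= T -> forall s x, kappa * (x.1 ^+ 2 + x.2 ^+ 2) <= 1 ->
    normc (cfield (fun i x => G s i (t, x)) x) <= M.
Proof.
move=> sG.
have b s i : {M | 0 <= M & forall t x, 0 <= t <= T -> `|x.1| <= disc_box kappa ->
    `|x.2| <= disc_box kappa -> `|G s i (t, x)| <= M}.
  by apply: cid2; apply: bounded_time_box; exact: smooth_continuous.
pose M s i := let: exist2 M _ _ := b s i in M.
have M0 s i : 0 <= M s i by rewrite /M; case: (b s i).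
have hM s i t x : 0 <= t <= T -> `|x.1| <= disc_box kappa ->
    `|x.2| <= disc_box kappa -> `|G s i (t, x)| <= M s i.
  by rewrite /M; case: (b s i) => M' _; exact.
exists ((M false 0 + M false 1) + (M true 0 + M true 1)); first by rewrite !addr_ge0.
move=> t tT s x /(disc_in_box kappa0)[x1 x2].
apply: (le_trans (normc_le2 _)); rewrite /cfield /=.
have := lerD (hM s 0 t x tT x1 x2) (hM s 1 t x tT x1 x2).
have := addr_ge0 (M0 false 0) (M0 false 1); have := addr_ge0 (M0 true 0) (M0 true 1).
by case: s => *; lra.
Qed.

(** [db] of a vector field has total weight 0, so a bound on the two discs, obtained by compactness
    of [0, T] times a disc, is a bound on the whole chart. It supplies the majorant for
    differentiation under the integral sign. *)
Lemma strain_bound (T : R) : exists2 M, 0 <= M &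
  (forall t x, 0 <= t <= T -> normc (db (slice t false) x) <= M) /\
  (forall t x, 0 < t <= T -> normc (db (dslice t false) x) <= M).
Proof.
have [M1 M10 h1] := cfield_disc_bound T smooth_strain.
have [M2 M20 h2] := @cfield_disc_bound (fun s i p => 'D_e_t (strain s i) p) T
  (fun s i => smooth_derive _ (smooth_strain s i)).
have bd (f : bool -> R * R -> C) M : 0 <= M -> tensor 1 (-1) f ->
    (forall s x, kappa * (x.1 ^+ 2 + x.2 ^+ 2) <= 1 -> normc (f s x) <= M) ->
    forall x, normc (f false x) <= M.
  move=> M0 [_ tf] fM x; have := transforms_bound kappa0 tf M0 fM x.
  by rewrite (_ : 1 + -1 = 0) // expr0 mul1r expr0z mulr1.
exists (M1 + M2); first exact: addr_ge0.
split=> t x /andP[t0 tT].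
- apply: (@le_trans _ _ M1); last by rewrite lerDl.
  apply: (bd (fun s => db (slice t s))) => //.
    by apply: tensor_db => //; exact: tensor_slice.
  by move=> s y hy; rewrite db_slice; apply: h1 => //; rewrite t0.
- apply: (@le_trans _ _ M2); last by rewrite lerDr.
  apply: (bd (fun s => db (dslice t s))) => //.
    by apply: tensor_db => //; exact: tensor_dslice.
  by move=> s y hy; rewrite db_dslice; apply: h2 => //; rewrite (ltW t0).
Qed.

Local Notation pairing := (pairing kappa).

Definition density t x : R := Re (lam2 x * (cj (db (slice t false) x) * db (slice t false) x)).
Definition ddensity t x : R :=
  2 * Re (lam2 x * (cj (db (slice t false) x) * db (dslice t false) x)).

Lemma is_derive_density t x : is_derive t (1 : R) (density ^~ x) (ddensity t x).
Proof.
have e : (density ^~ x) = fun t => lr x ^+ 2 * (strain false 0 (t, x) * strain false 0 (t, x) +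
    strain false 1 (t, x) * strain false 1 (t, x)).
  apply/funext => t'; rewrite /density db_slice lam2_lr // /cfield.
  by move: (lr x) (strain _ 0 _) (strain _ 1 _) => *; rewrite /=; ring.
have D i := is_derive_time (smooth_differentiable (smooth_strain false i) (t, x)).
have D0 := D 0; have D1 := D 1.
have DM i := is_deriveM (D i) (D i).
have DS := is_deriveD (DM 0) (DM 1).
have DZ := is_deriveZ (lr x ^+ 2) DS.
have e' : (density ^~ x) = (lr x ^+ 2) \*: ((strain false 0 \o (fun t => (t, x))) * (strain false 0 \o (fun t => (t, x))) + (strain false 1 \o (fun t => (t, x))) * (strain false 1 \o (fun t => (t, x)))).
  by rewrite e.
rewrite e'; apply: (is_derive_eq DZ).
rewrite /ddensity db_slice db_dslice lam2_lr // /cfield /GRing.scale.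
move: (lr x) (strain _ 0 _) (strain _ 1 _) ('D_e_t (strain _ 0) _) ('D_e_t (strain _ 1) _).
by move=> l a b a' b' /=; ring.
Qed.


Lemma normc_density_bound (c e : C) (M : R) x : normc c <= M -> normc e <= M ->
  `|Re (lam2 x * (cj c * e))| <= M ^+ 2 * Re (lam2 x).
Proof.
move=> cM eM; apply: (le_trans (normc_re _)); rewrite lam2_lr //.
move: (sqr_ge0 (lr x)); move: (lr x ^+ 2) => l l0.
rewrite normcM normc_real ger0_norm // mulrC ler_wpM2r // normcM normc_conj.
by rewrite expr2 ler_pM // normc_ge0.
Qed.

Lemma integrable_density t : 0 <= t -> plane_integrable (density t).
Proof.
move=> t0; have tq := tensor_db kappa0 (tensor_slice t0).
exact: (pairing_integrable kappa0 tq (tensor_eq tq erefl erefl (fun s x => erefl))).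
Qed.

Lemma integrable_lam2 : plane_integrable (fun x => Re (lam2 x)).
Proof. exact: (tensor_integrable kappa0 (tensor_lam2 kappa0)). Qed.

Lemma is_derive_deformation t : 0 < t ->
  is_derive t (1 : R) (fun t => deformation kappa (slice t))
    (2 * pairing (fun s => db (slice t s)) (fun s => db (dslice t s))).
Proof.
move=> t0; have [M M0 [b1 b2]] := strain_bound (t + 1).
pose G x := 2 * M ^+ 2 * Re (lam2 x).
have dE t' x : partial1of2 density t' x = ddensity t' x.
  have h := is_derive_density t' x; rewrite partial1of2E; exact: derive_val.
have l0 x : 0 <= Re (lam2 x) by rewrite lam2_lr //; exact: sqr_ge0.
have G0 x : 0 <= G x by rewrite /G !mulr_ge0 // sqr_ge0.
have iG : mu2.-integrable setT (EFin \o G) by exact: plane_integrableZ integrable_lam2.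
have It : t \in `]0, t + 1[ by rewrite in_itv /= t0 ltrDl ltr01.
have cv := @cvg_differentiation_under_integral R _ _ mu2 density setT measurableT t 0 (t + 1) It.
have {}cv := cv _ _ G G0 iG.
have c1 : forall t', [set` `]0, t + 1[] t' -> mu2.-integrable setT (EFin \o density t').
  by move=> t' /=; rewrite in_itv /= => /andP[/ltW t'0 _]; exact: integrable_density.
have c2 : forall t' x, [set` `]0, t + 1[] t' -> setT x -> derivable (density ^~ x) t' 1.
  by move=> t' x _ _; have h := is_derive_density t' x; exact: ex_derive.
have c3 : forall t' x, [set` `]0, t + 1[] t' -> setT x -> `|partial1of2 density t' x| <= G x.
  move=> t' x /=; rewrite in_itv /= => /andP[t'0 t'1] _; rewrite dE /ddensity /G normrM.
  rewrite ger0_norm // -mulrA ler_wpM2l // normc_density_bound //.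
    by rewrite b1 // ltW // ltW.
  by rewrite b2 // t'0 ltW.
have {}cv := cv c1 c2 c3.
have tq := tensor_db kappa0 (tensor_slice (ltW t0)).
have tdq := tensor_db kappa0 (tensor_dslice t0).
have ip := pairing_integrable kappa0 tq (tensor_eq tdq erefl erefl (fun s x => erefl)).
have L : plane_int (partial1of2 density t) =
    2 * pairing (fun s => db (slice t s)) (fun s => db (dslice t s)).
  rewrite /pairing -plane_intZ //; congr plane_int; apply/funext => x; exact: dE.
have cv' : (fun h : R => h^-1 *: ((fun t => deformation kappa (slice t)) (h *: 1 + t) -
    deformation kappa (slice t))) @ 0^' --> plane_int (partial1of2 density t).
  have -> : (fun h : R => h^-1 *: ((fun t => deformation kappa (slice t)) (h *: 1 + t) -
    deformation kappa (slice t))) = (fun h : R => h^-1 *: (plane_int (density (h + t)) - plane_int (density t))).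
    by apply/funext => h; rewrite /= [h *: 1]mulr1.
  exact: cv.
rewrite -L; apply: DeriveDef; first by apply/cvg_ex; eexists; exact: cv'.
exact: cvg_lim cv'.
Qed.

End TimeEvolution.

(** Gronwall: Q(t) exp(a t) is nonincreasing. Time 1 serves as origin because the differential
    inequality is available for t > 0 only. *)
Lemma exponential_decay (R : realType) (Q Q' : R -> R) (a : R) :
  (forall t : R, 0 < t -> is_derive t (1 : R) Q (Q' t)) ->
  (forall t : R, 0 < t -> Q' t <= - (a * Q t)) ->
  forall t : R, 1 <= t -> Q t <= Q 1 * expR a * expR (- (a * t)).
Proof.
move=> dQ Qa t; rewrite le_eqVlt => /orP[/eqP <-|t1].
  by rewrite mulr1 -mulrA -expRD subrr expR0 mulr1.
pose g s := Q s * expR (a * s).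
have dg (s : R) : 0 < s -> is_derive s (1 : R) g ((Q' s + a * Q s) * expR (a * s)).
  move=> s0; have d1 := dQ s s0.
  have d2 : is_derive s (1 : R) (fun r => expR (a * r)) (expR (a * s) * a).
    have d3 : is_derive s (1 : R) (fun r : R => a * r) a.
      have d := is_deriveZ a (is_derive_id s (1 : R)).
      by apply: (is_derive_eq d); rewrite /GRing.scale /= mulr1.
    have := @is_derive1_comp R expR (fun r => a * r) s _ _ (is_derive_expR _) d3.
    exact.
  have d4 := is_deriveM d1 d2; apply: (is_derive_eq d4).
  by rewrite /GRing.scale /=; ring.
have pos (s : R) : s \in `]1, t[ -> 0 < s.
  by rewrite in_itv /= => /andP[s1 _]; exact: lt_trans s1.
have cg : {within `[1, t], continuous g}.
  apply: continuous_in_subspaceT => s; rewrite inE /= in_itv /= => /andP[s1 _].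
  apply: differentiable_continuous; apply/derivable1_diffP.
  by have d := dg s (lt_le_trans ltr01 s1); exact: ex_derive.
have [c ct E] := MVT t1 (fun s st => dg s (pos s st)) cg.
have : g t <= g 1.
  rewrite -subr_le0 E mulr_le0_ge0 ?subr_ge0 ?(ltW t1) // mulr_le0_ge0 ?expR_ge0 //.
  by have := Qa c (pos c ct); lra.
rewrite /g mulr1 expRN => h.
by rewrite ler_pdivlMr ?expR_gt0.
Qed.

(** * The balance law of the deformation *)

Section Decay.
Variables (R : realType) (kappa mu : R).
Hypotheses (kappa0 : 0 < kappa) (mu0 : 0 < mu).
Local Notation C := R[i].
Local Notation d := (dc (-'i%C)).
Local Notation db := (dc ('i%C)).
Local Notation cj := conjc.
Local Notation tensor := (tensor kappa).
Local Notation lam2 := (lam2 kappa).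
Local Notation lap := (lap kappa).
Local Notation curl := (curl kappa).
Local Notation pairing := (pairing kappa).
Implicit Types (x : R * R) (s : bool) (t : R).

(** Here [v] stands for the time derivative of [w] and [pi] for the total head. An integration by
    parts pairs the equation of motion with [lap w]; the convection and the gradient drop out, and
    only viscosity remains. *)
Lemma pairing_dissipation (w v pi : bool -> R * R -> C) : tensor 1 0 w -> tensor 1 0 v ->
  tensor 0 0 pi -> (forall s x, Im (pi s x) = 0) -> (forall s x, Re (curl w s x) = 0) ->
  (forall x, lam2 x * v false x = mu%:C%C * (lam2 x * lap w false x) -
     curl w false x * (lam2 x * w false x) - db (pi false) x) ->
  pairing (fun s => db (w s)) (fun s => db (v s)) = - (mu * dissipation kappa w).
Proof.
move=> tw tv tpi pi0 c0 E.
have tl := tensor_lap kappa0 tw; have tll := tensor_lam2w kappa0 tl.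
have tlw := tensor_lam2w kappa0 tw; have tc := tensor_curl kappa0 tw.
have tclw := tensorM kappa0 tc tlw; have tdp := tensor_db kappa0 tpi.
rewrite -[LHS]opprK -(pairing_lap kappa0 tw tv); congr (- _).
have I1 := pairing_lap_curl kappa0 tw c0.
have I2 := pairing_lap_grad kappa0 tw tpi c0 pi0.
rewrite (@eq_pairing _ _ _ _ (lap w) (fun s x => mu%:C%C * (lam2 x * lap w s x) +
   ((-1)%:C%C * (curl w s x * (lam2 x * w s x)) + (-1)%:C%C * db (pi s) x))); last first.
  move=> x; congr (Re (_ * (_ * _))); rewrite E (rmorphN (real_complex R)) /=.
  by rewrite rmorph1 !mulN1r addrA.
have t1 := tensor_eq (tensorZ mu%:C%C tll) (erefl _) (erefl _) (fun s x => erefl).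
rewrite (@pairingDr _ _ kappa0 1 0) //.
- rewrite (@pairingZr _ _ kappa0 1 0) // (@pairingDr _ _ kappa0 1 0) //.
  + rewrite !(@pairingZr _ _ kappa0 1 0) //.
    by rewrite I1 I2 !mulr0 !addr0.
  + exact: tensorZ.
  + exact: tensorZ.
- exact: tensorD (tensorZ _ tclw) (tensorZ _ tdp).
Qed.

End Decay.

(** At t > 0 the constraint 0 <= t + h holds for all small h, so the restricted filter is the
    punctured neighbourhood of 0 and the limit is the ordinary derivative. *)
Lemma dt_derive (R : realType) (f F : R -> R) (t D : R) : 0 < t ->
  (forall s : R, 0 <= s -> F s = f s) -> is_derive t (1 : R) F D -> dt f t = D.
Proof.
move=> t0 Ff dF.
have nt : \forall h \near (0 : R)^', 0 <= t + h.
  have n0 : \forall h \near (0 : R), - t < h by apply: lt_nbhsr; rewrite oppr_lt0.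
  apply: cvg_within; apply: filterS n0 => h; lra.
rewrite /dt.
have -> : within [set h : R | 0 <= t + h] (0 : R)^' = (0 : R)^'.
  apply/funext => B; apply/propext; split => h.
    by apply: filterS2 nt h => s s0; exact.
  by apply: filterS h => s Bs _.
have c : (fun h : R => h^-1 *: (F (h *: 1 + t) - F t)) @ 0^' --> D.
  have /cvg_ex[l cl] := @ex_derive _ _ _ _ _ _ _ dF.
  have <- : l = D by rewrite -(@derive_val _ _ _ _ _ _ _ dF); apply/esym; exact: cvg_lim cl.
  exact: cl.
apply: cvg_lim => //; apply: cvg_trans c; apply: near_eq_cvg.
apply: filterS nt => h th /=.
by rewrite [h *: 1]mulr1 (addrC h) (Ff _ th) (Ff _ (ltW t0)).
Qed.

(** * Decay of the deformation along a Navier-Stokes flow *)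

Section Main.
Variables (R : realType) (kappa mu : R).
Hypotheses (kappa0 : 0 < kappa) (mu0 : 0 < mu).
Local Notation C := R[i].
Local Notation d := (dc (-'i%C)).
Local Notation db := (dc ('i%C)).
Local Notation cj := conjc.
Local Notation tensor := (tensor kappa).
Local Notation lam2 := (lam2 kappa).
Local Notation ilam2 := (ilam2 kappa).
Local Notation lr := (lr kappa).
Local Notation lap := (lap kappa).
Local Notation curl := (curl kappa).
Local Notation pairing := (pairing kappa).
Local Notation quad := (quad kappa).
Local Notation field_comp := (field_comp kappa).
Local Notation mu2 := (@lebesgue_measure R \x @lebesgue_measure R)%E.
Implicit Types (x : R * R) (s : bool) (t : R).

Section Solution.
Variables (u : R -> 'rV[R]_3 -> 'rV[R]_3) (p : R -> 'rV[R]_3 -> R).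
Hypothesis ns : navier_stokes kappa mu u p.
Variable F : bool -> 'I_2 -> R * (R * R) -> R.
Hypothesis sF : forall s i, smooth (F s i).
Hypothesis FE : forall s i t x, 0 <= t -> F s i (t, x) = components (chart kappa s) (u t) i x.
Variable P : bool -> R * (R * R) -> R.
Hypothesis sP : forall s, smooth (P s).
Hypothesis PE : forall s t x, 0 <= t -> P s (t, x) = p t (chart kappa s x).

Lemma sliceE t s x : 0 <= t -> slice F t s x = field_comp (u t) s x.
Proof. by move=> t0; rewrite /slice /field_comp /cfield !FE. Qed.

Lemma components_slice t s i : 0 <= t ->
  components (chart kappa s) (u t) i = fun x => F s i (t, x).
Proof. by move=> t0; apply/funext => x; rewrite FE. Qed.

Lemma smooth_components t s i : 0 <= t -> smooth (components (chart kappa s) (u t) i).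
Proof. by move=> t0; rewrite components_slice //; exact: smooth_section. Qed.

Lemma tensor_slice_u t : 0 <= t -> tensor 1 0 (slice F t).
Proof.
move=> t0; have := @tensor_field _ _ kappa0 (u t) (fun y sy => ns_tangent ns t0 sy)
  (fun s i => smooth_components s i t0).
by move/tensor_eq; apply => // s x; rewrite sliceE.
Qed.

Lemma curl_slice t s x : 0 <= t -> Re (curl (slice F t) s x) = 0.
Proof.
move=> t0; rewrite /curl.
have -> : slice F t s = cfield (components (chart kappa s) (u t)).
  by apply/funext => y; exact: sliceE.
rewrite (curl_cfield kappa0 s) /=; first exact: (ns_incompressible ns).
by move=> i; exact: smooth_components.
Qed.

(** The Bernoulli head p + |u|^2 / 2. *)
Definition head t s x : C :=
  (P s (t, x))%:C%C + lam2 x * (cj (slice F t s x) * slice F t s x) / 2.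

Lemma head_real t s x : Im (head t s x) = 0.
Proof.
rewrite /head lam2_lr //; move: (lr x) (slice F t s x) (P _ _) => l [w1 w2] q.
by rewrite /=; field.
Qed.

Lemma tensor_head t : 0 <= t -> tensor 0 0 (head t).
Proof.
move=> t0; have tw := tensor_slice_u t0.
have tp : tensor 0 0 (fun s x => (P s (t, x))%:C%C).
  split=> [s|x x0]; first by apply: csmooth_real; exact: smooth_section.
  by rewrite !expr0z !mul1r !PE // (chart_transition kappa0 x0).
have te := tensorM kappa0 (tensor_lam2 kappa0) (tensorM kappa0 (tensorJ tw) tw).
apply: (tensorD tp).
exact: (tensor_eq (tensorM kappa0 te (tensor_cst00 kappa 2^-1)) erefl erefl (fun s x => erefl)).
Qed.

Lemma momentum t x : 0 < t -> lam2 x * dslice F t false x =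
  mu%:C%C * (lam2 x * lap (slice F t) false x) -
  curl (slice F t) false x * (lam2 x * slice F t false x) - db (head t false) x.
Proof.
move=> t0; have t0' := ltW t0; set U := components (chart kappa false) (u t).
have sU i : smooth (U i) by exact: smooth_components.
have dU y : divergence (chart kappa false) U y = 0 by exact: (ns_incompressible ns).
have wU : slice F t false = cfield U by apply/funext => y; exact: sliceE.
have E i : 'D_((1, 0) : R * (R * R)) (F false i) (t, x) =
    mu * opL (chart kappa false) U i x - nabla (chart kappa false) U U i x
    - grad (chart kappa false) (fun y => P false (t, y)) i x.
  have dF := is_derive_time (smooth_differentiable (sF false i) (t, x)).
  have := ns_momentum ns false i x t0' => /=.
  rewrite (dt_derive t0 _ dF); last by move=> t' t'0; exact: FE.
  rewrite -/U (_ : (fun z => p t (chart kappa false z)) = (fun y => P false (t, y))); last first.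
    by apply/funext => y; rewrite PE.
  by lra.
have Ec : dslice F t false x =
   mu%:C%C * (opL (chart kappa false) U 0 x +i* opL (chart kappa false) U 1 x)%C -
   (nabla (chart kappa false) U U 0 x +i* nabla (chart kappa false) U U 1 x)%C -
   (grad (chart kappa false) (fun y => P false (t, y)) 0 x +i*
    grad (chart kappa false) (fun y => P false (t, y)) 1 x)%C.
  rewrite /dslice /cfield; apply: complex_eqP; rewrite ?reD ?imD ?reN ?imN ?reM ?imM.
    by rewrite [LHS]E /=; ring.
  by rewrite [LHS]E /=; ring.
rewrite Ec -(opL_cfield kappa0 (s := false)) // (nabla_cfield kappa0) // (grad_cfield kappa0).
have sw := smooth_cfield sU.
have sPt : csmooth (fun y => (P false (t, y))%:C%C) by apply: csmooth_real; exact: smooth_section.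
have sE : csmooth (fun y => lam2 y * (cj (cfield U y) * cfield U y) / 2).
  apply: csmoothM; last exact: csmooth_cst.
  by apply: csmoothM; [exact: csmooth_lam2|apply: csmoothM => //; exact: csmoothJ].
have -> : db (head t false) x = db (fun y => (P false (t, y))%:C%C) x +
    db (fun y => lam2 y * (cj (cfield U y) * cfield U y) / 2) x.
  by rewrite /head wU dcD //; exact: csmooth_cdiff.
rewrite /curl /lap wU.
move: (db (fun y => (P _ _)%:C%C) x) (db (fun y => _ / 2) x) (twist _ _ (db _) x) (twist _ _ (cfield U) x).
have := lam2K kappa0 x; move: (lam2 x) (ilam2 x) (cfield U x) mu%:C%C => l il w m e dp de tq tw.
rewrite (_ : l * _ = m * (l * (il * tq)) - tw * (l * w) - (l * il) * de - (l * il) * dp); last by ring.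
by rewrite e; ring.
Qed.

(** The time derivative is - 2 mu times the dissipation, hence at most - 8 mu kappa times the
    deformation. Gronwall applies from time 1 on; on [0, 1] the deformation is bounded by
    [strain_bound]. *)
Lemma deformation_decay : exists B : R, forall t, 0 <= t ->
  deformation kappa (slice F t) <= B * expR (- (8 * mu * kappa * t)).
Proof.
pose Q t := deformation kappa (slice F t).
pose Q' t := 2 * pairing (fun s => db (slice F t s)) (fun s => db (dslice F t s)).
have dQ t : 0 < t -> is_derive t (1 : R) Q (Q' t).
  exact: (is_derive_deformation kappa0 sF tensor_slice_u).
have Q'Q t : 0 < t -> Q' t <= - (8 * mu * kappa * Q t).
  move=> t0; have tw := tensor_slice_u (ltW t0).
  rewrite /Q' (pairing_dissipation kappa0 tw (tensor_dslice sF tensor_slice_u t0)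
    (tensor_head (ltW t0)) (head_real t) (fun s x => curl_slice s x (ltW t0))
    (fun x => momentum x t0)).
  have := dissipation_deformation kappa0 tw; rewrite -/(Q t) => h.
  have := ler_wpM2l (ltW mu0) h; lra.
have dec := exponential_decay dQ Q'Q.
have [M M0 [bM _]] := strain_bound kappa0 sF tensor_slice_u 1.
pose B1 := M ^+ 2 * plane_int (fun x => Re (lam2 x)).
have QB t : 0 <= t <= 1 -> Q t <= B1.
  move=> t01; rewrite /B1 -plane_intZ; last exact: integrable_lam2.
  apply: le_Rintegral => //.
  - by apply: (integrable_density kappa0 tensor_slice_u); case/andP: t01.
  - by apply: plane_integrableZ; exact: integrable_lam2.
  - move=> x _; apply: le_trans (ler_norm _) _.
    by apply: (normc_density_bound kappa0); exact: bM.
pose a := 8 * mu * kappa.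
have a0 : 0 <= a by rewrite !mulr_ge0 // ltW.
have B10 : 0 <= B1.
  rewrite mulr_ge0 ?sqr_ge0 // plane_int_ge0 // => x.
  by rewrite lam2_lr //; exact: sqr_ge0.
(* On [0, 1] the factor exp(a (1 - t)) is at least 1, so this constant also covers the initial
   interval. *)
exists (B1 * expR a) => t t0; have [t1|t1] := leP t 1.
  apply: (le_trans (QB t _)); first by rewrite t0.
  rewrite -/a -[leRHS]mulrA -expRD; apply: ler_peMr => //.
  by rewrite -expR0 ler_expR subr_ge0 ler_piMr.
apply: (le_trans (dec t (ltW t1))); rewrite -/a ler_wpM2r ?expR_ge0 //.
by rewrite ler_wpM2r ?expR_ge0 // QB // ler01 lexx.
Qed.

End Solution.
End Main.

(** * The component orthogonal to the Killing fields *)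

Section Perp.
Variables (R : realType) (kappa : R).
Hypothesis kappa0 : 0 < kappa.
Local Notation C := R[i].
Local Notation d := (dc (-'i%C)).
Local Notation db := (dc ('i%C)).
Local Notation cj := conjc.
Local Notation tensor := (tensor kappa).
Local Notation lam2 := (lam2 kappa).
Local Notation lr := (lr kappa).
Local Notation curl := (curl kappa).
Local Notation pairing := (pairing kappa).
Local Notation quad := (quad kappa).
Local Notation field_comp := (field_comp kappa).
Local Notation mu2 := (@lebesgue_measure R \x @lebesgue_measure R)%E.
Implicit Types (x : R * R) (s : bool) (v : 'rV[R]_3 -> 'rV[R]_3).

Lemma twistB q (f g : R * R -> C) x : csmooth f -> csmooth g ->
  twist kappa q (fun y => f y - g y) x = twist kappa q f x - twist kappa q g x.
Proof.
by move=> sf sg; rewrite /twist dcB; [ring|exact: csmooth_cdiff|exact: csmooth_cdiff].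
Qed.

Lemma sphere_integral_inner (v w : 'rV[R]_3 -> 'rV[R]_3) :
  sphere_integral kappa (inner (chart kappa false) (components (chart kappa false) v)
    (components (chart kappa false) w)) = 0%E ->
  pairing (field_comp w) (fun s x => lam2 x * field_comp v s x) = 0.
Proof.
move=> h; rewrite /pairing /plane_int; apply: (@etrans _ _ (fine 0%E)) => //.
rewrite -[in RHS]h /sphere_integral; congr fine; apply: eq_integral => x _; congr EFin.
rewrite innerE // area_densityE // lam2_lr // /field_comp /cfield.
move: (lr x) (components _ v 0 x) (components _ v 1 x) (components _ w 0 x) (components _ w 1 x).
by move=> l a b c e /=; ring.
Qed.

Lemma vrot_norm2_enstrophy v (w : bool -> R * R -> C) : tensor 1 0 w ->
  (forall x, field_comp v false x = w false x) -> (forall x, Re (curl w false x) = 0) ->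
  vrot_norm2 kappa v = (enstrophy kappa w)%:E.
Proof.
move=> tw vw c0; have tc := tensor_curl kappa0 tw; have [sw _] := tw.
have ic := pairing_integrable kappa0 tc (tensor_eq tc erefl erefl (fun s x => erefl)).
rewrite /enstrophy /pairing /plane_int fineK; last exact: integrable_fin_num ic.
rewrite /vrot_norm2 /sphere_integral; apply: eq_integral => x _; congr EFin.
have wE : w false = cfield (components (chart kappa false) v).
  by apply/funext => y; rewrite -vw.
have sv i : smooth (components (chart kappa false) v i).
  have := sw false; rewrite wE => -[s1 s2].
  by have [->|->] := ord2P i.
have := c0 x; rewrite /curl wE (curl_cfield kappa0 false) // => dv.
have {}dv : divergence (chart kappa false) (components (chart kappa false) v) x = 0 := dv.
rewrite dv area_densityE // lam2_lr //; move: (vrot _ _ _) (lr x) => q l /=; ring.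
Qed.

End Perp.

Theorem theorem7p3 (R : realType) (kappa mu : R)
    (hkappa : 0 < kappa) (hmu : 0 < mu)
    (u uK uperp : R -> 'rV[R]_3 -> 'rV[R]_3) (p : R -> 'rV[R]_3 -> R)
    (hNS : navier_stokes kappa mu u p)
    (hdecomp : forall (t : R) (y : 'rV[R]_3), 0 <= t -> sphere kappa y ->
      u t y = uK t y + uperp t y)
    (huK : forall t : R, 0 <= t -> killing kappa (uK t))
    (huperp : forall t : R, 0 <= t -> orthogonal_to_killing kappa (uperp t)) :
  exists C : R, forall t : R, 0 <= t ->
    (vrot_norm2 kappa (uperp t) <= (C * expR (- (8 * mu * kappa * t)))%:E)%E.
Proof.
(* The smooth extensions are chosen for both charts and both components at once, as functions of the
   indices. *)
have hF s i : {F : R * (R * R) -> R | smooth F & forall t x, 0 <= t ->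
    F (t, x) = components (chart kappa s) (u t) i x}.
  by apply: cid2; have [F [sF FE]] := ns_smooth_u hNS s i; exists F.
have hP s : {P : R * (R * R) -> R | smooth P & forall t x, 0 <= t ->
    P (t, x) = p t (chart kappa s x)}.
  by apply: cid2; have [P [sP PE]] := ns_smooth_p hNS s; exists P.
pose F s i := s2val (hF s i); pose P s := s2val (hP s).
have sF s i : smooth (F s i) := s2valP (hF s i).
have FE s i t x : 0 <= t -> F s i (t, x) = components (chart kappa s) (u t) i x.
  exact: (s2valP' (hF s i)).
have sP s : smooth (P s) := s2valP (hP s).
have PE s t x : 0 <= t -> P s (t, x) = p t (chart kappa s x) by exact: (s2valP' (hP s)).
have [B hB] := deformation_decay hkappa hmu hNS sF FE sP PE.
have [K K0 hK] := korn hkappa.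
(* The enstrophy of the orthogonal component is deformation + 2 kappa energy, at most (1 + 2 kappa
   K) times the deformation by [korn]. *)
exists ((1 + 2 * kappa * K) * B) => t t0.
have tw := tensor_slice_u hkappa hNS sF FE t0; have [sw _] := tw.
have cw s x := curl_slice hkappa hNS sF FE s x t0.
set w := slice F t in tw sw cw *.
have [[tanK smK] killK] := huK t t0.
have twK := tensor_field hkappa tanK smK; have [swK _] := twK.
have kK s x := (killing_cov hkappa s (smK s)).1 (killK s) x.
(* Smoothness is known for u and for the Killing part, so the tensor of the orthogonal component is
   obtained as their difference. *)
pose wp s x := w s x - field_comp kappa (uK t) s x.
have twp : tensor kappa 1 0 wp by apply: tensorD => //; exact: tensorN.
have perpE s x : field_comp kappa (uperp t) s x = wp s x.
  rewrite /wp /w (sliceE FE) // (@field_compD _ _ _ (u t) (uK t) (uperp t)) //.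
    by rewrite addrC addKr.
  by apply: hdecomp => //; exact: sphere_chart.
(* [db] annihilates Killing fields, so the decay of the deformation of u passes at once to the
   orthogonal component. *)
have dbp s x : dc 'i%C (wp s) x = dc 'i%C (w s) x.
  rewrite dcB; [|exact: csmooth_cdiff|exact: csmooth_cdiff].
  by have [-> _] := kK s x; rewrite subr0.
have cp s x : complex.Re (curl kappa wp s x) = 0.
  have [_ hk] := kK s x; have hw := cw s x.
  by rewrite /curl twistB // reD reN hw hk subr0.
have orth v c0 c1 c2 : killing kappa v ->
    (forall s x, field_comp kappa v s x = quad kappa c0 c1 c2 s x) ->
    pairing kappa (quad kappa c0 c1 c2) (fun s x => lam2 kappa x * wp s x) = 0.
  move=> kv vE; have := sphere_integral_inner hkappa (huperp t t0 v kv) => <-.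
  by apply: eq_pairing => x; rewrite vE perpE.
have [v0 kv0 v0E] := killing_quad0 hkappa; have [v1 kv1 v1E] := killing_quad1 hkappa.
have [v2 kv2 v2E] := killing_quad2 hkappa.
have := hK wp twp (orth_quad hkappa twp cp (orth _ _ _ _ kv0 v0E) (orth _ _ _ _ kv1 v1E)
  (orth _ _ _ _ kv2 v2E)).
rewrite (vrot_norm2_enstrophy hkappa twp (perpE false) (cp false)).
have := deformation_enstrophy hkappa twp.
have -> : deformation kappa wp = deformation kappa w by apply: eq_pairing => x; rewrite dbp.
have := hB t t0; rewrite -/w => h1 h2 h3.
have h4 : enstrophy kappa wp = deformation kappa w + 2 * kappa * energy kappa wp by lra.
have k2 : 0 <= 2 * kappa by rewrite mulr_ge0 // ltW.
rewrite h4 lee_fin -[leRHS]mulrA; apply: le_trans (ler_wpM2l _ h1); last first.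
  by rewrite addr_ge0 // mulr_ge0.
by rewrite [leRHS]mulrDl mul1r lerD2l -[leRHS]mulrA ler_wpM2l.
Qed.
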